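(* Let $q\ge5$ be a prime number and let $\lambda\in\Omega$. The group algebra decomposition of $JS_\lambda$ with respect to $G$ does not depend on the choice of the generating vector. That is, if $\sigma$ and $\sigma'$ are two generating vectors of $G$ of type $(2,2,2,2q)$ representing the action of $G$ on $S_\lambda$, and if $$JS_\lambda\sim_{G,\sigma} B_1\times B_2\times B_3\times B_4\times B_5^2\times B_6^2,\qquad JS_\lambda\sim_{G,\sigma'} B_1'\times B_2'\times B_3'\times B_4'\times (B_5')^2\times (B_6')^2$$ are the corresponding group algebra decompositions, then, up to relabelling and up to isogeny, the non-zero factors together with their multiplicities are the same in both decompositions.
   Context: Let $q\ge 5$ be a prime and let $G=\langle r,s : r^{2q}=s^2=(sr)^2=1\rangle$ be the dihedral group of order $4q$. $\mathcal{F}_q$ denotes the family of compact Riemann surfaces of genus $q$ with exactly $4q$ automorphisms. Every $S\in\mathcal{F}_q$ has full automorphism group $\mathrm{Aut}(S)\cong G$, and the quotient map $S\to S/G\cong\mathbb{P}^1$ has exactly four branch values: three marked with $2$ and one marked with $2q$ (a branch value is marked with the order of the stabilizers of the points above it). The action of $G$ on $S$ can be represented by the generating vector $(s,sr^{-2},r^q,r^{q+2})$ (local monodromies with respect to a standard system of loops), and up to a Möbius transformation the branch values are $\infty,0,1$ (marked with $2$) and $\lambda$ (marked with $2q$), the entries corresponding to $\infty,0,1,\lambda$ in this order. The set of admissible parameters is $\Omega=\mathbb{C}-\{0,\pm1,\tfrac12,2,\gamma,\gamma^2\}$, where $\gamma\ne -1$ is a fixed complex number with $\gamma^3=-1$.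 For $\lambda\in\Omega$, $S_\lambda$ denotes the member of $\mathcal{F}_q$ (unique up to isomorphism) obtained in this way, and $JS_\lambda$ its Jacobian variety. A generating vector of $G$ of type $(2,2,2,2q)$ is a tuple $(c_1,c_2,c_3,c_4)$ of elements generating $G$, of orders $2,2,2,2q$, with $c_1c_2c_3c_4=1$. There is a unique topological class of actions of $G$ in genus $q$ with this signature, so every such vector $\sigma$ can be chosen to represent the action of $G$ on $S_\lambda$: there is an isomorphism $\psi_\sigma:G\to\mathrm{Aut}(S_\lambda)$ for which $\sigma$ is the tuple of local monodromies, with respect to a suitable system of loops and ordering of the three branch values marked with $2$. Representations: $V_1,V_2,V_3,V_4$ are the degree-one representations with $(r,s)\mapsto(1,1),(1,-1),(-1,1),(-1,-1)$, and for $1\le k\le q-1$, $V_{k+4}$ is given by $r\mapsto\mathrm{diag}(\omega_{2q}^k,\bar\omega_{2q}^k)$, $s\mapsto\left(\begin{smallmatrix}0&1\\1&0\end{smallmatrix}\right)$, with $\omega_t=\exp(2\pi i/t)$. The rational irreducible representations of $G$ are $W_i=V_i$ ($1\le i\le4$), and $W_5$, $W_6$, the sums of the Galois conjugates of $V_5$, $V_6$ respectively. Group algebra decomposition: an action of $G$ on $S_\lambda$ induces a homomorphism $\Phi:\mathbb{Q}[G]\to\mathrm{End}_{\mathbb{Q}}(JS_\lambda)$. Let $e_j$ be the central idempotent of $W_j$ and write $e_j=f_{j1}+\dots+f_{jn_j}$ with primitive orthogonal idempotents ($n_1=\dots=n_4=1$, $n_5=n_6=2$). Then $B_j$ is the abelian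 subvariety $\Phi(l f_{j1})(JS_\lambda)$, where $l$ is a positive integer with $\Phi(lf_{j1})\in\mathrm{End}(JS_\lambda)$; it is well defined up to isogeny, may be zero, and $JS_\lambda\sim_G B_1\times B_2\times B_3\times B_4\times B_5^2\times B_6^2$. The decomposition with respect to $\sigma$ is the one obtained from $\psi_\sigma$. The symbol $\sim$ denotes isogeny. *)

(* Defs.v *)
From HB Require Import structures.
From mathcomp Require Import all_boot all_order all_algebra all_fingroup.
From mathcomp Require Import mxrepresentation complex.
From mathcomp Require Import all_classical all_reals all_analysis.
Import numFieldNormedType.Exports.
Import Order.TTheory GRing.Theory Num.Theory.

Set Implicit Arguments.
Unset Strict Implicit.
Unset Printing Implicit Defensive.

Local Open Scope card_scope.
Local Open Scope classical_set_scope.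
Local Open Scope complex_scope.
Local Open Scope ring_scope.

(* Stating R[i] as a numClosedFieldType lets it inherit the normed topology
   (and complex differentiability) that the library attaches to such types. *)
Definition Cx (R : realType) : numClosedFieldType := R[i].

Definition cis (R : realType) (t : R) : Cx R := cos t +i* sin t.

Definition omega (R : realType) (t : nat) : Cx R := cis (2 * pi / t%:R).

Definition holo_at (R : realType) (h : Cx R -> Cx R) (z : Cx R) : Prop :=
  \forall w \near z, derivable h w 1.

(* A coordinate on chart_dom together with its inverse icoord; only the values
   of chart_coord on chart_dom and those of icoord on the image of chart_dom are
   meaningful. *)
Record chart (R : realType) (S : topologicalType) := Chart {
  chart_dom : set S;
  chart_coord : S -> Cx R;
  icoord : Cx R -> S
}.

Definition is_chart (R : realType) (S : topologicalType) (c : chart R S) :=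
  [/\ open (chart_dom c), open (chart_coord c @` chart_dom c),
      forall x, chart_dom c x -> icoord c (chart_coord c x) = x,
      {within chart_dom c, continuous (chart_coord c)} &
      {within chart_coord c @` chart_dom c, continuous (icoord c)}].

Record riemann_surface (R : realType) := RiemannSurface {
  rs_space :> topologicalType;
  rs_index : Type;
  rs_chart : rs_index -> chart R rs_space;
  rs_hausdorff : hausdorff_space rs_space;
  rs_connected : connected [set: rs_space];
  rs_is_chart : forall i, is_chart (rs_chart i);
  rs_cover : forall x, exists i, chart_dom (rs_chart i) x;
  rs_compat : forall i j x,
    chart_dom (rs_chart i) x -> chart_dom (rs_chart j) x ->
    holo_at (chart_coord (rs_chart j) \o icoord (rs_chart i))
            (chart_coord (rs_chart i) x)
}.

Section RiemannSurfaces.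
Variables (R : realType) (S : riemann_surface R).
Local Notation C := (Cx R).
Local Notation D i := (chart_dom (rs_chart (r:=S) i)).
Local Notation z i := (chart_coord (rs_chart (r:=S) i)).
Local Notation zi i := (icoord (rs_chart (r:=S) i)).

(* Holomorphy near x of a complex-valued function on S. *)
Definition holo_fun_at (f : S -> C) (x : S) : Prop :=
  forall i, D i x -> holo_at (f \o zi i) (z i x).

Definition holo_map (f : S -> S) : Prop :=
  continuous f /\
  forall i j x, D i x -> D j (f x) -> holo_at (z j \o f \o zi i) (z i x).

Definition surface_Aut : set (S -> S) := [set f | holo_map f /\
  exists g, [/\ holo_map g, cancel f g & cancel g f]].

(* A holomorphic 1-form is given by its coefficient in each chart, as a
   function on S: the form is (w i) d(z i) on D i.  The coefficient is extended by
   0 outside D i so that equal forms are equal functions. *)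
Definition is_form (w : rs_index S -> S -> C) : Prop :=
  [/\ forall i x, ~ D i x -> w i x = 0,
      forall i x, D i x -> holo_at (w i \o zi i) (z i x) &
      forall i j x, D i x -> D j x ->
        w i x = w j x * derive1 (z j \o zi i) (z i x)].

Definition form_pred : {pred rs_index S -> S -> C} := fun w => `[< is_form w >].

Lemma form_submod_closed : submod_closed form_pred.
Proof.
split.
  apply/asboolP; split=> [//|i x _|i j x _ _]; last by rewrite mul0r.
  by rewrite /holo_at; near=> w; exact: (@derivable_cst _ _ _ (0 : C)).
move=> a u v /asboolP[u0 uh uc] /asboolP[v0 vh vc]; apply/asboolP.
split=> [i x nD|i x Dx|i j x Dix Djx].
- by rewrite /= !fctE u0// v0// addr0 scaler0.
- apply: filterS2 (uh i x Dx) (vh i x Dx) => w du dv.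
  have -> : (a *: u + v) i \o zi i = a *: (u i \o zi i) + (v i \o zi i) by [].
  by apply: derivableD dv; exact: derivableZ.
- by rewrite /= !fctE (uc i j)// (vc i j)// mulrDl /GRing.scale/= mulrA.
Unshelve. all: by end_near. Qed.

HB.instance Definition _ :=
  GRing.isSubmodClosed.Build C (rs_index S -> S -> C) form_pred
    form_submod_closed.

Definition holo_form := {w : rs_index S -> S -> C | w \in form_pred}.

HB.instance Definition _ := [isSub of holo_form for @sval _ _].
HB.instance Definition _ := [Choice of holo_form by <:].
HB.instance Definition _ := [SubChoice_isSubLmodule of holo_form by <:].

Definition has_genus (g : nat) : Prop :=
  exists b : 'I_g -> holo_form,
    forall w : holo_form, exists! a : {ffun 'I_g -> C}, w = \sum_k a k *: b k.

Definition is_pullback (f : S -> S) (w w' : holo_form) : Prop :=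
  forall i j x, D i x -> D j (f x) ->
    val w' i x = val w j (f x) * derive1 (z j \o f \o zi i) (z i x).

(* Such a w' is unique, and exists as soon as f is holomorphic. *)
Definition pullback (f : S -> S) (w : holo_form) : holo_form :=
  xget 0 [set w' | is_pullback f w w'].

Definition is_path (T : topologicalType) (c : R -> T) : Prop :=
  {within `[0, 1]%classic, continuous c}.

Definition is_loop (T : topologicalType) (c : R -> T) : Prop :=
  is_path c /\ c 0 = c 1.

(* F is a primitive of w along c: locally, F = h o z o c where dh = w in the
   coordinate z. *)
Definition is_primitive (w : holo_form) (c : R -> S) (F : R -> C) : Prop :=
  forall t, 0 <= t <= 1 -> exists i (h : C -> C),
    [/\ D i (c t),
        (\forall u \near z i (c t),
           derivable h u 1 /\ derive1 h u = val w i (zi i u)) &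
        \forall t' \near t, 0 <= t' <= 1 -> F t' = h (z i (c t'))].

Definition is_integral (w : holo_form) (c : R -> S) (I : C) : Prop :=
  exists2 F, is_primitive w c F & I = F 1 - F 0.

End RiemannSurfaces.

Arguments surface_Aut {R} S f.

(* The torus tangent / lattice, both inside an ambient vector space E. *)
Record torus (R : realType) (E : lmodType (Cx R)) := Torus {
  tangent : set E;
  lattice : set E
}.

Section Tori.
Variables (R : realType).
Local Notation C := (Cx R).

(* Homomorphisms of complex tori, through their linear lifts to the tangent
   spaces. *)
Definition is_hom (E1 E2 : lmodType C) (T1 : torus E1) (T2 : torus E2)
    (F : E1 -> E2) : Prop :=
  [/\ forall a x y, tangent T1 x -> tangent T1 y ->
        F (a *: x + y) = a *: F x + F y,
      forall x, tangent T1 x -> tangent T2 (F x) &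
      forall x, lattice T1 x -> lattice T2 (F x)].

(* A surjective homomorphism tangent T1 / lattice T1 -> tangent T2 / lattice T2
   with finite kernel. *)
Definition is_isogeny (E1 E2 : lmodType C) (T1 : torus E1) (T2 : torus E2)
    (F : E1 -> E2) : Prop :=
  [/\ is_hom T1 T2 F,
      forall y, tangent T2 y ->
        exists2 x, tangent T1 x & lattice T2 (y - F x) &
      exists X : seq E1, forall x, tangent T1 x -> lattice T2 (F x) ->
        exists2 x0, x0 \in X & lattice T1 (x - x0)].

Definition isogenous (E1 E2 : lmodType C) (T1 : torus E1) (T2 : torus E2) :=
  exists F, is_isogeny T1 T2 F.

Definition nonzero (E : lmodType C) (T : torus E) : Prop :=
  exists2 x, tangent T x & x != 0.

(* The subtorus F(T) of T, for an endomorphism F of T. *)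
Definition im_torus (E : lmodType C) (T : torus E) (F : E -> E) : torus E :=
  Torus (F @` tangent T) (F @` tangent T `&` lattice T).

Definition prod_torus (I : Type) (E : lmodType C) (T : I -> torus E) :
    torus (I -> E : lmodType C) :=
  @Torus R (I -> E : lmodType C)
    [set x | forall i, tangent (T i) (x i)]
    [set x | forall i, lattice (T i) (x i)].

End Tori.

Section Jacobian.
Variables (R : realType) (S : riemann_surface R).
Local Notation C := (Cx R).

(* JS = H^0(S, Omega)^* / H_1(S, Z), where a 1-cycle acts by integration. *)
Definition jacobian_torus : torus (holo_form S -> C : lmodType C) :=
  @Torus R (holo_form S -> C : lmodType C)
    [set L | scalar L]
    [set L | exists n (c : 'I_n -> R -> S) (I : 'I_n -> holo_form S -> C),
       [/\ forall k, is_loop (c k),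
           forall k w, is_integral w (c k) (I k w) &
           forall w, L w = \sum_k I k w]].

Definition jac_push (f : S -> S) (L : holo_form S -> C) : holo_form S -> C :=
  fun w => L (pullback f w).

End Jacobian.

(* gT is the group < r, s : r^2q = s^2 = (sr)^2 = 1 >, of order 4q. *)
Definition is_dihedral (q : nat) (gT : finGroupType) (r s : gT) : Prop :=
  [/\ <<[set r; s]%SET>>%g = [set: gT]%SET, (r ^+ (2 * q)%N = 1)%g,
      (s ^+ 2 = 1)%g, ((s * r) ^+ 2 = 1)%g & #|gT| = (4 * q)%N].

Definition generating_vector (q : nat) (gT : finGroupType) (c : 'I_4 -> gT) :=
  [/\ <<[set c k | k : 'I_4]%SET>>%g = [set: gT]%SET,
      forall k : 'I_4, #[c k]%g = (if (k < 3)%N then 2 else 2 * q)%N &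
      (\prod_k c k = 1)%g].

Definition gen_vec (q : nat) (gT : finGroupType) (r s : gT) (k : 'I_4) : gT :=
  (tnth [tuple s; s * r ^- 2; r ^+ q; r ^+ (q + 2)%N] k)%g.

Definition gralg (gT : finGroupType) := {ffun gT -> rat}.

Definition gralg_mul (gT : finGroupType) (a b : gralg gT) : gralg gT :=
  [ffun g => \sum_h a h * b (h^-1 * g)%g].

Definition is_idempotent (gT : finGroupType) (f : gralg gT) : Prop :=
  gralg_mul f f = f.

Definition primitive_idempotent (gT : finGroupType) (f : gralg gT) : Prop :=
  [/\ is_idempotent f, f <> 0 &
      forall a b : gralg gT, is_idempotent a -> is_idempotent b ->
        gralg_mul a b = 0 -> gralg_mul b a = 0 -> f = a + b ->
        a = 0 \/ b = 0].

Section Representations.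
Variables (R : realType) (q : nat) (gT : finGroupType) (r s : gT).
Local Notation C := (Cx R).
Local Notation rep n := (mx_representation C [set: gT]%G n).

Definition rot_mx (k : nat) : 'M[C]_2 :=
  \matrix_(i, j) (if i != j then 0
                  else if i == 0 then omega R (2 * q)%N ^+ k
                  else (omega R (2 * q)%N)^* ^+ k).

Definition swap_mx : 'M[C]_2 := \matrix_(i, j) (i != j)%:R.

(* The complex irreducible constituents of W_(j+1).  For j < 4 this is V_(j+1).
   W_5 and W_6 consist of the Galois conjugates (omega |-> omega^m, with m
   prime to 2q) of V_5 and V_6, where r |-> diag(omega^k, conj omega^k) with
   k = 1 and k = 2 respectively. *)
Variant constituent (j : 'I_6) : forall n, rep n -> Prop :=
| ConstituentDeg1 (rho : rep 1) of
    (j < 4)%N & rho r = ((-1) ^+ j./2)%:M & rho s = ((-1) ^+ j)%:M :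
    constituent j rho
| ConstituentDeg2 (m : nat) (rho : rep 2) of
    (4 <= j)%N & coprime m (2 * q)%N &
    rho r = rot_mx (m * (j - 3))%N & rho s = swap_mx :
    constituent j rho.

Definition gralg_rep n (rho : rep n) (a : gralg gT) : 'M[C]_n :=
  \sum_g ratr (a g) *: rho g.

(* e acts as the identity on W_(j+1) and as 0 on the other W_(i+1). *)
Definition central_idempotent (j : 'I_6) (e : gralg gT) : Prop :=
  forall (i : 'I_6) n (rho : rep n), constituent i rho ->
    gralg_rep rho e = (i == j)%:R%:M.

End Representations.

Definition multiplicity (j : 'I_6) : nat := if (j < 4)%N then 1 else 2.

Section Decomposition.
Variables (R : realType) (S : riemann_surface R).
Variables (q : nat) (gT : finGroupType) (r s : gT).
Local Notation C := (Cx R).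
Local Notation E := (holo_form S -> C : lmodType C).

Definition iso_Aut (psi : gT -> S -> S) : Prop :=
  [/\ forall g h, psi (g * h)%g = psi g \o psi h,
      injective psi & range psi = surface_Aut S].

Definition Phi (psi : gT -> S -> S) (a : gralg gT) (L : E) : E :=
  \sum_g (ratr (a g) : C) *: (jac_push (psi g) L : E).

(* JS ~_G B_1 x B_2 x B_3 x B_4 x B_5^2 x B_6^2 for the action psi; B j stands
   for B_(j+1) and f j k for f_(j+1, k+1). *)
Definition group_algebra_decomposition (psi : gT -> S -> S)
    (B : 'I_6 -> torus E) : Prop :=
  (exists (e : 'I_6 -> gralg gT) (f : 'I_6 -> nat -> gralg gT)
          (l : 'I_6 -> nat),
     [/\ forall j, central_idempotent R q r s j (e j),
         forall j, e j = \sum_(k < multiplicity j) f j k,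
         forall j k, (k < multiplicity j)%N -> primitive_idempotent (f j k),
         forall j k k', (k < multiplicity j)%N -> (k' < multiplicity j)%N ->
           k <> k' -> gralg_mul (f j k) (f j k') = 0 &
         forall j, [/\ (0 < l j)%N,
           is_hom (jacobian_torus S) (jacobian_torus S)
             (Phi psi (f j 0%N *+ l j)) &
           B j = im_torus (jacobian_torus S) (Phi psi (f j 0%N *+ l j))]])
  /\ isogenous (jacobian_torus S)
       (prod_torus (fun i : {j : 'I_6 & 'I_(multiplicity j)} => B (tag i))).

End Decomposition.

Section Monodromy.
Variables (R : realType) (S : riemann_surface R).
Local Notation C := (Cx R).

(* The sphere C u {oo} is option C, with None = oo; sph0 and sphoo are its
   coordinates z and 1/z around 0 and around oo. *)
Definition sph0 (v : option C) : C := odflt 0 v.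
Definition sphoo (v : option C) : C := if v is Some a then a^-1 else 0.

Definition holo_to_sphere (p : S -> option C) : Prop :=
  forall x,
    if p x is Some _ then
      (\forall y \near x, p y <> None) /\ holo_fun_at (sph0 \o p) x
    else
      (\forall y \near x, p y <> Some 0) /\ holo_fun_at (sphoo \o p) x.

Definition marking (q : nat) (lambda : C) (v : option C) : nat :=
  if v \in [:: None; Some 0; Some 1] then 2%N
  else if v == Some lambda then (2 * q)%N else 1%N.

(* p is the quotient map S -> S/Aut(S) = P^1, with branch values oo, 0, 1
   (marked with 2) and lambda (marked with 2q). *)
Definition quotient_map (q : nat) (lambda : C) (p : S -> option C) : Prop :=
  [/\ holo_to_sphere p, range p = [set: option C],
      forall x y, p x = p y <-> exists2 f, surface_Aut S f & f x = y &
      forall x, [set f | surface_Aut S f /\ f x = x]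
                #= `I_(marking q lambda (p x))].

Definition path_cat (T : Type) (c d : R -> T) : R -> T :=
  fun t => if t <= 2^-1 then c (2 * t) else d (2 * t - 1).

Definition path_rev (T : Type) (c : R -> T) : R -> T := fun t => c (1 - t).

(* The positively oriented circle of radius e around v, in the coordinate
   z - a if v = a and 1/z if v = oo. *)
Definition circle (v : option C) (e : C) : R -> C := fun t =>
  if v is Some a then a + e * cis (2 * pi * t) else (e * cis (2 * pi * t))^-1.

Definition finite_branch (lambda : C) : seq C := [:: 0; 1; lambda].

(* The closed disc bounded by circle v e contains no branch value but v. *)
Definition small_radius (lambda : C) (v : option C) (e : C) : Prop :=
  0 < e /\
  forall a, a \in finite_branch lambda -> Some a <> v ->
    if v is Some b then e < `|a - b| else e * `|a| < 1.

Definition avoids (lambda : C) (c : R -> C) : Prop :=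
  forall t, 0 <= t <= 1 -> c t \notin finite_branch lambda.

Definition null_homotopic (lambda : C) (x0 : C) (c : R -> C) : Prop :=
  exists H : R * R -> C,
    [/\ {within `[0, 1]%classic `*` `[0, 1]%classic, continuous H},
        forall u, 0 <= u <= 1 -> avoids lambda (fun t => H (u, t)),
        forall t, 0 <= t <= 1 -> H (0, t) = c t /\ H (1, t) = x0 &
        forall u, 0 <= u <= 1 -> H (u, 0) = x0 /\ H (u, 1) = x0].

(* A standard system of loops in P^1 - {oo, 0, 1, lambda} based at x0: c k runs
   along a path to the neighbourhood of b k, once around b k in the positive
   sense and back, and c 0 c 1 c 2 c 3 is null-homotopic.  By a theorem of
   Artin such loops generate the fundamental group and are the image of a given
   geometric system under a braid. *)
Definition standard_system (lambda : C) (b : 'I_4 -> option C) (x0 : C)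
    (c : 'I_4 -> R -> C) : Prop :=
  (forall k, exists (d : R -> C) (e : C),
     [/\ small_radius lambda (b k) e, is_path d, avoids lambda d,
         d 0 = x0 /\ d 1 = circle (b k) e 0 &
         c k = path_cat (path_cat d (circle (b k) e)) (path_rev d)])
  /\ null_homotopic lambda x0
       (path_cat (path_cat (c 0) (c 1)) (path_cat (c 2) (c 3))).

(* The loop c k lifts to a path from y to psi (sigma k) y, y being a fixed
   point above x0. *)
Definition local_monodromies (gT : finGroupType) (lambda : C)
    (p : S -> option C) (psi : gT -> S -> S) (b : 'I_4 -> option C)
    (sigma : 'I_4 -> gT) : Prop :=
  exists (x0 : C) (c : 'I_4 -> R -> C) (y : S),
    [/\ standard_system lambda b x0 c, p y = Some x0 &
        forall k, exists c' : R -> S,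
          [/\ is_path c', c' 0 = y, c' 1 = psi (sigma k) y &
              forall t, 0 <= t <= 1 -> p (c' t) = Some (c k t)]].

Definition branch_order (lambda : C) (k : 'I_4) : option C :=
  tnth [tuple None; Some 0; Some 1; Some lambda] k.

(* sigma represents the action of the group on S, through the isomorphism
   psi. *)
Definition represents (gT : finGroupType) (lambda : C) (p : S -> option C)
    (sigma : 'I_4 -> gT) (psi : gT -> S -> S) : Prop :=
  iso_Aut psi /\
  exists tau : 'S_4, tau ord_max = ord_max /\
    local_monodromies lambda p psi (branch_order lambda \o tau) sigma.

Definition is_S_lambda (q : nat) (gT : finGroupType) (r s : gT) (lambda : C)
    (p : S -> option C) : Prop :=
  [/\ compact [set: S], has_genus S q, surface_Aut S #= `I_(4 * q)%N,
      quotient_map q lambda p &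
      exists2 psi : gT -> S -> S, iso_Aut psi &
        local_monodromies lambda p psi (branch_order lambda) (gen_vec q r s)].

End Monodromy.

Definition Omega (R : realType) (gamma : Cx R) : set (Cx R) :=
  [set x | x \notin [:: 0; 1; -1; 2^-1; 2; gamma; gamma ^+ 2]].

(* Main.v *)
(** Two actions psi and psi' of the group G on S have the same image Aut(S), so
    psi' = psi o alpha for an automorphism alpha of G.  It sends r to a power r^k with
    k prime to 2q and s to some s r^l, hence it fixes the W_j up to exchanging W_3
    and W_4.  So B' j is, for the action psi, the image of a primitive idempotent f'
    of the simple component of Q[G] that f belongs to, and there are x, y in Q[G]
    with x y = f and y x = f'.  Multiples of x and y with integral coefficients
    give homomorphisms between B and B' whose composites are multiplications by
    positive integers.

    Such a composite has a finite kernel because the period lattice lies in a finitely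
    generated group: locally, holomorphic forms have primitives, and on the overlaps
    of a suitable finite cover of the compact surface S two of them differ by one of
    finitely many constants.  The action on the Jacobian is by pullback of forms,
    which uses that the derivative of a holomorphic function is holomorphic.  Here
    holomorphic means complex differentiable in a neighbourhood, and both facts are
    derived from Goursat's theorem for Riemann sums: it yields the maximum principle,
    and the latter, applied to divided differences, gives removable singularities
    and Taylor expansions. *)

Require Import Defs.
From HB Require Import structures.
From mathcomp Require Import all_boot all_order all_algebra all_fingroup.
From mathcomp Require Import all_solvable all_field mxrepresentation complex.
From mathcomp Require Import all_classical all_reals all_analysis.
From mathcomp Require Import ring lra.
Import numFieldNormedType.Exports.
Import Order.TTheory GRing.Theory Num.Theory.

Set Implicit Arguments.
Unset Strict Implicit.
Unset Printing Implicit Defensive.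

Local Open Scope classical_set_scope.
Local Open Scope ring_scope.

(** No integral along an edge is formed. A Riemann sum over [3 ^ n] equal pieces is exactly additive
    when a square is cut into nine, because neighbouring squares sample a common side at the same
    points. Goursat's theorem thus becomes a statement about finite sums that are small for all
    large [n], and the integral [2 pi i] of [1 / (w - z)] is replaced by a lower bound 4 on
    imaginary parts.

    On the algebraic side, [W_5] and [W_6] are irreducible only over the rationals, whereas the
    computations take place in complex 2 by 2 matrices. A rational polynomial that vanishes at one
    primitive root of unity vanishes at all of the same order, so a single complex constituent is
    faithful on its rational component. Sending [r] to [r^k] permutes the conjugate constituents,
    and replacing [s] by [s r^l] is undone by a diagonal conjugation; it is visible only on the two
    characters with [r = -1], as the sign [(-1)^l].

    Kernels of isogenies are finite because [L / m L] is finite for every subgroup [L] of a finitely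
    generated abelian group. *)

Lemma between_exists (R : realType) (I : Type) (lo hi : I -> R) (i0 : I) :
  (forall i j, lo i <= hi j) -> exists l, forall i, lo i <= l <= hi i.
Proof.
move=> lohi; exists (sup (range lo)) => i.
have lo_sup : has_sup (range lo).
  by split; [exists (lo i0), i0|exists (hi i0) => _ [j _ <-]; exact: lohi].
apply/andP; split; first by apply: sup_upper_bound => //; exists i.
by apply: ge_sup => [|_ [j _ <-]]; [exists (lo i0), i0|exact: lohi].
Qed.

(** The intervals of radius [e i] around [u i] meet pairwise, so on the line they have a common
    point. The index type is arbitrary because the lemma serves for sequences and for difference
    quotients over a punctured disc. *)
Lemma cauchy_limit (R : realType) (I : Type) (u e : I -> R) (i0 : I) :
  (forall i j, `|u i - u j| <= e i + e j) ->
  exists l, forall i, `|u i - l| <= e i.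
Proof.
move=> uc; have [] := @between_exists R I (fun i => u i - e i)
    (fun i => u i + e i) i0 => [i j|l ul].
  by have := uc i j; rewrite ler_norml => /andP[? ?]; lra.
by exists l => i; have /andP[? ?] := ul i; rewrite ler_norml; apply/andP; lra.
Qed.

(** Continuation along a segment, by the supremum of the points reached. It replaces the choice of a
    fine subdivision, both in mean value estimates and in continuation along paths. *)
Lemma real_induction (R : realType) (P : R -> Prop) (a b : R) : a <= b -> P a ->
  (forall t, a <= t <= b -> exists2 d : R, 0 < d & forall s, a <= s <= b ->
     `|s - t| < d -> (s <= t -> P s -> P t) /\ (t <= s -> P t -> P s)) ->
  P b.
Proof.
move=> ab Pa step; pose X := [set t | a <= t <= b /\ P t].
have Xa : X a by split; rewrite ?lexx.
have supX : has_sup X by split; [exists a|exists b => t [/andP[]]].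
have aS : a <= sup X by apply: sup_upper_bound.
have Sb : sup X <= b by apply: ge_sup; [exists a|move=> t [/andP[]]].
have aSb : a <= sup X <= b by rewrite aS.
have [d d0 stepS] := step _ aSb.
have [t [tab Pt] St] := sup_adherent d0 supX.
have tS : t <= sup X by apply: sup_upper_bound.
have PS : P (sup X).
  by apply: (stepS t tab _).1 => //; rewrite distrC ger0_norm; lra.
have [Seb|Sneb] := eqVneq (sup X) b; first by rewrite -Seb.
have {Sneb}Sb' : sup X < b by rewrite lt_neqAle Sneb.
pose s := Num.min b (sup X + d / 2).
have sab : a <= s <= b by apply/andP; rewrite /s; case: (lerP b (sup X + d / 2)) => ?; split; lra.
have Ss : sup X < s by rewrite /s; case: (lerP b (sup X + d / 2)) => ?; lra.
have sd : s <= sup X + d / 2 by rewrite /s; case: (lerP b (sup X + d / 2)) => ?; lra.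
have Ps : P s by apply: (stepS s sab _).2 => //; rewrite ?ger0_norm; lra.
have : s <= sup X by apply: sup_upper_bound.
lra.
Qed.

(** * Real-valued modulus and coordinates on the complex plane *)

Section ComplexPlane.
Variable R : realType.
Local Notation C := (Cx R).
Implicit Types (z w a : C) (x y : R).

(* The norm of the library takes values in Cx R; nm is its real-valued version. *)
Definition nm z : R := ComplexField.Normc.normc z.
Definition re z : R := complex.Re z.
Definition im z : R := complex.Im z.
Definition rc x : C := Complex x 0.
Definition iu : C := Complex 0 1.

Lemma normcE_nm z : `|z| = rc (nm z). Proof. by []. Qed.

Lemma reD z w : re (z + w) = re z + re w. Proof. by case: z w => ? ? [? ?]. Qed.
Lemma imD z w : im (z + w) = im z + im w. Proof. by case: z w => ? ? [? ?]. Qed.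
Lemma reN z : re (- z) = - re z. Proof. by case: z. Qed.
Lemma imN z : im (- z) = - im z. Proof. by case: z. Qed.
Lemma reB z w : re (z - w) = re z - re w. Proof. by rewrite reD reN. Qed.
Lemma imB z w : im (z - w) = im z - im w. Proof. by rewrite imD imN. Qed.
Lemma reM z w : re (z * w) = re z * re w - im z * im w.
Proof. by case: z w => ? ? [? ?]. Qed.
Lemma imM z w : im (z * w) = re z * im w + im z * re w.
Proof. by case: z w => ? ? [? ?]. Qed.
Lemma re_rc x : re (rc x) = x. Proof. by []. Qed.
Lemma im_rc x : im (rc x) = 0. Proof. by []. Qed.
Lemma re_iu : re iu = 0. Proof. by []. Qed.
Lemma im_iu : im iu = 1. Proof. by []. Qed.
Definition ReImE := (reD, imD, reN, imN, reM, imM, re_rc, im_rc, re_iu, im_iu).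

Lemma Cx_ext z w : re z = re w -> im z = im w -> z = w.
Proof. by case: z w => ? ? [? ?]; rewrite /re /im /= => -> ->. Qed.

Lemma rcD x y : rc (x + y) = rc x + rc y.
Proof. by apply: Cx_ext; rewrite !ReImE ?addr0. Qed.
Lemma rcN x : rc (- x) = - rc x.
Proof. by apply: Cx_ext; rewrite !ReImE ?oppr0. Qed.
Lemma rcB x y : rc (x - y) = rc x - rc y. Proof. by rewrite rcD rcN. Qed.
Lemma rcM x y : rc (x * y) = rc x * rc y.
Proof. by apply: Cx_ext; rewrite !ReImE; ring. Qed.
Lemma rc0 : rc 0 = 0. Proof. by []. Qed.
Lemma rc1 : rc 1 = 1. Proof. by []. Qed.
Lemma rc_nat n : rc n%:R = n%:R.
Proof. by elim: n => [//|n ih]; rewrite -addn1 !natrD rcD ih. Qed.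
Lemma CxE z : z = rc (re z) + iu * rc (im z).
Proof. by apply: Cx_ext; rewrite !ReImE; ring. Qed.

Lemma nm0 : nm 0 = 0. Proof. exact: ComplexField.Normc.normc0. Qed.
Lemma nm1 : nm 1 = 1. Proof. exact: ComplexField.Normc.normc1. Qed.
Lemma nmM z w : nm (z * w) = nm z * nm w.
Proof. exact: ComplexField.Normc.normcM. Qed.
Lemma nmV z : nm z^-1 = (nm z)^-1. Proof. exact: ComplexField.Normc.normcV. Qed.
Lemma nmX z n : nm (z ^+ n) = nm z ^+ n.
Proof. by elim: n => [|n ih]; rewrite ?expr0 ?nm1// !exprS nmM ih. Qed.
Lemma nmN z : nm (- z) = nm z. Proof. exact: (@normcN R z). Qed.
Lemma nmD z w : nm (z + w) <= nm z + nm w. Proof. exact: (@le_normcD R z w). Qed.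
Lemma nmB z w : nm (z - w) = nm (w - z). Proof. by rewrite -opprB nmN. Qed.
Lemma nm_ge0 z : 0 <= nm z. Proof. by case: z => a b; exact: sqrtr_ge0. Qed.
Lemma nm_eq0 z : nm z = 0 -> z = 0. Proof. exact: ComplexField.Normc.eq0_normc. Qed.
Lemma nm_gt0 z : z != 0 -> 0 < nm z.
Proof.
by move=> z0; rewrite lt_neqAle nm_ge0 andbT eq_sym; apply: contraNneq z0 => /nm_eq0 ->.
Qed.
Lemma nm2E z : nm z ^+ 2 = re z ^+ 2 + im z ^+ 2.
Proof. by case: z => a b; rewrite sqr_sqrtr// addr_ge0 ?sqr_ge0. Qed.
Lemma nm_rc x : nm (rc x) = `|x|.
Proof. by rewrite /nm /= expr0n /= addr0 sqrtr_sqr. Qed.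
Lemma nm_iu : nm iu = 1.
Proof. by rewrite /nm /= expr0n /= add0r expr1n sqrtr1. Qed.
Lemma re_le_nm z : `|re z| <= nm z.
Proof.
by rewrite -(ler_pXn2r (n:=2))// ?nnegrE ?nm_ge0// nm2E real_normK ?num_real// lerDl sqr_ge0.
Qed.
Lemma im_le_nm z : `|im z| <= nm z.
Proof.
by rewrite -(ler_pXn2r (n:=2))// ?nnegrE ?nm_ge0// nm2E real_normK ?num_real// lerDr sqr_ge0.
Qed.
Lemma nm_le_reim z : nm z <= `|re z| + `|im z|.
Proof.
rewrite {1}(CxE z) (le_trans (nmD _ _))// nmM nm_iu mul1r !nm_rc//.
Qed.
Lemma nm_triangle z w a : nm (z - w) <= nm (z - a) + nm (a - w).
Proof. by apply: le_trans (nmD _ _); rewrite addrA subrK. Qed.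
Lemma nm_le_small z : (forall e : R, 0 < e -> nm z <= e) -> z = 0.
Proof.
move=> ze; apply: nm_eq0; apply/eqP; rewrite eq_le nm_ge0 andbT.
by apply/ler_addgt0Pr => e e0; rewrite add0r ze.
Qed.

(** The limit is found in each coordinate separately, which costs the factor 2. *)
Lemma Cx_cauchy_limit (I : Type) (u : I -> C) (e : I -> R) (i0 : I) :
  (forall i j, nm (u i - u j) <= e i + e j) ->
  exists l, forall i, nm (u i - l) <= 2 * e i.
Proof.
move=> ue.
have [|x ux] := @cauchy_limit R I (re \o u) e i0.
  by move=> i j; rewrite /= -reB (le_trans (re_le_nm _)).
have [|y uy] := @cauchy_limit R I (im \o u) e i0.
  by move=> i j; rewrite /= -imB (le_trans (im_le_nm _)).
exists (rc x + iu * rc y) => i; apply: le_trans (nm_le_reim _) _.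
have := ux i; have := uy i; rewrite /= !ReImE => ? ?.
have -> : re (u i) + - (x + (0 * y - 1 * 0)) = re (u i) - x by ring.
have -> : im (u i) + - (0 + (0 * 0 + 1 * y)) = im (u i) - y by ring.
lra.
Qed.

End ComplexPlane.

(** * Compactness of squares by nested subdivision *)

Section SquareInduction.
Variable R : realType.
Local Notation C := (Cx R).
Implicit Types (z w a : C) (x y S : R).

Lemma expr_unbounded (b : nat) x : (1 < b)%N -> exists n, x < b%:R ^+ n.
Proof.
move=> b1; have [x0|x0] := lerP 0 x; last by exists 0%N; rewrite expr0; lra.
exists (Num.bound x); apply: lt_le_trans (archi_boundP x0) _.
by rewrite -natrX ler_nat ltnW// ltn_expl.
Qed.

Definition sq a S : set C := fun w =>
  (re a <= re w <= re a + S) /\ (im a <= im w <= im a + S).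

Definition subcorner a S (i j : nat) : C :=
  a + rc (i%:R * (S / 3)) + iu R * rc (j%:R * (S / 3)).

Lemma re_subcorner a S i j : re (subcorner a S i j) = re a + i%:R * (S / 3).
Proof. by rewrite /subcorner !ReImE; ring. Qed.
Lemma im_subcorner a S i j : im (subcorner a S i j) = im a + j%:R * (S / 3).
Proof. by rewrite /subcorner !ReImE; ring. Qed.

Lemma sub_sq a S (i j : 'I_3) : 0 < S -> sq (subcorner a S i j) (S / 3) `<=` sq a S.
Proof.
move=> S0 w; rewrite /sq re_subcorner im_subcorner => -[].
have n3 (k : 'I_3) : 0 <= k%:R :> R /\ k%:R <= 2 :> R.
  by rewrite ler0n (ler_nat _ k 2) -ltnS.
have := n3 i; have := n3 j; move: (i%:R : R) (j%:R : R) => x y [? ?] [? ?].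
have ? : x * (S / 3) <= 2 * (S / 3) by rewrite ler_pM2r; lra.
have ? : y * (S / 3) <= 2 * (S / 3) by rewrite ler_pM2r; lra.
have ? : 0 <= x * (S / 3) by apply: mulr_ge0; lra.
have ? : 0 <= y * (S / 3) by apply: mulr_ge0; lra.
move=> /andP[? ?] /andP[? ?]; split; apply/andP; split; lra.
Qed.

Lemma sq_diam a S w z : sq a S w -> sq a S z -> nm (w - z) <= 2 * S.
Proof.
move=> [/andP[? ?] /andP[? ?]] [/andP[? ?] /andP[? ?]].
apply: le_trans (nm_le_reim _) _; rewrite !ReImE.
have ? : `|re w + - re z| <= S by rewrite ler_norml; apply/andP; split; lra.
have ? : `|im w + - im z| <= S by rewrite ler_norml; apply/andP; split; lra.
lra.
Qed.

(** If [P] fails on a square, it fails on one of its nine subsquares; the nested squares obtained in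
    this way shrink to a point, where the local hypothesis applies. Used for Goursat's theorem and
    for the boundedness of continuous functions. *)
Lemma square_induction (P : C -> R -> Prop) a0 S0 : 0 < S0 ->
  (forall a S, 0 < S -> (forall i j : 'I_3, P (subcorner a S i j) (S / 3)) -> P a S) ->
  (forall z, sq a0 S0 z -> exists2 d : R, 0 < d & forall a S, 0 < S < d ->
     sq a S z -> sq a S `<=` sq a0 S0 -> P a S) ->
  P a0 S0.
Proof.
move=> S00 glue loc; apply: contrapT => nP0.
(* The premises stand inside the existential so that [choice] yields a total step function; where
   they fail its value is arbitrary. *)
have step (aS : C * R) : exists bT : C * R, ~ P aS.1 aS.2 -> 0 < aS.2 ->
    [/\ ~ P bT.1 bT.2, bT.2 = aS.2 / 3 & sq bT.1 bT.2 `<=` sq aS.1 aS.2].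
  case: aS => a S /=; case: (pselect (0 < S)) => [S1|nS1]; last by exists (a, S).
  case: (pselect (forall i j : 'I_3, P (subcorner a S i j) (S / 3))) => [h|].
    by exists (a, S) => /(_ (glue _ _ S1 h)).
  case/existsNP => i; case/existsNP => j nP.
  by exists (subcorner a S i j, S / 3) => /= _ _; split=> //; exact: sub_sq.
have [f fP] := choice step; pose s n := iter n f (a0, S0).
have sS n : (s n).2 = S0 / 3 ^+ n /\ ~ P (s n).1 (s n).2.
  elim: n => [|n [ih1 ih2]]; first by rewrite expr0 divr1.
  have sn0 : 0 < (s n).2 by rewrite ih1 divr_gt0// exprn_gt0.
  rewrite /s iterS -/(s n); have [p1 p2 _] := fP _ ih2 sn0; split=> //.
  by rewrite p2 ih1 exprS; field; rewrite expf_neq0.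
have s_gt0 n : 0 < (s n).2 by rewrite (sS n).1 divr_gt0// exprn_gt0.
have nest n k : sq (s (k + n)%N).1 (s (k + n)%N).2 `<=` sq (s n).1 (s n).2.
  elim: k => [|k ih]; first by rewrite add0n.
  apply: subset_trans ih; rewrite addSn /s iterS.
  by have [] := fP _ (sS (k + n)%N).2 (s_gt0 _).
(* Of two squares, the smaller one has its opposite corners in the larger one. The coordinate
   intervals therefore meet pairwise, and [between_exists] gives each coordinate of the limit
   point. *)
pose top n : C := (s n).1 + rc (s n).2 + iu R * rc (s n).2.
have sq_corners n : sq (s n).1 (s n).2 (s n).1 /\ sq (s n).1 (s n).2 (top n).
  have := s_gt0 n; rewrite /sq /top !ReImE => ?.
  by split; split; apply/andP; split; lra.
have nestC m n : (sq (s n).1 (s n).2 (s m).1 /\ sq (s n).1 (s n).2 (top m)) \/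
                 (sq (s m).1 (s m).2 (s n).1 /\ sq (s m).1 (s m).2 (top n)).
  case: (leqP n m) => [/subnK <-|/ltnW/subnK <-]; [left|right].
    by have [? ?] := sq_corners (m - n + n)%N; split; apply: (nest n (m - n)%N).
  by have [? ?] := sq_corners (n - m + m)%N; split; apply: (nest m (n - m)%N).
have [x xP] : exists x, forall n, re (s n).1 <= x <= re (s n).1 + (s n).2.
  apply: (between_exists 0%N) => i j; have := s_gt0 i; have := s_gt0 j.
  case: (nestC i j); rewrite /sq /top !ReImE => -[[/andP[? ?] _] [/andP[? ?] _]]; lra.
have [y yP] : exists y, forall n, im (s n).1 <= y <= im (s n).1 + (s n).2.
  apply: (between_exists 0%N) => i j; have := s_gt0 i; have := s_gt0 j.
  case: (nestC i j); rewrite /sq /top !ReImE => -[[_ /andP[? ?]] [_ /andP[? ?]]]; lra.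
pose z : C := rc x + iu R * rc y.
have zP n : sq (s n).1 (s n).2 z.
  have := xP n; have := yP n; rewrite /sq /z !ReImE.
  by rewrite !mul0r !mul1r subr0 !addr0 !add0r => ? ?; split.
have [d d0 dP] := loc z (zP 0%N).
have [n nd] := expr_unbounded (S0 / d) (isT : (1 < 3)%N).
apply: (sS n).2; apply: dP (zP n) _; last by have := nest 0%N n; rewrite addn0.
rewrite s_gt0 (sS n).1 ltr_pdivrMr ?exprn_gt0//.
by rewrite mulrC -ltr_pdivrMr.
Qed.

End SquareInduction.

(** * Complex differentiability with explicit moduli *)

Section ComplexDerivative.
Variable R : realType.
Local Notation C := (Cx R).
Implicit Types (z w a d : C) (f g : C -> C).

Lemma Cx_gt0 (e : C) : 0 < e -> e = rc (re e) /\ 0 < re e.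
Proof.
case: e => x y e0; have := e0; rewrite (@ltcE R 0 (x +i* y)%C) /= => /andP[/eqP -> x0].
by split.
Qed.

Lemma rc_lt (x y : R) : (rc x < rc y) = (x < y).
Proof. exact: ltcR. Qed.

Lemma rc_le (x y : R) : (rc x <= rc y) = (x <= y).
Proof. exact: lecR. Qed.

Lemma Cx_nearP z (P : C -> Prop) :
  (\forall w \near z, P w) <->
  exists2 e : R, 0 < e & forall w, nm (w - z) < e -> P w.
Proof.
split=> [/nbhs_normP[/= e e0 eP]|[e e0 eP]].
  have [ee e0'] := Cx_gt0 e0; rewrite ee in eP; exists (re e) => // w wz.
  by apply: eP; rewrite /= normcE_nm nmB rc_lt.
apply/nbhs_normP; exists (rc e); first by rewrite /= -rc0 rc_lt.
by move=> w /=; rewrite normcE_nm nmB rc_lt; exact: eP.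
Qed.

(** The difference quotient is multiplied out, so [w = z] needs no exception and every estimate is
    an inequality between reals. *)
Definition cdiff f z d := forall e : R, 0 < e -> exists2 del : R, 0 < del &
  forall w, nm (w - z) < del -> nm (f w - f z - d * (w - z)) <= e * nm (w - z).

Lemma cdiffP f z d : is_derive (z : C^o) 1 (f : C^o -> C^o) d <-> cdiff f z d.
Proof.
split=> [[fz fd] e e0|fd].
  have /cvgrPdist_le /(_ (rc e)) : (fun h : C => h^-1 *: ((f \o shift z) (h *: (1 : C^o)) - f z)) @ 0^' --> d.
    by rewrite -fd; exact: fz.
  rewrite -rc0 rc_lt => /(_ e0); rewrite near_withinE => /Cx_nearP[del del0 dP].
  exists del => // w wz; have [->|wz0] := eqVneq w z.
    by rewrite !subrr mulr0 subrr nm0 mulr0.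
  have := dP (w - z); rewrite /= subr0 subr_eq0 => /(_ wz wz0).
  rewrite [(w - z) *: _]mulr1 subrK normcE_nm rc_le => h.
  have wz1 : w - z != 0 by rewrite subr_eq0.
  rewrite -ler_pdivrMr ?nm_gt0// -nmV -nmM; apply: le_trans h.
  rewrite -[leRHS]nmN le_eqVlt; apply/orP; left; apply/eqP; congr nm; rewrite /GRing.scale /=; field.
  by [].
have lim : (fun h : C => h^-1 *: ((f \o shift z) (h *: (1 : C^o)) - f z)) @ 0^' --> (d : C^o).
  apply/cvgrPdist_le => e /Cx_gt0[-> e0].
  have [del del0 dP] := fd _ e0.
  rewrite near_withinE; apply/Cx_nearP; exists del => // h; rewrite subr0 => hd h0.
  have := dP (h + z); rewrite addrK => /(_ hd) dP'.
  rewrite /= [h *: _]mulr1 normcE_nm rc_le.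
  have -> : d - h^-1 *: (f (h + z) - f z) = - ((f (h + z) - f z - d * h) * h^-1).
    by rewrite /GRing.scale /=; field.
  by rewrite nmN nmM nmV ler_pdivrMr ?nm_gt0.
by apply: DeriveDef; [apply/cvg_ex; exists d|exact: cvg_lim lim].
Qed.

Lemma derivable_cdiff f z : derivable (f : C^o -> C^o) z 1 <-> exists d, cdiff f z d.
Proof.
split=> [fz|[d /cdiffP[]//]].
by exists ('D_1 (f : C^o -> C^o) z); apply/cdiffP/derivableP.
Qed.

Lemma derive1_cdiff f z d : cdiff f z d -> derive1 (f : C -> C^o) z = d.
Proof. by move=> /cdiffP fz; rewrite derive1E; exact: derive_val. Qed.

Lemma cdiff_ext f g z d (e : R) : 0 < e -> (forall w, nm (w - z) < e -> f w = g w) ->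
  cdiff f z d -> cdiff g z d.
Proof.
move=> e0 fg fd c c0; have [del del0 dP] := fd _ c0.
exists (Num.min e del); first by rewrite lt_min e0.
move=> w; rewrite lt_min => /andP[we wd].
by rewrite -!fg//; [exact: dP|rewrite subrr nm0].
Qed.

Lemma cdiff_unique f z d d' : cdiff f z d -> cdiff f z d' -> d = d'.
Proof. by move=> /derive1_cdiff <- /derive1_cdiff <-. Qed.

Lemma cdiff_cst c z : cdiff (fun=> c) z 0.
Proof. by move=> e e0; exists 1 => // w _; rewrite subrr mul0r subrr nm0 mulr_ge0 ?nm_ge0 ?ltW. Qed.

Lemma cdiff_id z : cdiff id z 1.
Proof. by move=> e e0; exists 1 => // w _; rewrite mul1r subrr nm0 mulr_ge0 ?nm_ge0 ?ltW. Qed.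

Lemma cdiffD f g z d e : cdiff f z d -> cdiff g z e -> cdiff (fun w => f w + g w) z (d + e).
Proof. by move=> /cdiffP fd /cdiffP gd; apply/cdiffP; exact: is_deriveD. Qed.

Lemma cdiffN f z d : cdiff f z d -> cdiff (fun w => - f w) z (- d).
Proof. by move=> /cdiffP fd; apply/cdiffP; exact: is_deriveN. Qed.

Lemma cdiffB f g z d e : cdiff f z d -> cdiff g z e -> cdiff (fun w => f w - g w) z (d - e).
Proof. by move=> fd gd; apply: cdiffD => //; exact: cdiffN. Qed.

Lemma cdiffM f g z d e : cdiff f z d -> cdiff g z e ->
  cdiff (fun w => f w * g w) z (f z * e + g z * d).
Proof. by move=> /cdiffP fd /cdiffP gd; apply/cdiffP; exact: is_deriveM. Qed.

Lemma cdiff_cont f z d : cdiff f z d -> forall e : R, 0 < e -> exists2 del : R, 0 < del &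
  forall w, nm (w - z) < del -> nm (f w - f z) < e.
Proof.
move=> fd e e0; have [del del0 dP] := fd 1 ltr01.
have K0 : 0 < nm d + 2 by have := nm_ge0 d; lra.
exists (Num.min del (e / (nm d + 2))); first by rewrite lt_min del0 divr_gt0.
move=> w; rewrite lt_min ltr_pdivlMr// => /andP[/dP wd].
rewrite mul1r in wd; have := nmD (f w - f z - d * (w - z)) (d * (w - z)).
rewrite subrK nmM; have := nm_ge0 (w - z); have := nm_ge0 d; nra.
Qed.

Lemma cdiff_comp f g z d e : cdiff f z d -> cdiff g (f z) e -> cdiff (g \o f) z (e * d).
Proof.
move=> fd gd c c0; have := nm_ge0 d; have := nm_ge0 e => e0 d0.
(* The two errors add up to at most [k * (k + nm d + nm e)] times the distance, which [k <= 1]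
   reduces to the bound [c]. *)
pose k := Num.min 1 (c / (2 + nm e + nm d)).
have D0 : 0 < 2 + nm e + nm d by lra.
have k0 : 0 < k by rewrite lt_min ltr01 divr_gt0.
have k1 : k <= 1 by rewrite ge_min lexx.
have kc : k * (2 + nm e + nm d) <= c by rewrite -ler_pdivlMr// ge_min lexx orbT.
have [d1 d10 fP] := fd _ k0; have [d2 d20 gP] := gd _ k0.
have [d3 d30 fc] := cdiff_cont fd d20.
exists (Num.min d1 d3); first by rewrite lt_min d10.
move=> w; rewrite lt_min => /andP[/fP w1 /fc/gP w3] /=.
have -> : g (f w) - g (f z) - e * d * (w - z) =
  (g (f w) - g (f z) - e * (f w - f z)) + e * (f w - f z - d * (w - z)) by ring.
apply: le_trans (nmD _ _) _; rewrite nmM.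
have w4 : nm (f w - f z) <= (k + nm d) * nm (w - z).
  by have := nmD (f w - f z - d * (w - z)) (d * (w - z)); rewrite subrK nmM; lra.
have w0 := nm_ge0 (w - z); have f0 := nm_ge0 (f w - f z).
have i1 : k * nm (f w - f z) <= k * ((k + nm d) * nm (w - z)) by rewrite ler_pM2l.
have i2 : nm e * nm (f w - f z - d * (w - z)) <= nm e * (k * nm (w - z)) by rewrite ler_wpM2l.
have i3 : k * (2 + nm e + nm d) * nm (w - z) <= c * nm (w - z) by rewrite ler_wpM2r.
have i4 : k * (k * nm (w - z)) <= k * (1 * nm (w - z)).
  by rewrite ler_pM2l// ler_wpM2r.
have i5 : 0 <= k * nm (w - z) by rewrite mulr_ge0// ltW.
lra.
Qed.

Lemma cdiffX f z d n : cdiff f z d -> exists d', cdiff (fun w => f w ^+ n) z d'.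
Proof.
move=> fd; elim: n => [|n [d' ih]]; first by exists 0; exact: cdiff_cst.
by eexists; apply: cdiff_ext ltr01 _ (cdiffM fd ih) => w _; rewrite exprS.
Qed.

Lemma cdiff_inv z : z != 0 -> exists d, cdiff (fun w => w^-1) z d.
Proof.
move=> z0; apply/derivable_cdiff.
by apply: (@derivableV C C^o id) => //; exact: derivable_id.
Qed.

Lemma cdiff_quotient f z0 z d c : z != z0 -> cdiff f z d ->
  exists d', cdiff (fun w => (f w - c) / (w - z0)) z d'.
Proof.
move=> zz0 fd; have [e eP] : exists e, cdiff (fun w => (w - z0)^-1) z e.
  have [|e eP] := @cdiff_inv (z - z0); first by rewrite subr_eq0.
  by exists (e * (1 - 0)); apply: (cdiff_comp (cdiffB (cdiff_id z) (cdiff_cst z0 z)) eP).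
by eexists; apply: cdiffM eP; apply: cdiffB fd (cdiff_cst c z).
Qed.

End ComplexDerivative.

(** * Goursat's theorem and the maximum principle *)

Section Goursat.
Variable R : realType.
Local Notation C := (Cx R).
Local Notation I := (iu R).
Implicit Types (z w a d : C) (f g : C -> C) (S : R) (n : nat).

(* The left Riemann sum with 3^n terms for the integral of g along the segment
   from a to a + S d. *)
Fixpoint edge_sum g n a S d : C :=
  if n is n'.+1 then
    edge_sum g n' a (S / 3) d + edge_sum g n' (a + rc (S / 3) * d) (S / 3) d +
    edge_sum g n' (a + 2 * rc (S / 3) * d) (S / 3) d
  else rc S * d * g a.

(** The boundary run counterclockwise: bottom, top, right and left side. Opposite sides are sampled
    in the same direction and the sign does the reversal, which lets common sides cancel exactly. *)
Definition square_sum g n a S : C :=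
  edge_sum g n a S 1 - edge_sum g n (a + I * rc S) S 1 +
  edge_sum g n (a + rc S) S I - edge_sum g n a S I.

Lemma rc_third S : rc S = 3 * rc (S / 3).
Proof. by rewrite -[3]rc_nat -rcM; congr rc; field. Qed.

(** An inner side belongs to two subsquares, with opposite signs and the same sample points, so it
    cancels at every level [n] and not only in the limit. *)
Lemma square_sumS g n a S :
  square_sum g n.+1 a S = \sum_(i < 3) \sum_(j < 3) square_sum g n (subcorner a S i j) (S / 3).
Proof.
pose pt (i j : nat) := a + i%:R * rc (S / 3) + I * (j%:R * rc (S / 3)).
have subE (i j : nat) : subcorner a S i j = pt i j.
  by rewrite /subcorner /pt !rcM !rc_nat.
have sumE (i j : nat) : square_sum g n (subcorner a S i j) (S / 3) =
   edge_sum g n (pt i j) (S / 3) 1 - edge_sum g n (pt i j.+1) (S / 3) 1 +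
   edge_sum g n (pt i.+1 j) (S / 3) I - edge_sum g n (pt i j) (S / 3) I.
  rewrite subE /square_sum.
  have -> : pt i j + I * rc (S / 3) = pt i j.+1 by rewrite /pt -[j.+1]addn1 natrD; ring.
  by have -> : pt i j + rc (S / 3) = pt i.+1 j by rewrite /pt -[i.+1]addn1 natrD; ring.
under eq_bigr do under eq_bigr do rewrite sumE.
rewrite !big_ord_recl !big_ord0 /= /bump /= !add1n /square_sum /= (rc_third S).
(* Once every side starts at a grid point [pt i j], equal sides are equal atoms for [ring]. *)
have e00 : a = pt 0%N 0%N by rewrite /pt; ring.
have e10 : a + rc (S / 3) * 1 = pt 1%N 0%N by rewrite /pt; ring.
have e20 : a + 2 * rc (S / 3) * 1 = pt 2%N 0%N by rewrite /pt; ring.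
have e03 : a + I * (3 * rc (S / 3)) = pt 0%N 3%N by rewrite /pt; ring.
have e13 : pt 0%N 3%N + rc (S / 3) * 1 = pt 1%N 3%N by rewrite /pt; ring.
have e23 : pt 0%N 3%N + 2 * rc (S / 3) * 1 = pt 2%N 3%N by rewrite /pt; ring.
have e30 : a + 3 * rc (S / 3) = pt 3%N 0%N by rewrite /pt; ring.
have e31 : pt 3%N 0%N + rc (S / 3) * I = pt 3%N 1%N by rewrite /pt; ring.
have e32 : pt 3%N 0%N + 2 * rc (S / 3) * I = pt 3%N 2%N by rewrite /pt; ring.
have e01 : a + rc (S / 3) * I = pt 0%N 1%N by rewrite /pt; ring.
have e02 : a + 2 * rc (S / 3) * I = pt 0%N 2%N by rewrite /pt; ring.
rewrite e03 e30 e13 e23 e31 e32 e10 e20 e01 e02.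
have -> : edge_sum g n a (S / 3) I = edge_sum g n (pt 0%N 0%N) (S / 3) I by rewrite -e00.
have -> : edge_sum g n a (S / 3) 1 = edge_sum g n (pt 0%N 0%N) (S / 3) 1 by rewrite -e00.
ring.
Qed.

Lemma edge_sum_linear f g (c : C) n a S d :
  edge_sum (fun w => f w + c * g w) n a S d = edge_sum f n a S d + c * edge_sum g n a S d.
Proof. by elim: n a S => [|n ih] a S /=; rewrite ?ih; ring. Qed.

Lemma edge_sum_cst (c : C) n a S d : edge_sum (fun=> c) n a S d = rc S * d * c.
Proof. by elim: n a S => [//|n ih] a S /=; rewrite !ih [rc S]rc_third; ring. Qed.

Lemma edge_sum_id n a w S d :
  edge_sum id n (a + w) S d = edge_sum id n a S d + rc S * d * w.
Proof.
elim: n a S => [|n ih] a S /=; first by ring.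
have -> : a + w + rc (S / 3) * d = a + rc (S / 3) * d + w by ring.
have -> : a + w + 2 * rc (S / 3) * d = a + 2 * rc (S / 3) * d + w by ring.
by rewrite !ih [rc S]rc_third; ring.
Qed.

Lemma edge_point a S d t n : 0 <= S ->
  (0 <= t <= S / 3) -> (n <= 2)%N ->
  a + n%:R * rc (S / 3) * d + rc t * d = a + rc (n%:R * (S / 3) + t) * d /\
  0 <= n%:R * (S / 3) + t <= S.
Proof.
move=> S0 /andP[t0 t1] n2; split; first by rewrite rcD (rcM n%:R) rc_nat; ring.
have n0 : 0 <= n%:R :> R by [].
have n2' : n%:R <= 2 :> R by rewrite (ler_nat _ n 2).
have ? : n%:R * (S / 3) <= 2 * (S / 3) by rewrite ler_wpM2r//; lra.
have ? : 0 <= n%:R * (S / 3) by apply: mulr_ge0; lra.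
by apply/andP; split; lra.
Qed.

(** [P] relates a partial sum to the length it covers. One induction then gives both the bound on
    the norm and the lower bound on the imaginary part. *)
Lemma edge_sum_ind (P : C -> R -> Prop) g n a S d : 0 <= S ->
  (forall u v S1 S2, P u S1 -> P v S2 -> P (u + v) (S1 + S2)) ->
  (forall t s, 0 <= s -> 0 <= t <= S -> P (rc s * (d * g (a + rc t * d))) s) ->
  P (edge_sum g n a S d) S.
Proof.
move=> S0 PD; elim: n a S S0 => [|n ih] a S S0 gP /=.
  by rewrite -mulrA -[in g a](addr0 a) -(mul0r d) -rc0; apply: gP; rewrite ?lexx.
have S30 : 0 <= S / 3 by rewrite divr_ge0.
have S3 : S = S / 3 + S / 3 + S / 3 by field.
rewrite [X in P _ X]S3.
have ep k t := @edge_point a S d t k S0.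
apply: (PD); [apply: (PD)|]; apply: ih => // t s s0 ts.
- have [] := ep 0%N t ts isT; rewrite mul0r mul0r addr0 => e i.
  by rewrite e; apply: gP.
- have [] := ep 1%N t ts isT; rewrite mul1r => e i.
  by rewrite e; apply: gP.
- have [e i] := ep 2%N t ts isT.
  by rewrite e; apply: gP.
Qed.

Lemma edge_sum_bound g n a S d (M : R) : nm d = 1 -> 0 <= S ->
  (forall t, 0 <= t <= S -> nm (g (a + rc t * d)) <= M) ->
  nm (edge_sum g n a S d) <= S * M.
Proof.
move=> d1 S0 gM; apply: (@edge_sum_ind (fun u S => nm u <= S * M)) => //.
  by move=> u v S1 S2 ? ?; rewrite mulrDl (le_trans (nmD _ _))// lerD.
by move=> t s s0 ts; rewrite !nmM d1 mul1r nm_rc ger0_norm// ler_wpM2l// gM.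
Qed.

Lemma edge_sum_im g n a S d (m : R) : 0 <= S ->
  (forall t, 0 <= t <= S -> m <= im (d * g (a + rc t * d))) ->
  S * m <= im (edge_sum g n a S d).
Proof.
move=> S0 gm; apply: (@edge_sum_ind (fun u S => S * m <= im u)) => //.
  by move=> u v S1 S2 ? ?; rewrite mulrDl imD lerD.
by move=> t s s0 ts; rewrite imM re_rc im_rc mul0r addr0 ler_wpM2l// gm.
Qed.

Definition bd a S : set C := fun w => sq a S w /\
  (re w = re a \/ re w = re a + S \/ im w = im a \/ im w = im a + S).

Lemma bd_edges a S t : 0 <= t <= S ->
  [/\ bd a S (a + rc t * 1), bd a S (a + I * rc S + rc t * 1),
      bd a S (a + rc S + rc t * I) & bd a S (a + rc t * I)].
Proof.
move=> /andP[t0 tS]; rewrite /bd /sq !ReImE.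
rewrite !(mulr1, mulr0, mul0r, mul1r, subr0, addr0, add0r) /re /im /= ?(mulr1, mulr0, mul0r, mul1r, subr0, addr0, add0r).
split; (split; [split; apply/andP; split; lra|]); 
  first [by left; lra|by right; left; lra|by right; right; left; lra|by right; right; right; lra].
Qed.

Lemma square_sum_bound g n a S (M : R) : 0 <= S ->
  (forall w, bd a S w -> nm (g w) <= M) -> nm (square_sum g n a S) <= 4 * S * M.
Proof.
move=> S0 gM; have be t ht := @bd_edges a S t ht.
have e1 : nm (edge_sum g n a S 1) <= S * M.
  by apply: edge_sum_bound; rewrite ?nm1// => t /be[? ? ? ?]; exact: gM.
have e2 : nm (edge_sum g n (a + I * rc S) S 1) <= S * M.
  by apply: edge_sum_bound; rewrite ?nm1// => t /be[? ? ? ?]; exact: gM.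
have e3 : nm (edge_sum g n (a + rc S) S I) <= S * M.
  by apply: edge_sum_bound; rewrite ?nm_iu// => t /be[? ? ? ?]; exact: gM.
have e4 : nm (edge_sum g n a S I) <= S * M.
  by apply: edge_sum_bound; rewrite ?nm_iu// => t /be[? ? ? ?]; exact: gM.
rewrite /square_sum; set x1 := edge_sum _ _ _ _ _ in e1 *.
set x2 := edge_sum _ _ _ _ _ in e2 *; set x3 := edge_sum _ _ _ _ _ in e3 *.
set x4 := edge_sum _ _ _ _ _ in e4 *.
have := nmD (x1 - x2 + x3) (- x4); have := nmD (x1 - x2) x3; have := nmD x1 (- x2).
rewrite !nmN; lra.
Qed.

Lemma square_sum_linear f g (c : C) n a S :
  square_sum (fun w => f w + c * g w) n a S = square_sum f n a S + c * square_sum g n a S.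
Proof. by rewrite /square_sum !edge_sum_linear; ring. Qed.

(** A left sum of [w] differs from the integral, but by [edge_sum_id] the error is the same on
    opposite sides, so the total vanishes exactly. *)
Lemma square_sum_affine (c d : C) n a S : square_sum (fun w => c + d * w) n a S = 0.
Proof.
rewrite (square_sum_linear (fun=> c) id) /square_sum !edge_sum_cst !edge_sum_id; ring.
Qed.

(** Plays the role of a bound [c] on the boundary integral, without asking that the sums
    converge. *)
Definition sums_le g a S (c : R) :=
  exists N, forall n, (N <= n)%N -> nm (square_sum g n a S) <= c.

Lemma sums_le_glue g a S (c : 'I_3 -> 'I_3 -> R) (c' : R) :
  (forall i j : 'I_3, sums_le g (subcorner a S i j) (S / 3) (c i j)) ->
  \sum_i \sum_j c i j <= c' -> sums_le g a S c'.
Proof.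
move=> gc cc'; have [N NP] := choice (fun ij : 'I_3 * 'I_3 => gc ij.1 ij.2).
(* Level [n.+1] on the square is level [n] on its nine parts. *)
exists (\max_ij N ij).+1 => -[//|n]; rewrite ltnS => maxn.
rewrite square_sumS; apply: le_trans cc'.
have nm_sum (J : finType) (F : J -> C) : nm (\sum_j F j) <= \sum_j nm (F j).
  elim/big_ind2: _ => [|x1 x2 y1 y2 h1 h2|//]; first by rewrite nm0.
  by apply: le_trans (nmD _ _) _; exact: lerD.
apply: le_trans (nm_sum _ _) _; apply: ler_sum => i _.
apply: le_trans (nm_sum _ _) _; apply: ler_sum => j _.
by apply: (NP (i, j)); apply: leq_trans maxn; exact: (leq_bigmax (i, j)).
Qed.

Lemma goursat g a S (c : R) : 0 < S -> 0 < c ->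
  (forall z, sq a S z -> exists d, cdiff g z d) -> sums_le g a S c.
Proof.
(* A bound proportional to the area is additive over the nine subsquares. *)
move=> S0 c0 gd; pose k := c / S ^+ 2.
have k0 : 0 < k by rewrite divr_gt0// exprn_gt0.
have -> : c = k * S ^+ 2 by rewrite /k; field; lra.
apply: (@square_induction R (fun a S => sums_le g a S (k * S ^+ 2))) => //.
  move=> a' S' S'0 h; apply: sums_le_glue h _.
  by rewrite !big_ord_recl !big_ord0 !addr0 le_eqVlt; apply/orP; left; apply/eqP; field.
move=> z az; have [d dP] := gd z az.
(* Perimeter [4 * S'] times deviation [k / 8 * (2 * S')], where [2 * S'] bounds the diameter, is
   exactly [k * S' ^+ 2]. *)
have k8 : 0 < k / 8 by lra.
have [del del0 delP] := dP _ k8; exists (del / 2) => [|a' S' /andP[S'0 S'd] a'z _]; first by lra.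
exists 0%N => n _.
pose err w := g w - g z - d * (w - z).
have -> : g = (fun w => err w + 1 * ((g z - d * z) + d * w)).
  by apply/funext => w; rewrite /err; ring.
rewrite square_sum_linear square_sum_affine mulr0 addr0.
have -> : k * S' ^+ 2 = 4 * S' * (k / 8 * (2 * S')) by field.
apply: square_sum_bound => [|w [wS _]]; first exact: ltW.
have wz := sq_diam wS a'z.
apply: le_trans (delP w _) _; first by lra.
by rewrite ler_pM2l.
Qed.

End Goursat.

Section MaximumPrinciple.
Variable R : realType.
Local Notation C := (Cx R).
Local Notation I := (iu R).
Implicit Types (z w a d : C) (f g : C -> C) (S rho : R) (n : nat).

Definition corner z rho : C := z - rc rho - I * rc rho.

Lemma re_corner z rho : re (corner z rho) = re z - rho.
Proof. by rewrite /corner !ReImE; ring. Qed.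
Lemma im_corner z rho : im (corner z rho) = im z - rho.
Proof. by rewrite /corner !ReImE; ring. Qed.

Definition csq z rho := sq (corner z rho) (2 * rho).
Definition cbd z rho := bd (corner z rho) (2 * rho).

Lemma csqP z rho w : csq z rho w <-> `|re (w - z)| <= rho /\ `|im (w - z)| <= rho.
Proof.
rewrite /csq /sq re_corner im_corner reB imB !ler_norml.
split=> -[/andP[? ?] /andP[? ?]]; split; apply/andP; split; lra.
Qed.

Lemma cbd_nm z rho w : 0 < rho -> cbd z rho w -> rho <= nm (w - z) <= 2 * rho.
Proof.
move=> rho0 [/csqP[wr wi]]; rewrite re_corner im_corner => e.
have := nm_le_reim (w - z); have := re_le_nm (w - z); have := im_le_nm (w - z).
move=> h1 h2 h3; apply/andP; split; last by lra.
have ra : re w = re z - rho \/ re w = re z + rho -> rho <= `|re (w - z)|.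
  by rewrite reB => -[->|->]; [rewrite distrC|]; rewrite ger0_norm; lra.
have ia : im w = im z - rho \/ im w = im z + rho -> rho <= `|im (w - z)|.
  by rewrite imB => -[->|->]; [rewrite distrC|]; rewrite ger0_norm; lra.
case: e => [?|[?|[?|?]]].
- by apply: le_trans (ra _) _ => //; left.
- by apply: le_trans (ra _) _ => //; right; lra.
- by apply: le_trans (ia _) _ => //; left.
- by apply: le_trans (ia _) _ => //; right; lra.
Qed.

Lemma csq_nm z rho w : 0 < rho -> csq z rho w -> nm (w - z) <= 2 * rho.
Proof. by move=> r0 /csqP[? ?]; have := nm_le_reim (w - z); lra. Qed.

Lemma subcorner_center z rho : subcorner (corner z rho) (2 * rho) 1 1 = corner z (rho / 3).
Proof.
by apply: Cx_ext; rewrite ?re_subcorner ?im_subcorner ?re_corner ?im_corner; field.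
Qed.

Lemma subcorner_off_center z rho (i j : 'I_3) : 0 < rho ->
  ~~ ((i == 1 :> nat) && (j == 1 :> nat)) ->
  ~ sq (subcorner (corner z rho) (2 * rho) i j) (2 * rho / 3) z.
Proof.
move=> r0; rewrite /sq re_subcorner im_subcorner re_corner im_corner.
case: i => -[|[|[|//]]] ? /=; case: j => -[|[|[|//]]] ? //= _ [/andP[? ?] /andP[? ?]]; lra.
Qed.

(* Triadic subdivision keeps z at the centre of a subsquare, and the eight outer
   subsquares are negligible by Goursat's theorem. *)
Lemma center_sums g z rho (r K c : R) (k : nat) : 0 < rho -> rho <= r * 3 ^+ k -> 0 < c ->
  (forall w, csq z rho w -> w != z -> exists d, cdiff g w d) ->
  0 <= K -> (forall w, w != z -> nm (w - z) <= 2 * r -> nm (g w) <= K) ->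
  sums_le g (corner z rho) (2 * rho) (8 * r * K + c).
Proof.
move=> + + + + K0 gK; elim: k rho c => [|k ih] rho c rho0 rk c0 gd.
  rewrite expr0 mulr1 in rk.
  (* The side is [2 * rho], so the trivial estimate is [8 * rho * K]; this is the origin of
     [8 * r * K]. *)
  exists 0%N => n _; apply: le_trans (@square_sum_bound _ g n _ _ K _ _) _.
  - by lra.
  - move=> w wb; have /andP[w1 w2] := cbd_nm rho0 wb; apply: gK; last by lra.
    by apply: contraTneq w1 => ->; rewrite subrr nm0 -ltNge.
  - have : rho * K <= r * K by rewrite ler_wpM2r.
    lra.
(* Half of [c] goes to the central square and a sixteenth to each of the other eight. *)
pose cc (i j : 'I_3) := if (i == 1 :> nat) && (j == 1 :> nat) then 8 * r * K + c / 2 else c / 16.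
apply: (@sums_le_glue R g _ _ cc) => [i j|]; last first.
  by rewrite !big_ord_recl !big_ord0 /cc /=; lra.
rewrite /cc; case: ifP => [/andP[/eqP i1 /eqP j1]|/negbT ij].
  rewrite i1 j1 subcorner_center.
  have -> : 2 * rho / 3 = 2 * (rho / 3) by field.
  apply: ih; [lra|by rewrite exprS in rk; lra|lra|] => w wq; apply: gd.
  by move: wq => /csqP[? ?]; apply/csqP; split; lra.
apply: goursat; [lra|lra|] => w wq; apply: gd.
  by apply: (@sub_sq R _ _ i j) wq; lra.
by apply: contraPneq wq => ->; exact: subcorner_off_center.
Qed.

(** A bounded singularity contributes nothing: the central square is shrunk until its trivial bound
    [8 * s * K'] is at most [c / 2]. *)
Lemma center_sums_vanish g z rho (K r c : R) : 0 < rho -> 0 < c -> 0 < r ->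
  (forall w, csq z rho w -> w != z -> exists d, cdiff g w d) ->
  (forall w, w != z -> nm (w - z) <= r -> nm (g w) <= K) ->
  sums_le g (corner z rho) (2 * rho) c.
Proof.
move=> rho0 c0 r0 gd gK; pose K' := Num.max K 1.
have K1 : 1 <= K' by rewrite le_max lexx orbT.
pose s := Num.min (r / 2) (c / (16 * K')).
have s0 : 0 < s by rewrite lt_min !divr_gt0//; lra.
have sr : s <= r / 2 by rewrite ge_min lexx.
have sc : s * (16 * K') <= c by rewrite -ler_pdivlMr ?ge_min ?lexx ?orbT//; lra.
have [k kP] := expr_unbounded (rho / s) (isT : (1 < 3)%N).
have [||//|||N NP] := @center_sums g z rho s K' (c / 2) k rho0.
- by rewrite mulrC -ler_pdivrMr// ltW.
- by lra.
- by lra.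
- by move=> w wz w1; rewrite le_max gK//; lra.
exists N => n /NP; lra.
Qed.

Lemma im_div d w : w != 0 ->
  im (d * w^-1) * nm w ^+ 2 = im d * re w - re d * im w.
Proof.
move=> w0; have {2 3}-> : d = d * w^-1 * w by rewrite mulfVK.
by rewrite nm2E (imM _ w) (reM _ w); ring.
Qed.

(** The centre sees each side under an angle [pi / 2], for which 1 is a crude lower bound. The
    numerator [im d * re w - re d * im w] is, up to the sign [s] of the orientation, the distance
    [rho] from the centre to the side, and [nm w ^+ 2] is at most [2 * rho ^+ 2]. *)
Lemma edge_sum_inv z x d rho n (s : R) : 0 < rho -> s = 1 \/ s = -1 ->
  (forall t, 0 <= t <= 2 * rho -> let w := x + rc t * d - z in
     rho <= s * (im d * re w - re d * im w) /\ re w ^+ 2 + im w ^+ 2 <= 2 * rho ^+ 2) ->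
  1 <= s * im (edge_sum (fun w => (w - z)^-1) n x (2 * rho) d).
Proof.
move=> r0 s1 h; have S0 : 0 <= 2 * rho by lra.
have -> : s * im (edge_sum (fun w => (w - z)^-1) n x (2 * rho) d) =
    im (edge_sum (fun w => 0 + rc s * (w - z)^-1) n x (2 * rho) d).
  by rewrite edge_sum_linear edge_sum_cst mulr0 add0r imM re_rc im_rc mul0r addr0.
have e1 : (2 * rho) * (2 * rho)^-1 = 1 by rewrite mulfV//; lra.
rewrite -[X in X <= _]e1; apply: edge_sum_im => // t /h; set w := x + _ - z => -[w1 w2].
have w0 : w != 0 by apply: contraTneq w1 => ->; rewrite !mulr0 subrr mulr0 -ltNge.
have -> : d * (0 + rc s * w^-1) = rc s * (d * w^-1) by ring.
rewrite imM re_rc im_rc mul0r addr0.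
have N0 : 0 < nm w ^+ 2 by rewrite exprn_gt0// nm_gt0.
have {w1} : rho / nm w ^+ 2 <= s * im (d / w).
  by rewrite ler_pdivrMr// -mulrA im_div.
apply: le_trans; rewrite -nm2E in w2.
have -> : (2 * rho)^-1 = rho / (2 * rho ^+ 2) by field; lra.
by rewrite ler_pM2l// lef_pV2// posrE// mulr_gt0// exprn_gt0.
Qed.

Lemma square_sum_inv z rho n : 0 < rho ->
  4 <= im (square_sum (fun w => (w - z)^-1) n (corner z rho) (2 * rho)).
Proof.
move=> r0; rewrite /square_sum imB imD imB.
have tr t : 0 <= t <= 2 * rho -> (t - rho) ^+ 2 <= rho ^+ 2 by move=> /andP[? ?]; nra.
have re_1 : re (1 : C) = 1 by [].
have im_1 : im (1 : C) = 0 by [].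
have e1 : 1 <= 1 * im (edge_sum (fun w => (w - z)^-1) n (corner z rho) (2 * rho) 1).
  apply: edge_sum_inv r0 _ _ => [|t /tr tt]; first by left.
  rewrite /= reB imB reD imD re_corner im_corner !ReImE; rewrite ?re_1 ?im_1; split; nra.
have e2 : 1 <= (-1) * im (edge_sum (fun w => (w - z)^-1) n (corner z rho + I * rc (2 * rho)) (2 * rho) 1).
  apply: edge_sum_inv r0 _ _ => [|t /tr tt]; first by right.
  rewrite /= reB imB reD imD reD imD re_corner im_corner !ReImE; rewrite ?re_1 ?im_1; split; nra.
have e3 : 1 <= 1 * im (edge_sum (fun w => (w - z)^-1) n (corner z rho + rc (2 * rho)) (2 * rho) I).
  apply: edge_sum_inv r0 _ _ => [|t /tr tt]; first by left.
  rewrite /= reB imB reD imD reD imD re_corner im_corner !ReImE; rewrite ?re_1 ?im_1; split; nra.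
have e4 : 1 <= (-1) * im (edge_sum (fun w => (w - z)^-1) n (corner z rho) (2 * rho) I).
  apply: edge_sum_inv r0 _ _ => [|t /tr tt]; first by right.
  rewrite /= reB imB reD imD re_corner im_corner !ReImE; rewrite ?re_1 ?im_1; split; nra.
lra.
Qed.

(** The quotient [(f w - f z) / (w - z)] is bounded near [z], so its sums tend to 0. Those of
    [f w / (w - z)] have modulus at most [8 * M] and those of [1 / (w - z)] at least 4, whence the
    factor 2; it disappears when the estimate is applied to powers of [f]. *)
Lemma cauchy_estimate f z rho (M : R) : 0 < rho ->
  (forall w, csq z rho w -> exists d, cdiff f w d) ->
  (forall w, cbd z rho w -> nm (f w) <= M) -> nm (f z) <= 2 * M.
Proof.
move=> r0 fd fM; apply/ler_addgt0Pr => e e0.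
pose g w := (f w - f z) / (w - z).
have zsq : csq z rho z by apply/csqP; rewrite subrr normr0 ltW.
have [d dP] := fd z zsq.
have [del del0 delP] := dP 1 ltr01.
have [|||N NP] := @center_sums_vanish g z rho (nm d + 1) (del / 2) e r0 e0; first by lra.
- by move=> w wq wz; have [d' d'P] := fd w wq; exact: cdiff_quotient d'P.
- move=> w wz wd; rewrite /g nmM nmV ler_pdivrMr ?nm_gt0 ?subr_eq0//.
  have := nmD (f w - f z - d * (w - z)) (d * (w - z)); rewrite subrK nmM.
  by have := delP w; lra.
have := NP N (leqnn N).
have -> : g = (fun w => f w / (w - z) + (- f z) * (w - z)^-1).
  by apply/funext => w; rewrite /g; ring.
rewrite square_sum_linear; have := square_sum_inv z N r0.
have : nm (square_sum (fun w => f w / (w - z)) N (corner z rho) (2 * rho)) <= 4 * (2 * rho) * (M / rho).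
  apply: square_sum_bound => [|w wb]; first by lra.
  have /andP[w1 _] := cbd_nm r0 wb.
  rewrite nmM nmV ler_pM ?nm_ge0 ?invr_ge0 ?nm_ge0//; first exact: fM.
  by rewrite lef_pV2// posrE; lra.
have -> : 4 * (2 * rho) * (M / rho) = 8 * M by field; lra.
set x := square_sum _ _ _ _; set y := square_sum _ _ _ _ => xM y4 xy.
have : nm (f z) * nm y <= nm x + nm (x + - f z * y).
  rewrite -nmM; have -> : f z * y = x - (x + - f z * y) by ring.
  by rewrite -[nm (x + - f z * y)]nmN nmD.
have := im_le_nm y; have := ler_norm (im y); have := nm_ge0 (f z).
have := nm_ge0 y.
move=> y0 f0 i1 i2 h.
have : nm (f z) * 4 <= nm (f z) * nm y by rewrite ler_wpM2l//; lra.
lra.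
Qed.

(** Otherwise the powers of [x / M] would outgrow [K], by Bernoulli's inequality. This discards any
    constant in front of [M ^+ n]. *)
Lemma le_of_expr_le (x M K : R) : 0 <= x -> 0 <= M ->
  (forall n, x ^+ n <= K * M ^+ n) -> x <= M.
Proof.
move=> x0 M0 h; rewrite leNgt; apply/negP => Mx.
have [M00|Mn0] := eqVneq M 0.
  by have := h 1%N; rewrite M00 !expr1 mulr0; lra.
have Mp : 0 < M by rewrite lt_neqAle eq_sym Mn0.
have h' n : (x / M) ^+ n <= K by rewrite expr_div_n ler_pdivrMr ?exprn_gt0.
pose t := x / M - 1.
have t0 : 0 < t by rewrite /t subr_gt0 ltr_pdivlMr// mul1r.
have bern n : 1 + n%:R * t <= (x / M) ^+ n.
  elim: n => [|n ih]; first by rewrite mul0r addr0 expr0.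
  rewrite exprS -natr1; set X := (x / M) ^+ n in ih *; set m : R := n%:R in ih *.
  have -> : x / M * X = (1 + t) * X by rewrite /t; ring.
  have m0 : 0 <= m * t * t by rewrite !mulr_ge0// ltW.
  have := ler_wpM2l (ltW t0) ih; lra.
have [K0|K0] := lerP 0 (K / t); last first.
  by have := h' 0%N; rewrite expr0; move: K0; rewrite pmulr_llt0 ?invr_gt0//; lra.
have := archi_boundP K0; rewrite ltr_pdivrMr// => h1.
by have := bern (Num.bound (K / t)); have := h' (Num.bound (K / t)); lra.
Qed.

Definition ccont f z := forall c : R, 0 < c -> exists2 del : R, 0 < del &
  forall w, nm (w - z) < del -> nm (f w - f z) < c.

Lemma ccontP f z : (f : C^o -> C^o) @ (z : C^o) --> (f z : C^o) <-> ccont f z.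
Proof.
split=> [/cvgrPdist_lt fz c c0|fz].
  have c0' : 0 < rc c by rewrite -rc0 rc_lt.
  have /Cx_nearP[del del0 dP] := fz _ c0'.
  by exists del => // w /dP; rewrite normcE_nm rc_lt nmB.
have [_] := @cvgrPdist_lt C C^o C^o (nbhs (z : C^o)) (nbhs_filter _) f (f z).
apply=> e /Cx_gt0[-> e0]; apply/Cx_nearP.
have [del del0 dP] := fz _ e0.
by exists del => // w /dP; rewrite normcE_nm rc_lt nmB.
Qed.

Lemma ccontM f g z : ccont f z -> ccont g z -> ccont (fun w => f w * g w) z.
Proof. by move=> /ccontP fz /ccontP gz; apply/ccontP; exact: (@cvgM C C^o (nbhs (z : C^o)) (nbhs_filter _) f g _ _ fz gz). Qed.

Lemma ccontX f z n : ccont f z -> ccont (fun w => f w ^+ n) z.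
Proof.
move=> fz; elim: n => [|n ih].
  by move=> c c0; exists 1 => // w _; rewrite !expr0 subrr nm0.
have -> : (fun w => f w ^+ n.+1) = (fun w => f w * f w ^+ n).
  by apply/funext => w; rewrite exprS.
exact: ccontM.
Qed.

Lemma cdiff_ccont f z d : cdiff f z d -> ccont f z.
Proof. by move=> fd c; exact: cdiff_cont fd _. Qed.

Lemma cdiff_factor g e : ccont g e -> cdiff (fun w => (w - e) * g w) e (g e).
Proof.
move=> gc c c0; have [del del0 dP] := gc c c0; exists del => // w /dP h.
rewrite subrr mul0r subr0 [g e * _]mulrC -mulrBr nmM mulrC.
by rewrite ler_wpM2r ?nm_ge0// ltW.
Qed.

(* A power trick: (w - e) f(w)^n is differentiable at e as soon as f is
   continuous there, and n-th roots absorb the factor w - e. *)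
Lemma max_principle f z rho (M : R) (s : seq C) : 0 < rho -> 0 <= M -> z \notin s ->
  (forall w, csq z rho w -> w \notin s -> exists d, cdiff f w d) ->
  (forall e, e \in s -> ccont f e) ->
  (forall w, cbd z rho w -> nm (f w) <= M) -> nm (f z) <= M.
Proof.
move=> r0; elim: s f M => [|e s ih] f M M0.
  move=> _ fd _ fM.
  apply: (@le_of_expr_le _ _ 2 (nm_ge0 _)) => // n; rewrite -nmX.
  apply: (@cauchy_estimate (fun w => f w ^+ n) z rho) => // w wq.
    by have [d dP] := fd w wq isT; exact: cdiffX dP.
  by rewrite nmX lerXn2r ?nnegrE ?nm_ge0// fM.
rewrite inE negb_or => /andP[ze zs] fd fc fM.
have ze0 : 0 < nm (z - e) by rewrite nm_gt0// subr_eq0.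
(* Bounds the factor [w - e] on the boundary, where [nm (w - z)] is at most [2 * rho]. *)
pose D := 2 * rho + nm (z - e).
apply: (@le_of_expr_le _ _ (D / nm (z - e)) (nm_ge0 _)) => // n.
rewrite mulrAC ler_pdivlMr// -nmX -nmM mulrC.
apply: (ih (fun w => (w - e) * f w ^+ n)) => //.
- by rewrite mulr_ge0 ?exprn_ge0// addr_ge0 ?ltW//; lra.
- move=> w wq ws; have [->|we] := eqVneq w e.
    by exists (f e ^+ n); apply: (@cdiff_factor (fun w => f w ^+ n)); apply: ccontX; apply: fc; rewrite mem_head.
  have [|d dP] := fd w wq; first by rewrite inE negb_or we.
  have [d' d'P] := cdiffX n dP.
  by eexists; apply: cdiffM d'P; apply: cdiffB (cdiff_id w) (cdiff_cst e w).
- move=> e' e's; apply: ccontM; last by apply/ccontX/fc; rewrite inE e's orbT.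
  by apply: cdiff_ccont; apply: cdiffB (cdiff_id e') (cdiff_cst e e').
- move=> w wb; rewrite nmM nmX ler_pM ?exprn_ge0 ?nm_ge0//.
    have /andP[_ w2] := cbd_nm r0 wb.
    by have := nm_triangle w e z; rewrite /D; lra.
  by rewrite lerXn2r ?nnegrE ?nm_ge0// fM.
Qed.

End MaximumPrinciple.

(** * Removable singularities and derivatives *)

Section RemovableSingularity.
Variable R : realType.
Local Notation C := (Cx R).
Local Notation I := (iu R).
Implicit Types (z w a d : C) (f g : C -> C) (S rho r : R) (n : nat).

Lemma third_cover (x y S : R) : 0 < S -> x <= y <= x + S ->
  exists i : 'I_3, x + i%:R * (S / 3) <= y <= x + i%:R * (S / 3) + S / 3.
Proof.
move=> S0 /andP[xy yx].
have [y1|y1] := lerP y (x + S / 3); first by exists (inord 0); rewrite inordK//; lra.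
have [y2|y2] := lerP y (x + 2 * (S / 3)); first by exists (inord 1); rewrite inordK//; lra.
by exists (inord 2); rewrite inordK//; lra.
Qed.

Lemma square_bounded f a S : 0 < S -> (forall z, sq a S z -> ccont f z) ->
  exists M : R, forall w, sq a S w -> nm (f w) <= M.
Proof.
move=> S0 fc; apply: (@square_induction R (fun a S => exists M : R, forall w, sq a S w -> nm (f w) <= M)) => //.
  move=> b T T0 h; have [M MP] := choice (fun ij : 'I_3 * 'I_3 => h ij.1 ij.2).
  exists (\sum_ij `|M ij|) => w [wr wi].
  have [i iP] := third_cover T0 wr; have [j jP] := third_cover T0 wi.
  have : nm (f w) <= M (i, j).
    by apply: MP; rewrite /sq re_subcorner im_subcorner.
  move=> /le_trans; apply; rewrite (bigD1 (i, j))//=.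
  by apply: le_trans (ler_norm _) _; rewrite lerDl sumr_ge0.
move=> z zS; have [del del0 dP] := fc z zS 1 ltr01.
exists (del / 2) => [|b T /andP[T0 Td] zb _]; first by lra.
exists (nm (f z) + 1) => w wb.
have := nmD (f w - f z) (f z); rewrite subrK.
have := sq_diam wb zb; have := dP w; lra.
Qed.

Definition holo_on f z r := forall w, nm (w - z) < r -> exists d, cdiff f w d.

Lemma disc_bounded f z r rho : 0 < rho -> 2 * rho < r ->
  (forall w, nm (w - z) < r -> ccont f w) ->
  exists2 M : R, 0 <= M & forall w, nm (w - z) <= rho -> nm (f w) <= M.
Proof.
move=> r0 rr fc; have [||M MP] := @square_bounded f (corner z rho) (2 * rho); first by lra.
  by move=> w /(csq_nm r0) wz; apply: fc; lra.
exists (Num.max M 0); rewrite ?le_max ?lexx ?orbT// => w wz.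
rewrite le_max; apply/orP; left; apply: MP; apply/csqP.
by have := re_le_nm (w - z); have := im_le_nm (w - z); split; lra.
Qed.

Definition slope f z d w : C := if w == z then d else (f w - f z) / (w - z).

Lemma slope_neq f z d w : w != z -> slope f z d w = (f w - f z) / (w - z).
Proof. by rewrite /slope => /negPf ->. Qed.

Lemma slope_eq f z d : slope f z d z = d.
Proof. by rewrite /slope eqxx. Qed.

Lemma slopeE f z d w : f w = f z + (w - z) * slope f z d w.
Proof.
have [->|wz] := eqVneq w z; first by rewrite subrr mul0r addr0.
by rewrite slope_neq// mulrCA mulfV ?subr_eq0// mulr1 addrC subrK.
Qed.

Lemma slope_ccont f z d : cdiff f z d -> ccont (slope f z d) z.
Proof.
move=> fd c c0; have c2 : 0 < c / 2 by lra.
have [del del0 dP] := fd _ c2; exists del => // w wd; rewrite slope_eq.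
have [->|wz] := eqVneq w z; first by rewrite slope_eq subrr nm0.
rewrite slope_neq//; have wz' : w - z != 0 by rewrite subr_eq0.
have -> : (f w - f z) / (w - z) - d = (f w - f z - d * (w - z)) / (w - z) by field.
by rewrite nmM nmV ltr_pdivrMr ?nm_gt0//; have := dP w wd; have := nm_gt0 wz'; nra.
Qed.

Lemma slope_near f z d w : w != z ->
  exists2 e : R, 0 < e & forall v, nm (v - w) < e -> slope f z d v = (f v - f z) / (v - z).
Proof.
move=> wz; exists (nm (w - z)); first by rewrite nm_gt0// subr_eq0.
move=> v vw; apply: slope_neq; apply: contraTneq vw => ->.
by rewrite nmB -leNgt.
Qed.

Lemma slope_cdiff f z d w e : w != z -> cdiff f w e -> exists d', cdiff (slope f z d) w d'.
Proof.
move=> wz fe; have [d' d'P] := cdiff_quotient (f z) wz fe; exists d'.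
have [c c0 cP] := slope_near f d wz.
by apply: cdiff_ext c0 _ d'P => v /cP ->.
Qed.

Lemma ccont_ext f g z (e : R) : 0 < e -> (forall w, nm (w - z) < e -> f w = g w) ->
  ccont f z -> ccont g z.
Proof.
move=> e0 fg fc c c0; have [del del0 dP] := fc _ c0.
exists (Num.min e del); first by rewrite lt_min e0.
move=> w; rewrite lt_min => /andP[we wd].
by rewrite -!fg//; [exact: dP|rewrite subrr nm0].
Qed.

Lemma ccontB_cst f z c : ccont f z -> ccont (fun w => f w - c) z.
Proof.
move=> fc e e0; have [del del0 dP] := fc e e0; exists del => // w /dP.
by have -> : f w - c - (f z - c) = f w - f z by ring.
Qed.

Lemma slope_ccont_neq f z d w : w != z -> ccont f w -> ccont (slope f z d) w.
Proof.
move=> wz fc; have [e e0 eP] := slope_near f d wz.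
apply: (@ccont_ext (fun v => (f v - f z) * (v - z)^-1)) e0 _ _ => [v /eP ->//|].
apply: ccontM; first exact: ccontB_cst.
have wz' : w - z != 0 by rewrite subr_eq0.
have [d' d'P] := cdiff_inv wz'.
by apply: cdiff_ccont (cdiff_comp (cdiffB (cdiff_id w) (cdiff_cst z w)) d'P).
Qed.

Lemma slope_bound f z d w rho (M : R) : 0 < rho -> rho <= nm (w - z) ->
  nm (f w) <= M -> nm (f z) <= M -> nm (slope f z d w) <= 2 * M / rho.
Proof.
move=> r0 wr fw fz; have wz : w != z by apply: contraTneq wr => ->; rewrite subrr nm0 -ltNge.
rewrite slope_neq// nmM nmV ler_pM ?nm_ge0 ?invr_ge0 ?nm_ge0//.
  by have := nmD (f w) (- f z); rewrite nmN; lra.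
by rewrite lef_pV2// posrE; lra.
Qed.

(* By the maximum principle the second divided differences of g at points other
   than z are bounded, so the slopes of g at z satisfy the Cauchy criterion. *)
Lemma removable g z r : 0 < r -> ccont g z ->
  (forall w, nm (w - z) < r -> w != z -> exists d, cdiff g w d) -> exists d, cdiff g z d.
Proof.
move=> r0 gz gd; pose rho := r / 8.
have rho0 : 0 < rho by rewrite /rho; lra.
have gc w : nm (w - z) < r -> ccont g w.
  by have [->//|wz] := eqVneq w z => /gd -/(_ wz)[d /cdiff_ccont].
have [|||M M0 gM] := @disc_bounded g z r (3 * rho); [by lra|by rewrite /rho; lra|exact: gc|].
(* Squares of half-side [rho] around points close to [z] have their boundary far from all such
   points, so divided differences are controlled there by the bound on [g]. *)
have bdM u v w : nm (u - z) < rho / 4 -> nm (v - z) < rho / 4 -> cbd u rho w ->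
    rho / 2 <= nm (w - v) /\ nm (w - z) <= 3 * rho.
  move=> uz vz /(cbd_nm rho0) /andP[w1 w2].
  have := nm_triangle w u v; have := nm_triangle v u z; have := nm_triangle w z u.
  by rewrite (nmB z u); split; lra.
have csqr u w : nm (u - z) < rho / 4 -> csq u rho w -> nm (w - z) < r.
  move=> uz /(csq_nm rho0) wu; have := nm_triangle w z u; rewrite /rho in uz wu *; lra.
pose K := 2 * M / (rho / 2).
have K0 : 0 <= K by rewrite divr_ge0//; lra.
pose K2 := 2 * K / (rho / 2).
have K20 : 0 <= K2 by rewrite divr_ge0//; lra.
have step v w : v != z -> w != z -> v != w -> nm (v - z) < rho / 4 -> nm (w - z) < rho / 4 ->
    nm ((g v - g z) / (v - z) - (g v - g w) / (v - w)) <= K2 * nm (w - z).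
  move=> vz wz vw vr wr.
  have [d dP] : exists d, cdiff g v d by apply: gd => //; rewrite /rho in vr; lra.
  (* [k z] and [k w] are the two quotients to be compared, and [m] below is the divided difference
     of [k] at [w]. The bound [K2] on [m] is obtained at points [u] other than [z]; continuity of
     [k] carries the comparison to [z]. *)
  pose k := slope g v d.
  have kK u : nm (u - z) < rho / 4 -> u != z -> u != v -> nm (k u) <= K.
    move=> ur uz uv; apply: (@max_principle R k u rho K [:: z; v]) => //.
    - by rewrite !inE negb_or uz.
    - move=> x xu; rewrite !inE negb_or => /andP[xz xv].
      by have [|e eP] := gd x _ xz; [exact: csqr xu|exact: slope_cdiff eP].
    - move=> e; rewrite !inE => /orP[|] /eqP ->; last exact: slope_ccont.
      by apply: slope_ccont_neq; rewrite 1?eq_sym.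
    - move=> x xb; have [x1 x2] := bdM u v x ur vr xb.
      by apply: slope_bound => //; [lra|exact: gM|apply: gM; lra].
  have [e eP] : exists e, cdiff k w e.
    have [|e eP] := gd w _ wz; first by rewrite /rho in wr; lra.
    by apply: slope_cdiff eP; rewrite eq_sym.
  pose m := slope k w e.
  have mK u : nm (u - z) < rho / 4 -> u != z -> u != v -> u != w -> nm (m u) <= K2.
    move=> ur uz uv uw; apply: (@max_principle R m u rho K2 [:: z; v; w]) => //.
    - by rewrite !inE !negb_or uz uv.
    - move=> x xu; rewrite !inE !negb_or => /and3P[xz xv xw].
      have [|e' e'P] := gd x _ xz; first exact: csqr xu.
      have [e2 e2P] := slope_cdiff d xv e'P.
      exact: slope_cdiff e2P.
    - move=> x; rewrite !inE => /or3P[] /eqP ->; last exact: slope_ccont.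
        by apply: slope_ccont_neq; rewrite 1?eq_sym//; apply: slope_ccont_neq; rewrite 1?eq_sym.
      by apply: slope_ccont_neq => //; exact: slope_ccont.
    - move=> x xb; have [x1 x2] := bdM u w x ur wr xb; have [x3 _] := bdM u v x ur vr xb.
      apply: slope_bound => //; first by lra.
        by apply: slope_bound => //; [lra|exact: gM|apply: gM; lra].
      by apply: kK; rewrite // eq_sym.
  have kz : k z = (g v - g z) / (v - z).
    rewrite /k slope_neq 1?eq_sym// -[g z - g v]opprB -[z - v]opprB invrN mulrNN//.
  have kw : k w = (g v - g w) / (v - w).
    rewrite /k slope_neq 1?eq_sym// -[g w - g v]opprB -[w - v]opprB invrN mulrNN//.
  rewrite -kz -kw; apply/ler_addgt0Pr => c c0.
  have kc : ccont k z by apply: slope_ccont_neq; rewrite 1?eq_sym.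
  have c2 : 0 < c / 2 by lra.
  have [del del0 dlP] := kc _ c2.
  have vz0 : 0 < nm (v - z) by rewrite nm_gt0// subr_eq0.
  have wz0 : 0 < nm (w - z) by rewrite nm_gt0// subr_eq0.
  (* [u] must differ from [v] and [w], stay in the disc, change [k] by less than [c / 2] and keep
     [K2 * t] below [c / 2]. *)
  pose t := Num.min (Num.min (del / 2) (nm (v - z) / 2))
             (Num.min (nm (w - z) / 2) (Num.min (rho / 8) (c / (2 * (K2 + 1))))).
  have KK : 0 < 2 * (K2 + 1) by lra.
  have ct : 0 < c / (2 * (K2 + 1)) by rewrite divr_gt0.
  have t0 : 0 < t by rewrite !lt_min ct; do !(apply/andP; split => //); lra.
  have : t <= t by [].
  rewrite {2}/t !le_min => /andP[/andP[t1 t2] /and3P[t3 t4]].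
  rewrite ler_pdivlMr// => t5.
  pose u := z + rc t.
  have uz : nm (u - z) = t by rewrite /u addrC addKr nm_rc gtr0_norm.
  have uz' : u != z by apply: contraTneq t0 => e1; rewrite -uz e1 subrr nm0 ltxx.
  have uv' : u != v by apply: contraTneq t2 => e1; rewrite -uz e1 -ltNge; lra.
  have uw' : u != w by apply: contraTneq t3 => e1; rewrite -uz e1 -ltNge; lra.
  have ur : nm (u - z) < rho / 4 by rewrite uz; lra.
  have := mK u ur uz' uv' uw'; rewrite /m slope_neq// nmM nmV ler_pdivrMr ?nm_gt0 ?subr_eq0// => h1.
  have h2 : nm (k u - k z) < c / 2 by apply: dlP; rewrite uz; lra.
  have h3 : nm (u - w) <= t + nm (w - z) by rewrite -uz (nmB w z) nm_triangle.
  have h4 : K2 * nm (u - w) <= K2 * (t + nm (w - z)) by rewrite ler_wpM2l.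
  have := nm_triangle (k z) (k w) (k u); rewrite (nmB (k z) (k u)); lra.
have t0P : z + rc (rho / 8) != z /\ nm (z + rc (rho / 8) - z) < rho / 4.
  have e : nm (z + rc (rho / 8) - z) = rho / 8 by rewrite addrC addKr nm_rc gtr0_norm//; lra.
  split; last by lra.
  by apply: contra_eq_neq e => ->; rewrite subrr nm0; lra.
(* Comparing the quotients at [v] and at [w] with the one between [v] and [w] produces exactly the
   form [e i + e j]. *)
have [|d dP] := @Cx_cauchy_limit R {w : C | w != z /\ nm (w - z) < rho / 4}
    (fun p => (g (sval p) - g z) / (sval p - z))
    (fun p => K2 * nm (sval p - z)) (exist _ _ t0P).
  move=> [v [vz vr]] [w [wz wr]] /=.
  have [->|vw] := eqVneq v w.
    by rewrite subrr nm0; apply: addr_ge0; apply: mulr_ge0 => //; exact: nm_ge0.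
  have := step v w vz wz vw vr wr; have := step w v wz vz _ wr vr; rewrite eq_sym => /(_ vw).
  have -> : (g w - g v) / (w - v) = (g v - g w) / (v - w).
    by rewrite -[g w - g v]opprB -[w - v]opprB invrN mulrNN.
  set p := _ / (v - z); set p' := _ / (w - z); set q := _ / _.
  have := nm_triangle p p' q; rewrite (nmB q p'); lra.
exists d => e e0; exists (Num.min (rho / 4) (e / (2 * K2 + 1))).
  by rewrite lt_min; apply/andP; split; [lra|rewrite divr_gt0//; lra].
move=> w; rewrite lt_min [X in _ && X]ltr_pdivlMr; last by lra.
move=> /andP[wr we].
have [->|wz] := eqVneq w z; first by rewrite !subrr mulr0 subrr nm0 mulr0.
have := dP (exist _ w (conj wz wr)) => /= h.
have wz' : w - z != 0 by rewrite subr_eq0.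
have -> : g w - g z - d * (w - z) = ((g w - g z) / (w - z) - d) * (w - z) by field.
by rewrite nmM ler_wpM2r ?nm_ge0//; have := nm_ge0 (w - z); lra.
Qed.

(** The divided difference is continuous at its base point, hence differentiable there by
    [removable]. *)
Lemma slope_holo f z r z0 d : holo_on f z r -> nm (z0 - z) < r -> cdiff f z0 d ->
  holo_on (slope f z0 d) z r.
Proof.
move=> fh z0r fd w wr; have [->|wz0] := eqVneq w z0; last first.
  by have [e eP] := fh w wr; exact: slope_cdiff eP.
apply: (@removable _ z0 (r - nm (z0 - z))); first by rewrite subr_gt0.
  exact: slope_ccont.
move=> v vz0 vne; have [|e eP] := fh v; last exact: slope_cdiff eP.
by have := nm_triangle v z z0; lra.
Qed.

Lemma holo_on_sub f z r z' r' : holo_on f z r -> nm (z' - z) + r' <= r -> holo_on f z' r'.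
Proof. by move=> fh h w wz; apply: fh; have := nm_triangle w z z'; lra. Qed.

(** The derivative is the value at [z] of the divided difference, which the maximum principle bounds
    by values at distance at least [rho] from [z]. *)
Lemma cauchy_deriv f z r d rho (M : R) : holo_on f z r -> cdiff f z d -> 0 < rho -> 2 * rho < r ->
  (forall w, nm (w - z) <= 2 * rho -> nm (f w) <= M) -> nm d <= 2 * M / rho.
Proof.
move=> fh fd r0 rr fM; rewrite -(slope_eq f z d).
have r1 : nm (z - z) < r by rewrite subrr nm0; lra.
have M0 : 0 <= M by apply: le_trans (nm_ge0 (f z)) (fM z _); rewrite subrr nm0; lra.
apply: (@max_principle R (slope f z d) z rho _ [::]) => //.
- by rewrite divr_ge0//; lra.
- move=> w /(csq_nm r0) wz _; apply: (slope_holo fh r1 fd); lra.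
- move=> w /(cbd_nm r0)/andP[w1 w2]; apply: slope_bound => //; first exact: fM.
  by apply: fM; rewrite subrr nm0; lra.
Qed.

(* From f w = f z + (w - z) f' z + (w - z)^2 k w with k holomorphic, one reads off
   the derivative 2 k z of f' at z. *)
Lemma deriv_cdiff f f' z r : 0 < r -> (forall w, nm (w - z) < r -> cdiff f w (f' w)) ->
  exists d, cdiff f' z d.
Proof.
move=> r0 fd; have fh : holo_on f z r by move=> w /fd; exists (f' w).
have z1 : nm (z - z) < r by rewrite subrr nm0.
have gh := slope_holo fh z1 (fd z z1); set g := slope f z (f' z) in gh.
have [g' g'P] := gh z z1.
have kh := slope_holo gh z1 g'P; set k := slope g z g' in kh.
have kd w : exists d, nm (w - z) < r -> cdiff k w d.
  by case: (pselect (nm (w - z) < r)) => [/kh[d dP]|nw]; [exists d|exists 0].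
have [k' k'P] := choice kd.
have fE w : f w = f z + f' z * (w - z) + (w - z) * (w - z) * k w.
  rewrite (slopeE f z (f' z) w) -/g (slopeE g z g' w) -/k /g slope_eq; ring.
have f'E w : nm (w - z) < r -> f' w = f' z + 2 * (w - z) * k w + (w - z) * (w - z) * k' w.
  move=> wr; apply: cdiff_unique (fd w wr) _.
  have sd := cdiffB (cdiff_id w) (cdiff_cst z w).
  have := cdiffD (cdiffD (cdiff_cst (f z) w) (cdiffM (cdiff_cst (f' z) w) sd)) (cdiffM (cdiffM sd sd) (k'P w wr)).
  have -> : 0 + (f' z * (1 - 0) + (w - z) * 0) +
     ((w - z) * (w - z) * k' w + k w * ((w - z) * (1 - 0) + (w - z) * (1 - 0))) =
     f' z + 2 * (w - z) * k w + (w - z) * (w - z) * k' w by ring.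
  by apply: cdiff_ext ltr01 _ => v _; rewrite [RHS]fE.
pose rho := r / 8.
have rho0 : 0 < rho by rewrite /rho; lra.
have kc w : nm (w - z) < r -> ccont k w by move=> /kh[d /cdiff_ccont].
have [|||M M0 kM] := @disc_bounded k z r (3 * rho); [by lra|by rewrite /rho; lra|exact: kc|].
(* A bound on [k'] is enough, since it enters the expansion of [f'] with the factor
   [(w - z) * (w - z)]. *)
have k'M w : nm (w - z) < rho -> nm (k' w) <= 2 * M / rho.
  move=> wr; apply: (@cauchy_deriv k w (r / 2)) => //.
  - by apply: holo_on_sub kh _; rewrite /rho in wr; lra.
  - by apply: k'P; rewrite /rho in wr; lra.
  - by rewrite /rho; lra.
  - by move=> v vw; apply: kM; have := nm_triangle v z w; lra.
exists (2 * k z) => e e0.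
pose K := 2 * M / rho.
have K0 : 0 <= K by rewrite divr_ge0//; lra.
have e4 : 0 < e / 4 by lra.
have [del del0 dP] := kc z z1 _ e4.
exists (Num.min (Num.min rho del) (e / (2 * (K + 1)))).
  by rewrite !lt_min rho0 del0 /= divr_gt0//; lra.
move=> w; rewrite !lt_min [X in _ && X]ltr_pdivlMr; last by lra.
move=> /andP[/andP[wr wd] we].
rewrite f'E; last by rewrite /rho in wr; lra.
have -> : f' z + 2 * (w - z) * k w + (w - z) * (w - z) * k' w - f' z - 2 * k z * (w - z) =
  (w - z) * (2 * (k w - k z) + (w - z) * k' w) by ring.
rewrite nmM mulrC ler_wpM2r ?nm_ge0//.
have := nmD (2 * (k w - k z)) ((w - z) * k' w); rewrite !nmM.
have -> : nm (2 : C) = 2 by rewrite -(rc_nat R 2) nm_rc ger0_norm.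
have := dP w wd; have := k'M w wr; rewrite -/K => h1 h2 h3.
have : nm (w - z) * nm (k' w) <= nm (w - z) * K by rewrite ler_wpM2l ?nm_ge0.
have := nm_ge0 (w - z); lra.
Qed.

End RemovableSingularity.

(** * Taylor expansions and primitives *)

Section Primitive.
Variable R : realType.
Local Notation C := (Cx R).
Implicit Types (z w a d : C) (f g : C -> C) (rho r : R) (n : nat).

(** Along the segment from [z] to [w] the deviation from [f z] stays below [e * t] for every
    positive [e], by continuation in [t]. *)
Lemma zero_derivative f z r : (forall w, nm (w - z) < r -> cdiff f w 0) ->
  forall w, nm (w - z) < r -> f w = f z.
Proof.
move=> fd w wr; apply/eqP; rewrite -subr_eq0; apply/eqP; apply: nm_le_small => e e0.
pose p (t : R) := z + rc t * (w - z).
have pz t s : nm (p t - p s) = `|t - s| * nm (w - z).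
  have -> : p t - p s = rc (t - s) * (w - z) by rewrite /p rcB; ring.
  by rewrite nmM nm_rc.
have p0 : p 0 = z by rewrite /p rc0 mul0r addr0.
have p1 : p 1 = w by rewrite /p rc1 mul1r addrC subrK.
have D0 : 0 < nm (w - z) + 1 by have := nm_ge0 (w - z); lra.
have : nm (f (p 1) - f z) <= e * 1.
  apply: (@real_induction R (fun t => nm (f (p t) - f z) <= e * t) 0 1) => //.
    by rewrite p0 subrr nm0 mulr0.
  move=> t /andP[t0 t1].
  have pt : nm (p t - z) < r.
    rewrite -p0 pz subr0 ger0_norm//; apply: le_lt_trans wr.
    by rewrite ler_piMl ?nm_ge0.
  have e1 : 0 < e / (nm (w - z) + 1) by rewrite divr_gt0.
  have [del del0 dP] := fd _ pt _ e1.
  exists (del / (nm (w - z) + 1)) => [|s /andP[s0 s1] st]; first by rewrite divr_gt0.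
  have ps : nm (p s - p t) < del.
    rewrite pz; move: st; rewrite ltr_pdivlMr// mulrDr mulr1.
    by have := normr_ge0 (s - t); lra.
  have := dP _ ps; rewrite mul0r subr0 pz => h.
  have {}h : nm (f (p s) - f (p t)) <= e * `|s - t|.
    apply: le_trans h _; set k := e / _ in e1 *.
    have -> : e = k * (nm (w - z) + 1) by rewrite /k; field; lra.
    have : 0 <= k * `|s - t| by rewrite mulr_ge0// ltW.
    lra.
  split=> ts hs.
    have := nm_triangle (f (p t)) (f z) (f (p s)); rewrite (nmB (f (p t)) (f (p s))).
    by move: h; rewrite distrC ger0_norm; lra.
  have := nm_triangle (f (p s)) (f z) (f (p t)).
  by move: h; rewrite ger0_norm; lra.
by rewrite p1 mulr1.
Qed.

Lemma geometric_sum_le n m : \sum_(n <= j < m) (2 : R) ^- j <= 2 * 2 ^- n.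
Proof.
have [nm|mn] := leqP n m; last first.
  by rewrite big_geq ?(ltnW mn)// mulr_ge0// invr_ge0 exprn_ge0.
suff -> : \sum_(n <= j < m) (2 : R) ^- j = 2 * 2 ^- n - 2 * 2 ^- m.
  by rewrite gerBl mulr_ge0// invr_ge0 exprn_ge0.
have tel j : (2 : R) ^- j = (- (2 * 2 ^- j.+1)) - (- (2 * 2 ^- j)).
  rewrite exprS invfM; field; by rewrite expf_neq0.
by under eq_bigr do rewrite tel; rewrite telescope_sumr//; ring.
Qed.

Lemma nm_sum_nat n m (F : nat -> C) : nm (\sum_(n <= j < m) F j) <= \sum_(n <= j < m) nm (F j).
Proof.
elim/big_ind2: _ => [|x1 x2 y1 y2 h1 h2|//]; first by rewrite nm0.
by apply: le_trans (nmD _ _) _; exact: lerD.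
Qed.

(** Iterated divided differences at [z]: they give an exact Taylor formula without higher
    derivatives or factorials. *)
Definition taylor_remainder z f n : C -> C := iter n (fun g => slope g z (derive1 (g : C -> C^o) z)) f.
Definition taylor_coef z f n : C := taylor_remainder z f n z.

Lemma taylor_remainder_holo f z r n : 0 < r -> holo_on f z r -> holo_on (taylor_remainder z f n) z r.
Proof.
move=> r0 fh; elim: n => [//|n ih] /=.
have z0 : nm (z - z) < r by rewrite subrr nm0.
by have [d dP] := ih z z0; apply: slope_holo => //; rewrite (derive1_cdiff dP).
Qed.

Lemma taylorE f z n w :
  f w = \sum_(0 <= j < n) taylor_coef z f j * (w - z) ^+ j + (w - z) ^+ n * taylor_remainder z f n w.
Proof.
elim: n => [|n ih]; first by rewrite big_geq// add0r expr0 mul1r.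
rewrite {1}ih big_nat_recr//= -addrA; congr (_ + _).
by rewrite [taylor_remainder z f n w](slopeE _ z (derive1 (taylor_remainder z f n : C -> C^o) z)) /taylor_coef exprS; ring.
Qed.

(** One divided difference costs the factor [4 / rho]: at distance at least [rho / 2] from [z] by
    the direct estimate, and closer to [z] by the maximum principle on a square of half-side [rho]
    around [w], whose boundary lies in the first range. *)
Lemma taylor_remainder_bound f z rho (M : R) n : 0 < rho -> holo_on f z (8 * rho) ->
  (forall w, nm (w - z) <= 3 * rho -> nm (f w) <= M) ->
  forall w, nm (w - z) <= 3 * rho -> nm (taylor_remainder z f n w) <= M * (4 / rho) ^+ n.
Proof.
move=> r0 fh fM; have r8 : 0 < 8 * rho by lra.
elim: n => [|n ih] w wr; first by rewrite expr0 mulr1; exact: fM.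
have z3 : nm (z - z) <= 3 * rho by rewrite subrr nm0; lra.
have far v : rho / 2 <= nm (v - z) -> nm (v - z) <= 3 * rho ->
    nm (taylor_remainder z f n.+1 v) <= M * (4 / rho) ^+ n.+1.
  move=> v1 v2; have -> : M * (4 / rho) ^+ n.+1 = 2 * (M * (4 / rho) ^+ n) / (rho / 2).
    by rewrite exprS; field; lra.
  by apply: slope_bound => //; [lra|exact: ih|exact: ih].
have [wf|wn] := lerP (rho / 2) (nm (w - z)); first exact: far.
apply: (@max_principle R _ w rho _ [::]) => //.
- apply: mulr_ge0; first by apply: le_trans (nm_ge0 (f z)) (fM z z3).
  by rewrite exprn_ge0// divr_ge0//; lra.
- move=> v /(csq_nm r0) vw _; apply: (@taylor_remainder_holo f z _ n.+1 r8 fh).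
  by have := nm_triangle v z w; lra.
- move=> v /(cbd_nm r0)/andP[v1 v2]; apply: far.
    by have := nm_triangle v w z; rewrite (nmB z w); lra.
  by have := nm_triangle v z w; lra.
Qed.

(** The factor [s] on the left avoids an exponent [j.-1] on the right. The factor [j.+1] will cancel
    against the denominator from termwise integration, and the wasteful [2 ^+ j] keeps the induction
    short. *)
Lemma taylor_power_increment (s : R) (v v' : C) (j : nat) : 0 <= s -> nm v <= s -> nm v' <= s ->
  s * nm (v' ^+ j.+1 - v ^+ j.+1 - j.+1%:R * v ^+ j * (v' - v)) <=
    j.+1%:R * (2 * s) ^+ j * nm (v' - v) ^+ 2.
Proof.
move=> s0 vs v's; elim: j => [|j ih].
  have -> : v' ^+ 1 - v ^+ 1 - 1 * v ^+ 0 * (v' - v) = 0 by ring.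
  by rewrite nm0 mulr0 mul1r expr0 mul1r sqr_ge0.
have -> : v' ^+ j.+2 - v ^+ j.+2 - j.+2%:R * v ^+ j.+1 * (v' - v) =
  v' * (v' ^+ j.+1 - v ^+ j.+1 - j.+1%:R * v ^+ j * (v' - v)) + j.+1%:R * v ^+ j * (v' - v) ^+ 2.
  by rewrite -[j.+2%:R]natr1 !exprS; ring.
set r := _ - _ * _ * _ in ih *; set h := v' - v in r ih *.
have n1 : nm (j.+1%:R : C) = j.+1%:R by rewrite -rc_nat nm_rc ger0_norm.
have := nmD (v' * r) (j.+1%:R * v ^+ j * h ^+ 2); rewrite !nmM !nmX n1 => h1.
have h2 : nm v ^+ j <= s ^+ j by rewrite lerXn2r// ?nnegrE ?nm_ge0.
have h3 : nm v' * nm r <= s * nm r by rewrite ler_wpM2r ?nm_ge0.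
have H0 : 0 <= nm h ^+ 2 by rewrite sqr_ge0.
have J0 : 0 <= j.+1%:R :> R by [].
have h4 : j.+1%:R * nm v ^+ j * nm h ^+ 2 <= j.+1%:R * s ^+ j * nm h ^+ 2.
  by rewrite ler_wpM2r// ler_wpM2l.
have h5 : s * nm (v' * r + j.+1%:R * v ^+ j * h ^+ 2) <=
    s * (j.+1%:R * (2 * s) ^+ j * nm h ^+ 2) + s * (j.+1%:R * s ^+ j * nm h ^+ 2).
  rewrite -mulrDr ler_wpM2l//; lra.
apply: le_trans h5 _.
have p1 : 1 <= (2 : R) ^+ j by apply: exprn_ege1; lra.
rewrite !exprMn [2 ^+ _.+1]exprS [s ^+ _.+1]exprS -[j.+2%:R]natr1.
set J : R := j.+1%:R in J0 *; set H := nm h ^+ 2 in H0 *; set P := 2 ^+ j in p1 *; set T := s ^+ j.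
have T0 : 0 <= s * T * H by rewrite mulr_ge0// mulr_ge0// exprn_ge0.
have : 0 <= J * (P - 1) * (s * T * H) by rewrite mulr_ge0// mulr_ge0// subr_ge0.
have : 0 <= P * (s * T * H) by rewrite mulr_ge0//; lra.
lra.
Qed.

(** The Taylor series is integrated term by term. The partial sums satisfy a quadratic error bound
    uniform in [n], which passes to the limit and yields the derivative. *)
Lemma primitive_exists f z r : 0 < r -> holo_on f z r ->
  exists h : C -> C, forall w, nm (w - z) < r / 128 -> cdiff h w (f w).
Proof.
(* With [s = rho / 16] the product [4 / rho * (2 * s)] is [1 / 2], so the error terms, which carry
   [(2 * s) ^+ j], are still dominated by a geometric series. Altogether [s = r / 128]. *)
move=> r0 fh; pose rho := r / 8; pose s := rho / 16.
have rho0 : 0 < rho by rewrite /rho; lra.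
have s0 : 0 < s by rewrite /s; lra.
have r8 : 8 * rho = r by rewrite /rho; field.
have fc w : nm (w - z) < r -> ccont f w by move=> /fh[d /cdiff_ccont].
have [|||M M0 fM] := @disc_bounded R f z r (3 * rho); [by lra|by rewrite /rho; lra|exact: fc|].
have gM n w : nm (w - z) <= 3 * rho -> nm (taylor_remainder z f n w) <= M * (4 / rho) ^+ n.
  by apply: taylor_remainder_bound => //; rewrite r8.
pose a := taylor_coef z f.
have aM n : nm (a n) <= M * (4 / rho) ^+ n by apply: gM; rewrite subrr nm0; lra.
have s4 n : (4 / rho) ^+ n * s ^+ n = 4 ^- n.
  by rewrite -exprMn /s -exprVn; congr (_ ^+ _); field; lra.
have s24 n : (4 / rho) ^+ n * (2 * s) ^+ n = 2 ^- n.
  by rewrite -exprMn /s -exprVn; congr (_ ^+ _); field; lra.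
pose F n w := \sum_(0 <= j < n) a j * (w - z) ^+ j.
pose H n w := \sum_(0 <= j < n) a j / j.+1%:R * (w - z) ^+ j.+1.
have nn j : nm (j.+1%:R : C) = j.+1%:R by rewrite -rc_nat nm_rc ger0_norm.
have half4 n : (4 : R) ^- n <= 2 ^- n.
  by rewrite lef_pV2 ?posrE ?exprn_gt0// lerXn2r// ?nnegrE; lra.
have FP n w : nm (w - z) <= s -> nm (f w - F n w) <= M * 2 ^- n.
  move=> ws; rewrite {1}(taylorE f z n w) -/(F n w) addrC addKr nmM nmX.
  have h1 : nm (w - z) ^+ n <= s ^+ n by rewrite lerXn2r ?nnegrE ?nm_ge0// ltW.
  have h2 : nm (taylor_remainder z f n w) <= M * (4 / rho) ^+ n by apply: gM; rewrite /s in ws; lra.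
  apply: le_trans (ler_pM _ _ h1 h2) _; rewrite ?exprn_ge0 ?nm_ge0//.
  by rewrite mulrCA [s ^+ n * _]mulrC s4 ler_wpM2l.
have HC w : nm (w - z) <= s -> forall n m, (n <= m)%N -> nm (H n w - H m w) <= s * M * 2 * 2 ^- n.
  move=> ws n m nm_; rewrite nmB /H (big_cat_nat (leq0n n) nm_) /= addrAC subrr add0r.
  apply: le_trans (nm_sum_nat _ _ _) _.
  apply: (@le_trans _ _ (\sum_(n <= j < m) s * M * 2 ^- j)).
    apply: ler_sum => j _; rewrite !nmM nmV nn nmX.
    have h1 : nm (w - z) ^+ j.+1 <= s ^+ j.+1 by rewrite lerXn2r ?nnegrE ?nm_ge0// ltW.
    have h2 : nm (a j) / j.+1%:R <= M * (4 / rho) ^+ j.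
      apply: le_trans (aM j); rewrite ler_pdivrMr// ler_peMr ?nm_ge0//.
      by rewrite (ler_nat _ 1).
    apply: le_trans (ler_pM _ _ h2 h1) _; rewrite ?exprn_ge0 ?nm_ge0 ?divr_ge0 ?nm_ge0//.
    rewrite exprS; have -> : M * (4 / rho) ^+ j * (s * s ^+ j) = s * M * ((4 / rho) ^+ j * s ^+ j) by ring.
    by rewrite s4 ler_wpM2l// mulr_ge0// ltW.
  rewrite -mulr_sumr -[leRHS]mulrA; apply: ler_wpM2l; last exact: geometric_sum_le.
  by rewrite mulr_ge0// ltW.
have HL w : exists l, nm (w - z) <= s -> forall n, nm (H n w - l) <= 2 * (s * M * 2 * 2 ^- n).
  case: (pselect (nm (w - z) <= s)) => [ws|]; last by exists 0.
  have [|l lP] := @Cx_cauchy_limit R nat (fun n => H n w) (fun n => s * M * 2 * 2 ^- n) 0%N.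
    move=> i j; have P0 k : 0 <= s * M * 2 * 2 ^- k.
      by rewrite !mulr_ge0 ?invr_ge0 ?exprn_ge0// ltW.
    have [/(HC w ws)|/ltnW/(HC w ws)] := leqP i j; have := P0 i; have := P0 j; first lra.
    by rewrite nmB; lra.
  by exists l.
have [h hP] := choice HL; exists h => w ws.
have sE : r / 128 = s by rewrite /s /rho; field.
rewrite sE in ws.
move=> e e0; exists (Num.min (s - nm (w - z)) (s * e / (2 * M + 1))).
  rewrite lt_min subr_gt0 ws /= divr_gt0 ?mulr_gt0//; lra.
move=> w'; rewrite lt_min [X in _ && X]ltr_pdivlMr; last by lra.
move=> /andP[w'1 w'2].
have w's : nm (w' - z) <= s by have := nm_triangle w' z w; lra.
suff main : s * nm (h w' - h w - f w * (w' - w)) <= 2 * M * nm (w' - w) ^+ 2.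
  rewrite -(ler_pM2l s0); apply: le_trans main _.
  by rewrite expr2; have := nm_ge0 (w' - w); nra.
have part n : s * nm (H n w' - H n w - F n w * (w' - w)) <= 2 * M * nm (w' - w) ^+ 2.
  have -> : H n w' - H n w - F n w * (w' - w) = \sum_(0 <= j < n)
     a j / j.+1%:R * ((w' - z) ^+ j.+1 - (w - z) ^+ j.+1 - j.+1%:R * (w - z) ^+ j * (w' - w)).
    rewrite /H /F mulr_suml -!sumrB; apply: eq_bigr => j _.
    have : j.+1%:R != 0 :> C by rewrite pnatr_eq0.
    by move: (j.+1%:R : C) => J J0; field.
  apply: le_trans (ler_wpM2l (ltW s0) (nm_sum_nat _ _ _)) _.
  rewrite mulr_sumr; apply: (@le_trans _ _ (\sum_(0 <= j < n) M * nm (w' - w) ^+ 2 * 2 ^- j)).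
    apply: ler_sum => j _; rewrite !nmM nmV nn.
    have := @taylor_power_increment s (w - z) (w' - z) j (ltW s0) (ltW ws) w's.
    have -> : w' - z - (w - z) = w' - w by ring.
    set X := nm (_ - _ * _ * _) => hX.
    have j0 : 0 < j.+1%:R :> R by [].
    have -> : s * (nm (a j) / j.+1%:R * X) = nm (a j) / j.+1%:R * (s * X) by ring.
    apply: le_trans (ler_wpM2l _ hX) _; first by rewrite divr_ge0 ?nm_ge0.
    have -> : nm (a j) / j.+1%:R * (j.+1%:R * (2 * s) ^+ j * nm (w' - w) ^+ 2) =
      nm (a j) * ((2 * s) ^+ j * nm (w' - w) ^+ 2).
      by move: j0; move: (j.+1%:R : R) => J J0; field; lra.
    apply: le_trans (ler_wpM2r _ (aM j)) _; first by rewrite mulr_ge0 ?exprn_ge0 ?nm_ge0 ?mulr_ge0// ltW.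
    have -> : M * (4 / rho) ^+ j * ((2 * s) ^+ j * nm (w' - w) ^+ 2) =
      M * nm (w' - w) ^+ 2 * ((4 / rho) ^+ j * (2 * s) ^+ j) by ring.
    by rewrite s24.
  rewrite -mulr_sumr; have := geometric_sum_le 0 n; rewrite expr0 invr1 => g2.
  have N0 : 0 <= M * nm (w' - w) ^+ 2 by rewrite mulr_ge0 ?sqr_ge0.
  by have := ler_wpM2l N0 g2; lra.
apply/ler_addgt0Pr => c c0.
(* The cost, up to [2 ^- n], of replacing [h] and [f] by partial sums: [4 * (s * M)] for each of
   [h w'] and [h w], and [M * nm (w' - w)] for [f w]. *)
pose B := s * (8 * (s * M) + M * nm (w' - w)).
have B0 : 0 <= B by rewrite mulr_ge0 ?addr_ge0 ?mulr_ge0 ?nm_ge0// ltW.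
have [n nP] := expr_unbounded (B / c) (isT : (1 < 2)%N).
have {}nP : B * 2 ^- n <= c.
  by rewrite ler_pdivrMr ?exprn_gt0// mulrC -ler_pdivrMr// ltW.
have h1 := hP w (ltW ws) n; have h2 := hP w' w's n; have h3 := FP n w (ltW ws).
have -> : h w' - h w - f w * (w' - w) = (H n w' - H n w - F n w * (w' - w)) +
   ((h w' - H n w') + ((H n w - h w) + (F n w - f w) * (w' - w))) by ring.
set A := H n w' - _ - _.
have t1 := nmD A ((h w' - H n w') + ((H n w - h w) + (F n w - f w) * (w' - w))).
have t2 := nmD (h w' - H n w') ((H n w - h w) + (F n w - f w) * (w' - w)).
have t3 := nmD (H n w - h w) ((F n w - f w) * (w' - w)).
rewrite (nmB (h w')) in t2; rewrite nmM (nmB (F n w)) in t3.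
have t4 : nm (f w - F n w) * nm (w' - w) <= M * 2 ^- n * nm (w' - w) by rewrite ler_wpM2r ?nm_ge0.
have : s * nm (A + ((h w' - H n w') + ((H n w - h w) + (F n w - f w) * (w' - w)))) <=
   s * (nm A + (8 * (s * M) + M * nm (w' - w)) * 2 ^- n).
  rewrite ler_pM2l//; lra.
have := part n; rewrite -/A mulrDr; rewrite /B in nP; lra.
Qed.

End Primitive.

(** * Pullback of holomorphic forms *)

Section SurfaceCalculus.
Variables (R : realType) (S : riemann_surface R).
Local Notation C := (Cx R).
Local Notation D i := (chart_dom (rs_chart (r:=S) i)).
Local Notation z i := (chart_coord (rs_chart (r:=S) i)).
Local Notation zi i := (icoord (rs_chart (r:=S) i)).
Implicit Types (x y : S) (u v a : C) (w : holo_form S).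

Lemma holo_atP (h : C -> C) u :
  holo_at h u <-> exists2 e : R, 0 < e & holo_on h u e.
Proof.
rewrite /holo_at; split=> [/Cx_nearP[e e0 eP]|[e e0 eP]].
  by exists e => // v /eP /derivable_cdiff.
by apply/Cx_nearP; exists e => // v /eP /derivable_cdiff.
Qed.

Lemma chart_openD i : open (D i). Proof. by have [] := rs_is_chart (r:=S) i. Qed.

Lemma icoordK i x : D i x -> zi i (z i x) = x.
Proof. by have [_ _ + _ _] := rs_is_chart (r:=S) i; apply. Qed.

Lemma icoord_near i x (U : set S) : D i x -> nbhs x U ->
  exists2 e : R, 0 < e & forall u, nm (u - z i x) < e ->
    [/\ D i (zi i u), z i (zi i u) = u & U (zi i u)].
Proof.
move=> Dx Ux; have [_ oz K _ cz] := rs_is_chart (r:=S) i.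
have zx : (z i @` D i) (z i x) by exists x.
move: cz; rewrite continuous_open_subspace// => /(_ (z i x)).
rewrite inE => /(_ zx) cz.
have U' : nbhs (zi i (z i x)) U by rewrite icoordK.
have /Cx_nearP[e e0 eP] := cz _ U'.
have /Cx_nearP[e' e'0 e'P] : \forall u \near z i x, (z i @` D i) u.
  exact: open_nbhs_nbhs.
exists (Num.min e e'); first by rewrite lt_min e0.
move=> u; rewrite lt_min => /andP[/eP Uu /e'P[y Dy yu]].
by rewrite -yu icoordK//; split=> //; rewrite -[y](@icoordK i)// yu.
Qed.

Lemma coord_near i x (e : R) : D i x -> 0 < e ->
  \forall y \near x, D i y /\ nm (z i y - z i x) < e.
Proof.
move=> Dx e0; have [oD _ _ cz _] := rs_is_chart (r:=S) i.
move: cz; rewrite continuous_open_subspace// => /(_ x).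
rewrite inE => /(_ Dx) cz; apply: filterI; first exact: open_nbhs_nbhs.
by apply: (cz [set u | nm (u - z i x) < e]); apply/Cx_nearP; exists e.
Qed.

(** With [f := id] this is a change of coordinates, so one chain rule covers maps and charts. *)
Definition chart_lift (f : S -> S) i j : C -> C := z j \o f \o zi i.

Lemma holo_map_id : @holo_map R S id.
Proof. by split=> [x|i j x]; [exact: cvg_id|exact: rs_compat]. Qed.

Lemma holo_lift f i j x : holo_map f -> D i x -> D j (f x) ->
  exists d, cdiff (chart_lift f i j) (z i x) d.
Proof.
move=> [_ h] Dx Df; have /holo_atP[e e0 eP] := h i j x Dx Df.
by apply: eP; rewrite subrr nm0.
Qed.

Lemma lift_chain (f g : S -> S) i j k x : holo_map f -> holo_map g ->
  D i x -> D j (f x) -> D k (g (f x)) ->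
  derive1 (chart_lift (g \o f) i k) (z i x) =
    derive1 (chart_lift g j k) (z j (f x)) * derive1 (chart_lift f i j) (z i x).
Proof.
move=> hf hg Dx Df Dg.
have [d dP] := holo_lift hf Dx Df; have [e eP] := holo_lift hg Df Dg.
rewrite (derive1_cdiff dP) (derive1_cdiff eP); apply: derive1_cdiff.
have eP' : cdiff (chart_lift g j k) (chart_lift f i j (z i x)) e by rewrite /chart_lift/= icoordK.
have [r r0 rP] : exists2 r : R, 0 < r & forall u, nm (u - z i x) < r ->
    [/\ D i (zi i u), z i (zi i u) = u & D j (f (zi i u))].
  apply: (@icoord_near i x (f @^-1` D j)) => //; apply: hf.1; apply: open_nbhs_nbhs; split=> //.
  exact: chart_openD.
apply: cdiff_ext r0 _ (cdiff_comp dP eP') => u /rP[_ _ Dfu].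
by rewrite /chart_lift /= icoordK.
Qed.

Lemma form_cocycle w i j x : D i x -> D j x ->
  val w i x = val w j x * derive1 (chart_lift id i j) (z i x).
Proof. by have /asboolP[_ _ h] := valP w; exact: h. Qed.

Lemma form_off w i x : ~ D i x -> val w i x = 0.
Proof. by have /asboolP[h _ _] := valP w; exact: h. Qed.

Lemma form_holo w i x : D i x -> holo_at (val w i \o zi i) (z i x).
Proof. by have /asboolP[_ h _] := valP w; exact: h. Qed.

Section Pullback.
Variable f : S -> S.
Hypothesis hf : holo_map f.

(** The cocycle rule of [w] on the target compensates the change of chart, by the chain rule with
    [g := id]. *)
Lemma pullback_indep w i j j' x : D i x -> D j (f x) -> D j' (f x) ->
  val w j (f x) * derive1 (chart_lift f i j) (z i x) =
  val w j' (f x) * derive1 (chart_lift f i j') (z i x).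
Proof.
move=> Dx Dj Dj'; rewrite (form_cocycle w Dj Dj') -mulrA.
by rewrite -(lift_chain hf holo_map_id Dx Dj Dj').
Qed.

(** The chart around [f x] is chosen point by point; [pullback_indep] makes the choice harmless and
    lets one fixed chart serve on a whole neighbourhood. *)
Definition pullback_coef w i x : C :=
  if pselect (D i x) then
    val w (sval (cid (rs_cover (f x)))) (f x) *
      derive1 (chart_lift f i (sval (cid (rs_cover (f x))))) (z i x)
  else 0.

Lemma pullback_coefE w i j x : D i x -> D j (f x) ->
  pullback_coef w i x = val w j (f x) * derive1 (chart_lift f i j) (z i x).
Proof.
move=> Dx Dj; rewrite /pullback_coef; case: (pselect (D i x)) => [Dx'|nDx]; last by have := nDx Dx.
exact: (pullback_indep w Dx (svalP (cid (rs_cover (f x)))) Dj).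
Qed.

Lemma pullback_coef_form w : is_form (pullback_coef w).
Proof.
split=> [i x nD|i x Dx|i i' x Dx Dx'].
- by rewrite /pullback_coef; case: (pselect (D i x)) => [Dx|//]; have := nD Dx.
- have [j Dj] := rs_cover (f x).
  have /holo_atP[e1 e10 e1P] := form_holo w Dj.
  have /holo_atP[e2 e20 e2P] : holo_at (chart_lift f i j) (z i x) by apply: hf.2.
  have z0 : nm (z i x - z i x) < e2 by rewrite subrr nm0.
  have [d dP] := e2P _ z0.
  have [e3 e30 e3P] := cdiff_cont dP e10.
  have [e4 e40 e4P] : exists2 r : R, 0 < r & forall u, nm (u - z i x) < r ->
    [/\ D i (zi i u), z i (zi i u) = u & D j (f (zi i u))].
    apply: (@icoord_near i x (f @^-1` D j)) => //; apply: hf.1; apply: open_nbhs_nbhs; split=> //.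
    exact: chart_openD.
  apply/holo_atP; exists (Num.min e2 (Num.min e3 e4)); first by rewrite !lt_min e20 e30.
  move=> u; rewrite !lt_min => /and3P[u2 u3 u4].
  have [d' d'P] := e2P u u2.
  have [d2 d2P] : exists d2, cdiff (val w j \o zi j) (chart_lift f i j u) d2.
    by apply: e1P; have := e3P u u3; rewrite {2}/chart_lift/= icoordK.
  have [d3 d3P] : exists d3, cdiff (fun v => derive1 (chart_lift f i j) v) u d3.
    apply: (@deriv_cdiff R (chart_lift f i j) _ u (e2 - nm (u - z i x))); first by rewrite subr_gt0.
    move=> v vu; have [|d4 d4P] := e2P v; last by rewrite (derive1_cdiff d4P).
    by have := nm_triangle v (z i x) u; lra.
  eexists; apply: (@cdiff_ext _ _ _ _ _ (e4 - nm (u - z i x))) (cdiffM (cdiff_comp d'P d2P) d3P).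
    by rewrite subr_gt0.
  move=> v vu; have [|Dv zv Dfv] := e4P v.
    by have := nm_triangle v (z i x) u; lra.
  by rewrite /= (pullback_coefE _ Dv Dfv) zv /chart_lift /= icoordK.
- have [j Dj] := rs_cover (f x).
  rewrite (pullback_coefE _ Dx Dj) (pullback_coefE _ Dx' Dj) -mulrA.
  by rewrite -(lift_chain holo_map_id hf Dx Dx' Dj).
Qed.

Lemma pullbackP w : is_pullback f w (pullback f w).
Proof.
have wP : pullback_coef w \in @form_pred R S by apply/asboolP; exact: pullback_coef_form.
have pw : is_pullback f w (Sub (pullback_coef w) wP).
  by move=> i j x Dx Df; rewrite SubK (pullback_coefE _ Dx Df).
have ex : exists w', [set w' | is_pullback f w w'] w' by exists (Sub (pullback_coef w) wP).
exact: (xgetPex 0 ex).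
Qed.

End Pullback.

Lemma is_pullback_unique (f : S -> S) w w1 w2 :
  is_pullback f w w1 -> is_pullback f w w2 -> w1 = w2.
Proof.
move=> h1 h2; apply: val_inj; apply/funext => i; apply/funext => x.
case: (pselect (D i x)) => Dx; last by rewrite !form_off.
by have [j Dj] := rs_cover (f x); rewrite (h1 i j x Dx Dj) (h2 i j x Dx Dj).
Qed.

Lemma pullback_id w : pullback id w = w.
Proof.
apply: is_pullback_unique (pullbackP holo_map_id w) _ => i j x Dx Df.
exact: form_cocycle.
Qed.

Lemma pullback_comp (f g : S -> S) w : holo_map f -> holo_map g -> holo_map (g \o f) ->
  pullback (g \o f) w = pullback f (pullback g w).
Proof.
move=> hf hg hgf; apply: is_pullback_unique (pullbackP hgf w) _ => i k x Dx Dgf.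
have [j Dj] := rs_cover (f x).
rewrite (pullbackP hf (pullback g w) Dx Dj) (pullbackP hg w Dj Dgf) -mulrA.
by rewrite -(lift_chain hf hg Dx Dj Dgf).
Qed.

Lemma val_formD (a : C) w1 w2 i x : val (a *: w1 + w2) i x = a * val w1 i x + val w2 i x.
Proof. by []. Qed.

Lemma pullback_linear (f : S -> S) a w1 w2 : holo_map f ->
  pullback f (a *: w1 + w2) = a *: pullback f w1 + pullback f w2.
Proof.
move=> hf; apply: is_pullback_unique (pullbackP hf _) _ => i j x Dx Df.
rewrite !val_formD (pullbackP hf w1 Dx Df) (pullbackP hf w2 Dx Df).
by rewrite mulrA -mulrDl.
Qed.

Lemma jac_push_comp (f g : S -> S) (L : holo_form S -> C) : holo_map f -> holo_map g ->
  holo_map (g \o f) -> jac_push (g \o f) L = jac_push g (jac_push f L).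
Proof. by move=> hf hg hgf; apply/funext => w; rewrite /jac_push pullback_comp. Qed.

Lemma jac_push_tangent (f : S -> S) (L : holo_form S -> C) : holo_map f ->
  tangent (jacobian_torus S) L -> tangent (jacobian_torus S) (jac_push f L).
Proof. by move=> hf lL a w1 w2; rewrite /jac_push pullback_linear// lL. Qed.

Lemma surface_Aut_holo f : surface_Aut S f -> holo_map f. Proof. by case. Qed.

Lemma path_near (T : topologicalType) (c : R -> T) t (U : set T) : is_path c -> 0 <= t <= 1 ->
  nbhs (c t) U -> \forall t' \near t, 0 <= t' <= 1 -> U (c t').
Proof.
move=> /subspace_continuousP cc t01 Ut.
have t01' : `[0, 1]%classic t by rewrite /= in_itv.
have := cc t t01' U Ut; rewrite /nbhs /= /within /=.
by apply: filterS => t' h t'01; apply: h; rewrite in_itv.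
Qed.

(** Let [g] be the inverse of [f] and [h] a local primitive of the pullback. The composite of [h]
    with the chart expression of [g] has as derivative the coefficient of the pullback by [g] of the
    pullback by [f], that is of [w]. *)
Lemma primitive_push f w c (F : R -> C) : surface_Aut S f ->
  is_path c -> is_primitive (pullback f w) c F -> is_primitive w (f \o c) F.
Proof.
move=> [hf [g [hg fg gf]]] cc Fp t t01.
have [i [h [Dc hP Fh]]] := Fp t t01.
have [j Dj] := rs_cover (f (c t)).
have Dgc : D i (g (f (c t))) by rewrite fg.
exists j, (h \o chart_lift g j i); split; first exact: Dj.
  have fgid : f \o g = id by apply/funext => x; exact: gf.
  have /Cx_nearP[e1 e10 e1P] := hP.
  have [d dP] := holo_lift hg Dj Dgc.
  have /holo_atP[e2 e20 e2P] : holo_at (chart_lift g j i) (z j (f (c t))) by apply: hg.2.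
  have [e3 e30 e3P] := cdiff_cont dP e10.
  have [e4 e40 e4P] : exists2 r : R, 0 < r & forall u, nm (u - z j (f (c t))) < r ->
    [/\ D j (zi j u), z j (zi j u) = u & D i (g (zi j u))].
    apply: (@icoord_near j (f (c t)) (g @^-1` D i)) => //; apply: hg.1; apply: open_nbhs_nbhs; split=> //.
    exact: chart_openD.
  apply/Cx_nearP; exists (Num.min e2 (Num.min e3 e4)); first by rewrite !lt_min e20 e30.
  move=> u; rewrite !lt_min => /and3P[u2 u3 u4].
  have [d' d'P] := e2P u u2; have [Du zu Dgu] := e4P u u4.
  have [] := e1P (chart_lift g j i u).
    by have := e3P u u3; rewrite {2}/chart_lift/= icoordK// fg.
  move=> /derivable_cdiff[d1 d1P]; rewrite (derive1_cdiff d1P) => d1E.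
  have hd := cdiff_comp d'P d1P.
  split; first by apply/derivable_cdiff; exists (d1 * d').
  have hfg : holo_map (f \o g) by rewrite fgid; exact: holo_map_id.
  have gfw : pullback g (pullback f w) = w.
    by rewrite -(pullback_comp w hg hf hfg) fgid pullback_id.
  have liftE : zi i (chart_lift g j i u) = g (zi j u) by exact: icoordK.
  have wE := pullbackP hg (pullback f w) Du Dgu.
  rewrite gfw zu -/(chart_lift g j i) (derive1_cdiff d'P) in wE.
  by rewrite (derive1_cdiff hd) d1E liftE wE.
have Ut : nbhs (c t) (f @^-1` D j).
  by apply: hf.1; apply: open_nbhs_nbhs; split=> //; exact: chart_openD.
apply: filterS2 Fh (path_near cc t01 Ut) => t' h1 h2 t'01.
by rewrite h1// /chart_lift /= icoordK ?fg//; exact: h2.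
Qed.

End SurfaceCalculus.

(** * Periods *)

Section SpanOverZ.
Variable V : zmodType.
Implicit Types (k v : V) (ks : seq V).

(** Peeling off one generator at a time suits inductions on [ks]; the generators may be
    dependent. *)
Fixpoint zspan ks v : Prop :=
  if ks is k :: ks' then exists n : int, zspan ks' (v - k *~ n) else v = 0.

Lemma zspan0 ks : zspan ks 0.
Proof. by elim: ks => [//|k ks ih]; exists 0; rewrite mulr0z subr0. Qed.

Lemma zspanB ks v w : zspan ks v -> zspan ks w -> zspan ks (v - w).
Proof.
elim: ks v w => [|k ks ih] v w /=; first by move=> -> ->; rewrite subrr.
move=> [n vn] [m wm]; exists (n - m); have := ih _ _ vn wm.
by rewrite mulrzBr !opprB [X in zspan ks X -> _](AC (2*2) ((1*4)*(3*2))).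
Qed.

Lemma zspanN ks v : zspan ks v -> zspan ks (- v).
Proof. by move=> h; rewrite -sub0r; apply: zspanB (zspan0 ks) h. Qed.

Lemma zspanD ks v w : zspan ks v -> zspan ks w -> zspan ks (v + w).
Proof. by move=> h1 h2; rewrite -[w]opprK; apply: zspanB => //; exact: zspanN. Qed.

Lemma zspanMz ks v (n : int) : zspan ks v -> zspan ks (v *~ n).
Proof.
move=> h; have hn (m : nat) : zspan ks (v *+ m).
  by elim: m => [|m ih]; rewrite ?mulr0n ?mulrS; [exact: zspan0|exact: zspanD].
by case: n => n; [exact: hn|rewrite NegzE mulrNz; apply: zspanN; exact: hn].
Qed.

Lemma zspan_mem ks k : k \in ks -> zspan ks k.
Proof.
elim: ks => [//|k' ks ih]; rewrite inE => /orP[/eqP->|/ih h].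
  by exists 1; rewrite mulr1z subrr; exact: zspan0.
by exists 0; rewrite mulr0z subr0.
Qed.

Lemma zspan_sum ks n (F : 'I_n -> V) : (forall i, zspan ks (F i)) -> zspan ks (\sum_i F i).
Proof.
by move=> h; apply: (big_ind (zspan ks)) => [|x y|i _]; [exact: zspan0|exact: zspanD|exact: h].
Qed.

(** Induction on the generators: [G] is generated by its part [G1] in the span of the tail and by
    one element [g0] whose coefficient [d] at [k] is the least positive one. Representatives are
    those of [G1] shifted by fewer than [M] copies of [g0]. *)
Lemma subgroup_mod_finite (G : V -> Prop) ks (M : nat) : (0 < M)%N -> G 0 ->
  (forall v w, G v -> G w -> G (v - w)) -> (forall v, G v -> zspan ks v) ->
  exists X : seq V, (forall x, x \in X -> G x) /\
    forall v, G v -> exists2 x, x \in X & exists2 g, G g & v - x = g *+ M.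
Proof.
move=> M0; elim: ks G => [|k ks ih] G G0 GB Gk.
  exists [:: 0]; split=> [x|v /Gk /= ->]; first by rewrite inE => /eqP ->.
  by exists 0; rewrite ?mem_head//; exists 0; rewrite ?mul0rn ?subr0.
have GN v : G v -> G (- v) by move=> h; rewrite -sub0r; exact: GB.
have GD v w : G v -> G w -> G (v + w) by move=> h1 h2; rewrite -[w]opprK; apply: GB => //; exact: GN.
have GMn v n : G v -> G (v *+ n).
  by move=> Gv; elim: n => [|n hn]; rewrite ?mulr0n// mulrS; exact: GD.
have GMz v (n : int) : G v -> G (v *~ n).
  by case: n => n Gv; [exact: GMn|rewrite NegzE mulrNz; apply: GN; exact: GMn].
pose G1 v := G v /\ zspan ks v.
have [X [XG XP]] : exists X : seq V, (forall x, x \in X -> G1 x) /\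
    forall v, G1 v -> exists2 x, x \in X & exists2 g, G1 g & v - x = g *+ M.
  apply: ih => [|v w [? ?] [? ?]|v []//]; first by split=> //; exact: zspan0.
  by split; [exact: GB|exact: zspanB].
pose Q (d : nat) := `[< (0 < d)%N /\ exists2 v, G v & zspan ks (v - k *~ d%:Z) >].
case: (pselect (exists d, Q d)) => [exQ|nQ]; last first.
  exists X; split=> [x /XG[]//|v Gv].
  suff /XP[x xX [g [Gg _] e]] : G1 v by exists x => //; exists g.
  split=> //; have /= [n nP] := Gk v Gv.
  suff n0 : n = 0 by move: nP; rewrite n0 mulr0z subr0.
  apply: contrapT => n0; apply: nQ; exists `|n|%N; apply/asboolP.
  split; first by rewrite absz_gt0; apply/eqP.
  case: n n0 nP => n n0 nP; first by exists v.
  exists (- v); first exact: GN.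
  have := zspanN nP; rewrite NegzE mulrNz opprK opprD.
  by [].
have := ex_minnP exQ => -[d /asboolP[d0 [g0 Gg0 g0P]] dmin].
exists [seq x + g0 *+ j | x <- X, j <- iota 0 M]; split.
  move=> y /allpairsP[[x j] /= [/XG[Gx _] _ ->]].
  by apply: GD => //; exact: GMn.
move=> v Gv; have /= [n nP] := Gk v Gv.
(* Division by [d] leaves a smaller coefficient at [k], which is 0 by minimality. *)
pose m := (n %/ d%:Z)%Z.
have vm : zspan ks ((v - g0 *~ m) - k *~ (n %% d%:Z)%Z).
  have g0m : zspan ks (g0 *~ m - k *~ (m * d%:Z)).
    have -> : g0 *~ m - k *~ (m * d%:Z) = (g0 - k *~ d%:Z) *~ m.
      by rewrite mulrzBl mulrzA_C mulrzA.
    exact: zspanMz.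
  have := zspanB nP g0m.
  rewrite {1}(divz_eq n d%:Z) -/m mulrzDr opprB opprD !addrA.
  by rewrite [X in zspan ks X -> _](ACl (1*5*3*2*4)) /= subrK.
have r0 : (n %% d%:Z)%Z = 0.
  have d0' : d%:Z != 0 by rewrite eqz_nat -lt0n.
  have := modz_ge0 n d0'; have := ltz_pmod n (_ : 0 < d%:Z); rewrite ltz_nat => /(_ d0).
  move: vm; case: (n %% d%:Z)%Z => // r vm rd _.
  case: r vm rd => // r vm; rewrite ltz_nat => rd.
  have : Q r.+1 by apply/asboolP; split=> //; exists (v - g0 *~ m) => //; apply: GB => //; exact: GMz.
  by move=> /dmin; rewrite leqNgt rd.
have [x xX [g [Gg _] e]] : exists2 x, x \in X & exists2 g, G1 g & (v - g0 *~ m) - x = g *+ M.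
  apply: XP; split; first by apply: GB => //; exact: GMz.
  by move: vm; rewrite r0 mulr0z subr0.
have M0' : (M%:Z : int) != 0 by rewrite eqz_nat -lt0n.
(* Full multiples of [M] go into the term [g *+ M], and the remainder [j] selects the
   representative. *)
pose t := (m %/ M%:Z)%Z.
have [j jM mj] : exists2 j, (j < M)%N & m = t * M%:Z + j%:Z.
  exists `|(m %% M%:Z)%Z|%N; last by rewrite gez0_abs ?modz_ge0//; exact: divz_eq.
  by rewrite -ltz_nat gez0_abs ?modz_ge0// ltz_pmod// ltz_nat.
exists (x + g0 *+ j); first by apply/allpairsP; exists (x, j); rewrite /= mem_iota.
exists (g + g0 *~ t); first by apply: GD => //; exact: GMz.
rewrite mulrnDl -e.
have -> : g0 *~ m = g0 *~ t *+ M + g0 *+ j.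
  by rewrite mj mulrzDr mulrzA -!pmulrn.
rewrite !opprD !addrA; set a := g0 *~ t *+ M; set b := g0 *+ j.
by rewrite [RHS](ACl (1*4*3*2*5)) /= subrK.
Qed.

End SpanOverZ.

Lemma split_lshift (m n : nat) (k : 'I_m) : fintype.split (lshift n k) = inl k.
Proof. exact: (@unsplitK m n (inl k)). Qed.

Lemma split_rshift (m n : nat) (k : 'I_n) : fintype.split (rshift m k) = inr k.
Proof. exact: (@unsplitK m n (inr k)). Qed.

Lemma real_nearP (R : realType) (t : R) (P : R -> Prop) :
  (\forall s \near t, P s) <-> exists2 e : R, 0 < e & forall s, `|s - t| < e -> P s.
Proof.
split=> [/nbhs_normP[/= e e0 eP]|[e e0 eP]].
  by exists e => // s st; apply: eP; rewrite /= distrC.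
by apply/nbhs_normP; exists e => // s /=; rewrite distrC; exact: eP.
Qed.

Lemma segment_const (R : realType) (T : Type) (phi : R -> T) (a b : R) : a <= b ->
  (forall t, a <= t <= b -> exists2 d : R, 0 < d & forall s, a <= s <= b ->
     `|s - t| < d -> phi s = phi t) -> phi a = phi b.
Proof.
move=> ab h; apply: (@real_induction R (fun t => phi a = phi t) a b) => // t tab.
have [d d0 dP] := h t tab; exists d => // s sab st.
by split=> _ ->; rewrite (dP s sab st).
Qed.

(** * Local primitives of forms and the period lattice *)

Section PeriodLattice.
Variables (R : realType) (S : riemann_surface R).
Local Notation C := (Cx R).
Local Notation D i := (chart_dom (rs_chart (r:=S) i)).
Local Notation z i := (chart_coord (rs_chart (r:=S) i)).
Local Notation zi i := (icoord (rs_chart (r:=S) i)).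
Local Notation E := (holo_form S -> C : lmodType C).
Local Notation Lam := (lattice (jacobian_torus S)).
Implicit Types (x y : S) (u v a : C) (w : holo_form S) (c : R -> S) (L : E).

Lemma path_comp (f : S -> S) c : continuous f -> is_path c -> is_path (f \o c).
Proof.
move=> cf /subspace_continuousP cc; apply/subspace_continuousP => t t01.
exact: cvg_comp (cc t t01) (cf _).
Qed.

Lemma lattice_push f L : surface_Aut S f -> Lam L -> Lam (jac_push f L).
Proof.
move=> fA [n [c [I [cl cI LI]]]]; have hf := surface_Aut_holo fA.
exists n, (fun k => f \o c k), (fun k w => I k (pullback f w)); split.
- move=> k; have [cc c01] := cl k; split; first exact: path_comp hf.1 cc.
  by rewrite /= c01.
- move=> k w; have [F Fp ->] := cI k (pullback f w); exists F => //.
  exact: primitive_push fA (cl k).1 Fp.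
- by move=> w; exact: LI.
Qed.

Lemma lattice_zero : Lam (0 : E).
Proof.
have c0 (A : Type) : 'I_0 -> A by case.
exists 0%N, (c0 _), (c0 _); split; first by case.
  by case.
by move=> w; rewrite big_ord0.
Qed.

Lemma lattice_add L1 L2 : Lam L1 -> Lam L2 -> Lam (L1 + L2).
Proof.
move=> [n1 [c1 [I1 [cl1 cI1 LI1]]]] [n2 [c2 [I2 [cl2 cI2 LI2]]]].
exists (n1 + n2)%N, (fun k => match fintype.split k with inl k => c1 k | inr k => c2 k end),
  (fun k => match fintype.split k with inl k => I1 k | inr k => I2 k end); split.
- by move=> k; case: (fintype.split k) => k'; [exact: cl1|exact: cl2].
- by move=> k; case: (fintype.split k) => k'; [exact: cI1|exact: cI2].
- move=> w; rewrite big_split_ord; rewrite -[LHS]/(L1 w + L2 w) LI1 LI2.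
  by congr (_ + _); apply: eq_bigr => k _; rewrite (split_lshift, split_rshift).
Qed.

Lemma path_revP c : is_path c -> is_path (path_rev c).
Proof.
move=> cc; apply/subspace_continuousP => t /=; rewrite in_itv /= => t01 U Ut.
have t01' : 0 <= 1 - t <= 1 by case/andP: t01 => ? ?; apply/andP; split; lra.
have /real_nearP[e e0 eP] := path_near cc t01' Ut.
rewrite /nbhs /= /within /=; apply/real_nearP; exists e => // s st.
rewrite /= in_itv /= => /andP[s0 s1]; apply: eP; last by apply/andP; split; lra.
have -> : 1 - s - (1 - t) = - (s - t) by ring.
by rewrite normrN.
Qed.

Lemma primitive_rev w c (F : R -> C) : is_primitive w c F ->
  is_primitive w (path_rev c) (fun t => F (1 - t)).
Proof.
move=> Fp t t01.
have t01' : 0 <= 1 - t <= 1 by case/andP: t01 => ? ?; apply/andP; split; lra.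
have [i [h [Dc hP /real_nearP[e e0 eP]]]] := Fp _ t01'.
exists i, h; split; [exact: Dc|exact: hP|].
apply/real_nearP; exists e => // s st /andP[s0 s1]; apply: eP.
  have -> : 1 - s - (1 - t) = - (s - t) by ring.
  by rewrite normrN.
by apply/andP; split; lra.
Qed.

Lemma lattice_opp L : Lam L -> Lam (- L).
Proof.
move=> [n [c [I [cl cI LI]]]].
exists n, (fun k => path_rev (c k)), (fun k w => - I k w); split.
- move=> k; have [cc c01] := cl k; split; first exact: path_revP.
  by rewrite /path_rev subr0 subrr.
- move=> k w; have [F Fp ->] := cI k w; exists (fun t => F (1 - t)); first exact: primitive_rev.
  by rewrite subrr subr0 opprB.
- by move=> w; rewrite sumrN -LI.
Qed.

Lemma lattice_sub L1 L2 : Lam L1 -> Lam L2 -> Lam (L1 - L2).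
Proof. by move=> h1 h2; apply: lattice_add => //; exact: lattice_opp. Qed.

Lemma lattice_mulz L (n : int) : Lam L -> Lam (L *~ n).
Proof.
move=> h; have hn (m : nat) : Lam (L *+ m).
  by elim: m => [|m ih]; rewrite ?mulr0n ?mulrS; [exact: lattice_zero|exact: lattice_add].
by case: n => n; [exact: hn|rewrite NegzE mulrNz; apply: lattice_opp; exact: hn].
Qed.

Definition local_primitive w i (h : C -> C) y := D i y /\
  \forall u \near z i y, derivable h u 1 /\ derive1 h u = val w i (zi i u).

(** In the coordinate [z i] the difference of the two primitives has derivative 0, by the cocycle
    rule for [w]. *)
Lemma local_primitive_compare w i j (h k : C -> C) y :
  local_primitive w i h y -> local_primitive w j k y ->
  \forall y' \near y, h (z i y') - h (z i y) = k (z j y') - k (z j y).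
Proof.
move=> [Di /Cx_nearP[e1 e10 e1P]] [Dj /Cx_nearP[e2 e20 e2P]].
have hid := @holo_map_id R S.
have [d dP] := holo_lift (f := id) hid Di Dj.
have /holo_atP[e3 e30 e3P] : holo_at (chart_lift id i j) (z i y) by apply: hid.2.
have [e4 e40 e4P] := cdiff_cont dP e20.
have [e5 e50 e5P] := icoord_near Di (open_nbhs_nbhs (conj (chart_openD j) Dj)).
pose e := Num.min (Num.min e1 e3) (Num.min e4 e5).
have e0 : 0 < e by rewrite !lt_min e10 e30 e40.
pose G u := h u - k (chart_lift id i j u).
have Gd u : nm (u - z i y) < e -> cdiff G u 0.
  rewrite !lt_min => /andP[/andP[u1 u3] /andP[u4 u5]].
  have [Du zu Dju] := e5P u u5.
  have [/derivable_cdiff[d1 d1P] d1E] := e1P u u1; rewrite (derive1_cdiff d1P) in d1E.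
  have [d3 d3P] := e3P u u3.
  have [/derivable_cdiff[d2 d2P] d2E] : derivable k (chart_lift id i j u) 1 /\
      derive1 k (chart_lift id i j u) = val w j (zi j (chart_lift id i j u)).
    by apply: e2P; have := e4P u u4; rewrite {2}/chart_lift /= icoordK.
  rewrite (derive1_cdiff d2P) in d2E.
  have wE := form_cocycle w Du Dju; rewrite zu (derive1_cdiff d3P) in wE.
  have liftE : zi j (chart_lift id i j u) = zi i u by exact: icoordK.
  have := cdiffB d1P (cdiff_comp d3P d2P).
  by rewrite d1E d2E liftE wE subrr.
have Gc := zero_derivative Gd.
have near1 := coord_near Di e0; have near2 := coord_near Di e50.
apply: filterS near1 => y' [Dy' y'e].
have := Gc _ y'e; rewrite /G /chart_lift /= !icoordK// => h1.
rewrite -[h (z i y')](subrK (k (z j y'))) h1.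
ring.
Qed.

(** [U] serves for all forms at once, as the finite cover requires; chart and primitive may vary
    with the form and the point. *)
Definition primitive_on (U : set S) (H : holo_form S -> S -> C) :=
  forall w y, U y -> exists i (h : C -> C), local_primitive w i h y /\
    \forall y' \near y, H w y' = h (z i y').

(** The radius [r / 128] of [primitive_exists] depends on the disc and not on the function, hence a
    single [U] for all forms. *)
Lemma primitive_on_exists x : exists U H, [/\ open U, U x & primitive_on U H].
Proof.
have [i Dx] := rs_cover x.
have [r r0 rP] := icoord_near Dx (open_nbhs_nbhs (conj (chart_openD i) Dx)).
have fh w : holo_on (val w i \o zi i) (z i x) r.
  move=> u /rP[Du zu _]; have /holo_atP[e e0 eP] := form_holo w Du.
  by rewrite zu in eP; apply: eP; rewrite subrr nm0.
have [h hP] := choice (fun w => primitive_exists r0 (fh w)).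
have r128 : 0 < r / 128 by lra.
pose U := [set y | D i y /\ nm (z i y - z i x) < r / 128].
exists U, (fun w y => h w (z i y)); split.
- rewrite openE => y [Dy yr]; have e0 : 0 < r / 128 - nm (z i y - z i x) by rewrite subr_gt0.
  apply: filterS (coord_near Dy e0) => y' [Dy' y'e]; split=> //.
  by have := nm_triangle (z i y') (z i x) (z i y); lra.
- by split; [exact: Dx|rewrite subrr nm0].
- move=> w y [Dy yr]; exists i, (h w); split; last by apply: filterE.
  split; first exact: Dy.
  apply/Cx_nearP; exists (r / 128 - nm (z i y - z i x)); first by rewrite subr_gt0.
  move=> u uy; have ux : nm (u - z i x) < r / 128.
    by have := nm_triangle u (z i x) (z i y); lra.
  have hu := hP w u ux; split; last exact: derive1_cdiff hu.
  by apply/derivable_cdiff; eexists; exact: hu.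
Qed.

(** The neighbourhood is a chart disc inside both sets, so it is the same for all [w]. *)
Lemma primitive_on_const U1 H1 U2 H2 p : open U1 -> open U2 ->
  primitive_on U1 H1 -> primitive_on U2 H2 -> U1 p -> U2 p ->
  \forall p' \near p, forall w, H1 w p' - H2 w p' = H1 w p - H2 w p.
Proof.
move=> o1 o2 p1 p2 U1p U2p; have [i Dp] := rs_cover p.
have U12 : nbhs p (U1 `&` U2) by apply: open_nbhs_nbhs; split; [exact: openI|].
have [r r0 rP] := icoord_near Dp U12.
apply: filterS (coord_near Dp r0) => p' [Dp' p'r] w.
pose G u := H1 w (zi i u) - H2 w (zi i u).
have Gd u : nm (u - z i p) < r -> cdiff G u 0.
  move=> /rP[Du zu [U1u U2u]].
  have [i1 [h1 [l1 n1]]] := p1 w _ U1u; have [i2 [h2 [l2 n2]]] := p2 w _ U2u.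
  have n3 := local_primitive_compare l1 l2.
  have e1 := nbhs_singleton n1; have e2 := nbhs_singleton n2.
  have [e e0 eP] := icoord_near Du (filterI n3 (filterI n1 n2)).
  apply: (@cdiff_ext _ (fun=> G u) G u 0 e) => // [v|]; last exact: cdiff_cst.
  rewrite -{1}zu => /eP[_ _ [m3 [m1 m2]]].
  rewrite /G m1 m2 e1 e2; move: m3; move: (h1 _) (h2 _) (h1 _) (h2 _) => a b a' b' m3.
  apply/eqP; rewrite -subr_eq0; have -> : a - b - (a' - b') = (b' - b) - (a' - a) by ring.
  by rewrite m3 subrr.
by have := zero_derivative Gd p'r; rewrite /G !icoordK.
Qed.

Lemma compact_finite_cover (P : S -> set S) : compact [set: S] ->
  (forall x, open (P x)) -> (forall x, P x x) ->
  exists s : seq S, forall y, exists2 x, x \in s & P x y.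
Proof.
move=> /compact_near_coveringP cS oP Px.
(* The filter of lists growing by inclusion turns the near-covering form of compactness into finite
   subcovers. *)
pose F : set_system (seq S) := filter_from [set: seq S] (fun s0 => [set s : seq S | {subset s0 <= s}]).
have FF : Filter F.
  apply: filter_from_filter => [|s1 s2 _ _]; first by exists [::].
  exists (s1 ++ s2) => // s /= s12.
  by split=> x xs; apply: s12; rewrite mem_cat xs ?orbT.
have [|s0 _ sP] := cS _ F (fun s y => exists2 x, x \in s & P x y) FF.
  move=> x _; exists (P x, [set s : seq S | {subset [:: x] <= s}]) => /=.
    by split; [apply: open_nbhs_nbhs|exists [:: x]].
  by move=> [y s] /= [Pxy xs]; exists x => //; apply: xs; rewrite mem_head.
by exists s0 => y; apply: (sP s0).
Qed.

End PeriodLattice.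

Section PeriodLatticeFinite.
Variables (R : realType) (S : riemann_surface R).
Local Notation C := (Cx R).
Local Notation E := (holo_form S -> C : lmodType C).
Local Notation Lam := (lattice (jacobian_torus S)).
Hypothesis cS : compact [set: S].

(* Periods are sums of values of the cocycle H x - H y, which is locally constant
   on U x `&` U y; since the closure of V x lies in U x, it takes only finitely
   many values on V x `&` V y. *)
Lemma primitive_cover : exists (V : S -> set S) (H : S -> holo_form S -> S -> C)
    (J : seq S) (ks : seq E),
  [/\ forall x, open (V x), forall x, primitive_on (V x) (H x),
      forall y, exists2 x, x \in J & V x y &
      forall x x' p, x \in J -> x' \in J -> V x p -> V x' p ->
        ((fun w => H x w p - H x' w p) : E) \in ks].
Proof.
have [U UP] := choice (@primitive_on_exists R S).
have [H HP] := choice UP.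
have exV x : exists A : set S, [/\ open A, A x & closure A `<=` U x].
  have [oU Ux _] := HP x.
  have [A xA AU] := compact_regular (@rs_hausdorff _ S) cS filterT (open_nbhs_nbhs (conj oU Ux)).
  exists (interior A); split; first exact: open_interior.
    exact: xA.
  by apply: subset_trans AU; apply: closureS; exact: interior_subset.
have [V VP] := choice exV.
have [J JP] : exists J : seq S, forall y, exists2 x, x \in J & V x y.
  by apply: compact_finite_cover => // x; have [] := VP x.
have pair x x' : exists ks : seq E, forall p, V x p -> V x' p ->
    ((fun w => H x w p - H x' w p) : E) \in ks.
  (* Near a point of both [U x] and [U x'] the difference is constant; any other point has a
     neighbourhood off the closure of [V x] or of [V x'], where the claim is vacuous. *)
  have exN p : exists A : set S, [/\ open A, A p &
      exists k : E, forall p', A p' -> V x p' -> V x' p' -> (fun w => H x w p' - H x' w p') = k].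
    have [oU1 _ pU1] := HP x; have [oU2 _ pU2] := HP x'.
    have [oV1 _ cV1] := VP x; have [oV2 _ cV2] := VP x'.
    case: (pselect (U x p)) => [U1p|nU1p]; last first.
      exists (~` closure (V x)); split.
      - by apply: closed_openC; exact: closed_closure.
      - by move=> /cV1.
      - by exists 0 => p' np' Vp'; have := np' (subset_closure Vp').
    case: (pselect (U x' p)) => [U2p|nU2p]; last first.
      exists (~` closure (V x')); split.
      - by apply: closed_openC; exact: closed_closure.
      - by move=> /cV2.
      - by exists 0 => p' np' _ Vp'; have := np' (subset_closure Vp').
    have near_p := primitive_on_const oU1 oU2 pU1 pU2 U1p U2p.
    exists (interior [set p' | forall w, H x w p' - H x' w p' = H x w p - H x' w p]); split.
    - exact: open_interior.
    - exact: near_p.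
    - exists (fun w => H x w p - H x' w p) => p' /interior_subset h _ _.
      by apply/funext => w; exact: h.
  have [N NP] := choice exN.
  have [s sP] : exists s : seq S, forall y, exists2 p, p \in s & N p y.
    by apply: compact_finite_cover => // p; have [] := NP p.
  have exk p := let: And3 _ _ h := NP p in h.
  have [k kP] := choice exk.
  exists (map k s) => p V1p V2p; have [p' p's Np'] := sP p.
  by rewrite (kP p' p Np' V1p V2p); exact: map_f.
have pair' (xx : S * S) := pair xx.1 xx.2.
have [ks ksP] := choice pair'.
exists V, H, J, (flatten [seq ks xx | xx <- [seq (x, x') | x <- J, x' <- J]]); split.
- by move=> x; have [] := VP x.
- move=> x w y Vy; have [_ _ cV] := VP x; have [_ _ h] := HP x.
  by apply: h; apply: cV; exact: subset_closure.
- exact: JP.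
- move=> x x' p xJ x'J Vp V'p; apply/flattenP; exists (ks (x, x')).
    by apply: map_f; apply/allpairsP; exists (x, x').
  exact: (ksP (x, x')).
Qed.

(** The primitive along a loop is compared with the local ones, and each change of neighbourhood
    adds an element of [ks]. When the loop has closed up and the first neighbourhood is restored,
    the accumulated element is the period. *)
Lemma lattice_finitely_generated : exists ks : seq E, forall L, Lam L -> zspan ks L.
Proof.
have [V [H [J [ks [oV pV JP ksP]]]]] := primitive_cover.
exists ks => L [n [c [I [cl cI LI]]]].
have -> : L = \sum_k (I k : E).
  by apply/funext => w; rewrite LI fct_sumE.
apply: zspan_sum => k; have [cc c01] := cl k.
have exF w : exists F : R -> C, is_primitive w (c k) F /\ I k w = F 1 - F 0.
  by have [F Fp e] := cI k w; exists F.
have [F FP] := choice exF.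
have [x0 x0J Vx0] := JP (c k 0).
(* One [l] for all forms: the accumulated constants make up an element of [E]. *)
pose Q x t := exists2 l : E, zspan ks l & forall w,
  F w t - F w 0 = H x w (c k t) - H x0 w (c k 0) + l w.
have Qchange x x' t : x \in J -> x' \in J -> V x (c k t) -> V x' (c k t) -> Q x t -> Q x' t.
  move=> xJ x'J Vx Vx' [l lk e].
  exists (l + (fun w => H x w (c k t) - H x' w (c k t))).
    by apply: zspanD => //; apply: zspan_mem; exact: ksP.
  by move=> w; rewrite e -[(l + _) w]/(l w + (H x w (c k t) - H x' w (c k t))); ring.
have [x [xJ Vx [l lk e]]] : exists x, [/\ x \in J, V x (c k 1) & Q x 1].
  apply: (@real_induction R (fun t => exists x, [/\ x \in J, V x (c k t) & Q x t]) 0 1) => //.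
    exists x0; split=> //; exists 0; first exact: zspan0.
    by move=> w; rewrite !subrr addr0.
  move=> t t01; have [x xJ Vx] := JP (c k t).
  have /real_nearP[d d0 dP] := path_near cc t01 (open_nbhs_nbhs (conj (oV x) Vx)).
  have const a b w : 0 <= a -> a <= b -> b <= 1 -> `|a - t| < d -> `|b - t| < d ->
      F w a - H x w (c k a) = F w b - H x w (c k b).
    move=> a0 ab b1 ad bd; apply: (@segment_const R C (fun t => F w t - H x w (c k t)) a b) => //.
    move=> v /andP[va vb]; have v01 : 0 <= v <= 1 by apply/andP; split; lra.
    have vd : `|v - t| < d.
      by move: ad bd; rewrite !ltr_norml => /andP[? ?] /andP[? ?]; apply/andP; split; lra.
    have Vv := dP v vd v01.
    have [i [h [Di hP Fh]]] := (FP w).1 v v01.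
    have [j [h' [l' nH]]] := pV x w _ Vv.
    have n1 := local_primitive_compare (conj Di hP) l'.
    have [e1 e10 e1P] := (real_nearP _ _).1 (path_near cc v01 (filterI n1 nH)).
    have [e2 e20 e2P] := (real_nearP _ _).1 Fh.
    exists (Num.min e1 e2) => [|s /andP[sa sb]]; first by rewrite lt_min e10.
    have s01 : 0 <= s <= 1 by apply/andP; split; lra.
    rewrite lt_min => /andP[/e1P /(_ s01)[m1 m2] /e2P /(_ s01) m3].
    have m4 : F w v = h (chart_coord (rs_chart i) (c k v)) by apply: e2P; rewrite ?subrr ?normr0.
    rewrite m3 m4 m2 (nbhs_singleton nH); apply/eqP; rewrite -subr_eq0.
    move: m1; move: (h _) (h _) (h' _) (h' _) => p q p' q' m1.
    have -> : q - q' - (p - p') = (q - p) - (q' - p') by ring.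
    by rewrite m1 subrr.
  have QQ a b : 0 <= a <= 1 -> 0 <= b <= 1 -> `|a - t| < d -> `|b - t| < d -> Q x a -> Q x b.
    move=> /andP[a0 a1] /andP[b0 b1] ad bd [l lk e]; exists l => // w.
    have ab : F w a - H x w (c k a) = F w b - H x w (c k b).
      by case: (lerP a b) => [?|/ltW ?]; [|apply: esym]; apply: const.
    have -> : F w b = (F w b - H x w (c k b)) + H x w (c k b) by ring.
    rewrite -ab; have -> : F w a - H x w (c k a) + H x w (c k b) - F w 0 =
      (F w a - F w 0) - H x w (c k a) + H x w (c k b) by ring.
    by rewrite e; ring.
  exists d => // s s01 sd.
  have td : `|t - t| < d by rewrite subrr normr0.
  have Vs := dP s sd s01.
  split=> _ [x' [x'J Vx' Qx']].
    exists x; split => //; apply: (QQ s t) => //; exact: (Qchange x' x).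
  exists x; split => //; apply: (QQ t s) => //; exact: (Qchange x' x).
rewrite -c01 in Vx; have [l' lk' e'] : Q x0 1.
  by apply: (Qchange x x0) => //; rewrite -?c01//; exists l.
have -> : (I k : E) = l'; last by [].
apply/funext => w; rewrite (FP w).2 e' c01; ring.
Qed.

End PeriodLatticeFinite.

(** * The rational group algebra of the dihedral group *)

Section GroupAlgebra.
Variable gT : finGroupType.
Local Notation A := (gralg gT).
Local Notation "a ** b" := (gralg_mul a b) (at level 40, left associativity).
Implicit Types (a b c : A) (g h : gT).

(** General in [F] so as to serve both for matrices of representations and for the action on the
    Jacobian. *)
Lemma sum_gralg_mul (K : numFieldType) (V : lmodType K) (F : gT -> V) a b :
  \sum_g (ratr ((a ** b) g) : K) *: F g =
  \sum_g \sum_h (ratr (a g) * ratr (b h) : K) *: F (g * h)%g.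
Proof.
under eq_bigr do rewrite ffunE rmorph_sum /= scaler_suml.
rewrite exchange_big /=; apply: eq_bigr => h _.
rewrite (reindex_inj (mulgI h)) /=; apply: eq_bigr => g _.
by rewrite mulKg rmorphM.
Qed.

Lemma gralg_mulA a b c : a ** b ** c = a ** (b ** c).
Proof.
apply/ffunP => g; rewrite !ffunE.
under eq_bigr do rewrite ffunE mulr_suml.
rewrite exchange_big /=; apply: eq_bigr => k _.
rewrite ffunE mulr_sumr (reindex_inj (mulgI k)) /=; apply: eq_bigr => h _.
by rewrite mulKg invMg mulrA mulgA.
Qed.

Lemma gralg_mulDl a b c : (a + b) ** c = a ** c + b ** c.
Proof.
apply/ffunP => g; rewrite !ffunE -big_split /=; apply: eq_bigr => h _.
by rewrite ffunE mulrDl.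
Qed.

Lemma gralg_mulDr a b c : a ** (b + c) = a ** b + a ** c.
Proof.
apply/ffunP => g; rewrite !ffunE -big_split /=; apply: eq_bigr => h _.
by rewrite ffunE mulrDr.
Qed.

Lemma gralg_mulNl a b : (- a) ** b = - (a ** b).
Proof.
by apply/ffunP => g; rewrite !ffunE -sumrN; apply: eq_bigr => h _; rewrite ffunE mulNr.
Qed.

Lemma gralg_mulNr a b : a ** (- b) = - (a ** b).
Proof.
by apply/ffunP => g; rewrite !ffunE -sumrN; apply: eq_bigr => h _; rewrite ffunE mulrN.
Qed.

Lemma gralg_mulBl a b c : (a - b) ** c = a ** c - b ** c.
Proof. by rewrite gralg_mulDl gralg_mulNl. Qed.

Lemma gralg_mulBr a b c : a ** (b - c) = a ** b - a ** c.
Proof. by rewrite gralg_mulDr gralg_mulNr. Qed.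

Lemma gralg_mul0l a : 0 ** a = 0.
Proof. by apply/ffunP => g; rewrite !ffunE big1// => h _; rewrite ffunE mul0r. Qed.

Lemma gralg_mul0r a : a ** 0 = 0.
Proof. by apply/ffunP => g; rewrite !ffunE big1// => h _; rewrite ffunE mulr0. Qed.

Lemma gralg_mulnl a b n : (a *+ n) ** b = (a ** b) *+ n.
Proof. by elim: n => [|n ih]; rewrite ?mulr0n ?gralg_mul0l// !mulrS gralg_mulDl ih. Qed.

Lemma gralg_mulnr a b n : a ** (b *+ n) = (a ** b) *+ n.
Proof. by elim: n => [|n ih]; rewrite ?mulr0n ?gralg_mul0r// !mulrS gralg_mulDr ih. Qed.

Definition gralg_delta g : A := [ffun x => (x == g)%:R].

Lemma gralg_scaleD (k : rat) a b : (a ** ([ffun g => k * b g] : A)) = [ffun g => k * (a ** b) g].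
Proof.
by apply/ffunP => g; rewrite !ffunE mulr_sumr; apply: eq_bigr => h _; rewrite ffunE mulrCA.
Qed.

Lemma integral_multiple a : exists2 N : nat, (0 < N)%N &
  forall g, exists n : int, (a *+ N) g = n%:~R.
Proof.
exists (\prod_g `|denq (a g)|)%N => [|g].
  by apply: prodn_gt0 => g; rewrite absz_gt0 denq_neq0.
rewrite ffunMnE (bigD1 g)//= mulrnA; set M := (\prod_(_ | _) _)%N.
exists (numq (a g) * M%:Z); rewrite rmorphM /= -mulr_natr; congr (_ * _).
rewrite -{1}(divq_num_den (a g)) -mulr_natr natr_absz gtr0_norm ?denq_gt0//.
by rewrite mulfVK// intr_eq0 denq_neq0.
Qed.

(** A dimension count over the rationals; it will invert an element of a subalgebra without
    constructing the subalgebra. *)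
Lemma gralg_injective_surjective (f : A -> A) :
  (forall a b, f (a + b) = f a + f b) ->
  (forall (k : rat) a, f [ffun g => k * a g] = [ffun g => k * f a g]) ->
  (forall a, f a = 0 -> a = 0) -> forall b, exists a, f a = b.
Proof.
move=> fD fZ finj b.
pose V := {ffun gT -> rat^o}.
have scaleE (k : rat) (u : V) : k *: u = ([ffun g => k * u g] : V).
  by apply/ffunP => g; rewrite !ffunE.
pose F : V -> V := f.
have fl : linear F.
  move=> k u v; rewrite -[LHS]/(f (k *: u + v : V)) fD; congr (_ + _).
  by rewrite !scaleE; exact: fZ.
pose Fl := GRing.isLinear.Build _ _ _ _ F fl.
pose FF : {linear V -> V} := HB.pack F Fl.
have ker0 : lker (linfun FF) == 0%VS.
  apply/lker0P => u v; rewrite !lfunE /= => uv.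
  have e : FF (u - v) = 0 by rewrite linearB /= uv subrr.
  exact: subr0_eq (finj _ e).
have : b \in limg (linfun FF).
  by have -> := lker0_limgf ker0; exact: memvf.
by move=> /memv_imgP[a _ ->]; exists a; rewrite lfunE.
Qed.
End GroupAlgebra.

(** * Normal form and representations of the dihedral group *)

Section Dihedral.
Variables (q : nat) (gT : finGroupType) (r s : gT).
Hypotheses (q_gt0 : (0 < q)%N) (dih : is_dihedral q r s).
Local Open Scope group_scope.

Let n := (2 * q)%N.

Lemma dihedral_ss : s * s = 1. Proof. by have [_ _ + _ _] := dih; rewrite expgS expg1. Qed.

Lemma dihedral_rn : r ^+ n = 1. Proof. by have [_ + _ _ _] := dih. Qed.

Lemma dihedral_rsr : r * s * r = s.
Proof.
have [_ _ _ + _] := dih; rewrite expgS expg1 !mulgA => e.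
have : s * (s * r * s * r) = s by rewrite e mulg1.
by rewrite !mulgA dihedral_ss mul1g.
Qed.

Lemma dihedral_rXs k : r ^+ k * s * r ^+ k = s.
Proof.
elim: k => [|k ih]; first by rewrite !expg0 mul1g mulg1.
by rewrite {1}expgSr expgS !mulgA -(mulgA _ r s) -(mulgA _ (r * s) r) dihedral_rsr ih.
Qed.

Lemma dihedral_rs k : (k <= n)%N -> r ^+ k * s = s * r ^+ (n - k).
Proof.
move=> kn; rewrite -{2}(dihedral_rXs k) -mulgA -expgD subnKC// dihedral_rn mulg1.
by [].
Qed.

Definition dihedral_elt (x : bool * 'I_n) : gT := s ^+ x.1 * r ^+ x.2.

Lemma dihedral_eltP g : exists (e : bool) (k : nat), g = s ^+ e * r ^+ k.
Proof.
pose K := [set dihedral_elt x | x : bool * 'I_n].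
have n0 : (0 < n)%N by rewrite muln_gt0.
have inK (e : bool) k : s ^+ e * r ^+ k \in K.
  apply/imsetP; exists (e, Ordinal (ltn_pmod k n0)) => //.
  by rewrite /dihedral_elt /= expg_mod// dihedral_rn.
have gK : group_set K.
  apply/group_setP; split; first by have := inK false 0%N; rewrite !expg0 mulg1.
  move=> _ _ /imsetP[[e k] _ ->] /imsetP[[e' k'] _ ->]; rewrite /dihedral_elt /=.
  case: e'; last by rewrite expg0 mul1g -mulgA -expgD.
  have -> : s ^+ e * r ^+ k * (s ^+ true * r ^+ k') = s ^+ e * s * r ^+ (n - k + k').
    by rewrite expg1 expgD !mulgA -(mulgA _ (r ^+ k) s) dihedral_rs ?(ltnW (ltn_ord k))// !mulgA.
  case: e; last by rewrite expg0 mul1g; exact: (inK true).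
  by rewrite expg1 dihedral_ss mul1g; have := inK false (n - k + k')%N; rewrite expg0 mul1g.
have gen : [set: gT]%SET \subset Group gK.
  have [<- _ _ _ _] := dih; rewrite gen_subG finset.subUset !finset.sub1set /=.
  have := inK false 1%N; have := inK true 0%N.
  by rewrite !expg0 !expg1 mulg1 mul1g => -> ->.
have /imsetP[[e k] _ ->] := fintype.subsetP gen g (finset.in_setT g).
by exists e, k.
Qed.

Lemma dihedral_elt_bij : bijective dihedral_elt.
Proof.
have n0 : (0 < n)%N by rewrite muln_gt0.
have cardE : #|{: bool * 'I_n}| = #|gT|.
  by rewrite card_prod card_bool card_ord; have [_ _ _ _ ->] := dih; rewrite mulnA.
apply: inj_card_bij; last by rewrite cardE.
suff /imset_injP h : #|dihedral_elt @: [set: bool * 'I_n]%SET| == #|[set: bool * 'I_n]%SET|.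
  by move=> x y; apply: h; rewrite inE.
rewrite cardsT cardE -[X in _ == X]cardsT; apply/eqP; congr #|pred_of_set _|.
apply/setP => g; rewrite inE; have [e [k ->]] := dihedral_eltP g.
apply/imsetP; exists (e, Ordinal (ltn_pmod k n0)); first by rewrite inE.
by rewrite /dihedral_elt /= expg_mod// dihedral_rn.
Qed.

Lemma dihedral_sum (V : nmodType) (F : gT -> V) :
  (\sum_g F g = \sum_(k < n) F (r ^+ k)%g + \sum_(k < n) F (s * r ^+ k)%g)%R.
Proof.
rewrite (reindex dihedral_elt) /=; last exact/onW_bij/dihedral_elt_bij.
rewrite -(pair_bigA _ (fun e k => F (dihedral_elt (e, k)))) /= big_bool /= GRing.addrC.
by rewrite /dihedral_elt /=; under eq_bigr do rewrite expg0 mul1g; under [X in (_ + X)%R]eq_bigr do rewrite expg1.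
Qed.

Lemma dihedral_order_r : #[r] = n.
Proof.
have n0 : (0 < n)%N by rewrite muln_gt0.
apply/eqP; rewrite eqn_dvd order_dvdn dihedral_rn eqxx /=.
have [f fK _] := dihedral_elt_bij.
have o_lt : (0 < #[r])%N := order_gt0 r.
have : (#[r] <= n)%N by rewrite dvdn_leq// order_dvdn dihedral_rn.
rewrite leq_eqVlt => /orP[/eqP ->//|lt].
have inj := can_inj fK; have := inj (false, Ordinal lt) (false, Ordinal n0).
rewrite /dihedral_elt /= expg_order expg0 => /(_ erefl) [k0].
by rewrite k0 in o_lt.
Qed.

Lemma dihedral_reflection k : (s * r ^+ k) * (s * r ^+ k) = 1.
Proof. by rewrite mulgA -(mulgA s) -(mulgA s) dihedral_rXs dihedral_ss. Qed.

Section Representation.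
Variables (F : fieldType) (d : nat) (D P : 'M[F]_d).
Hypotheses (Dn : (D ^+ n = 1)%R) (PP : (P * P = 1)%R) (PDPD : (P * D * (P * D) = 1)%R).
Local Open Scope ring_scope.

Let DXPDX k : D ^+ k * P * D ^+ k = P.
Proof.
have DPD : D * P * D = P.
  have : P * (P * D * (P * D)) = P by rewrite PDPD mulr1.
  by rewrite !mulrA PP mul1r.
elim: k => [|k ih]; first by rewrite !expr0 mul1r mulr1.
by rewrite {1}exprSr exprS !mulrA -(mulrA _ D P) -(mulrA _ (D * P) D) DPD ih.
Qed.

Let DXP k : (k <= n)%N -> D ^+ k * P = P * D ^+ (n - k).
Proof. by move=> kn; rewrite -{2}(DXPDX k) -mulrA -exprD subnKC// Dn mulr1. Qed.

Lemma dihedral_rep : exists rho : mx_representation F [set: gT]%G d, rho r = D /\ rho s = P.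
Proof.
have n0 : (0 < n)%N by rewrite muln_gt0.
have [f fK Kf] := dihedral_elt_bij.
pose M g : 'M[F]_d := P ^+ (f g).1 * D ^+ (f g).2.
have ME (e : bool) k : M (s ^+ e * r ^+ k)%g = P ^+ e * D ^+ k.
  have -> : (s ^+ e * r ^+ k)%g = dihedral_elt (e, Ordinal (ltn_pmod k n0)).
    by rewrite /dihedral_elt /= expg_mod// dihedral_rn.
  by rewrite /M fK /= expr_mod.
have M1 : M 1%g = 1%:M by have := ME false 0%N; rewrite !expg0 mulg1 !expr0 mulr1.
have MM : {in [set: gT]%SET &, {morph M : x y / (x * y)%g >-> x *m y}}.
  move=> g g' _ _; rewrite -{1}(Kf g) -{1}(Kf g') /dihedral_elt.
  rewrite -[RHS]/((P ^+ (f g).1 * D ^+ (f g).2) * (P ^+ (f g').1 * D ^+ (f g').2)); case: (f g) => e k; case: (f g') => e' k' /=.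
  have kn := ltnW (ltn_ord k).
  case: e'; last by rewrite expg0 expr0 mul1g mul1r -mulgA -expgD ME exprD mulrA.
  have -> : (s ^+ e * r ^+ k * (s ^+ true * r ^+ k') = s ^+ e * s * r ^+ (n - k + k'))%g.
    by rewrite expg1 expgD !mulgA -(mulgA _ (r ^+ k)%g s) dihedral_rs// !mulgA.
  have -> : P ^+ e * D ^+ k * (P ^+ true * D ^+ k') = P ^+ e * P * D ^+ (n - k + k').
    by rewrite expr1 exprD !mulrA -(mulrA _ (D ^+ k) P) DXP// !mulrA.
  case: e; last by rewrite expg0 expr0 mul1g mul1r (ME true) expr1.
  rewrite expg1 expr1 dihedral_ss PP mul1g mul1r.
  by have := ME false (n - k + k')%N; rewrite expg0 mul1g expr0 mul1r.
exists (@MxRepresentation _ _ _ _ M (conj M1 MM)); split => /=.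
  by have := ME false 1%N; rewrite !expg0 !expg1 mul1g expr0 expr1 mul1r.
by have := ME true 0%N; rewrite !expg0 !expg1 mulg1 expr0 expr1 mulr1.
Qed.

End Representation.
End Dihedral.

(** * Rational polynomials at conjugate roots of unity *)

Section CyclotomicConjugates.
Variable K : numFieldType.
Local Notation ratK := (map_poly (ratr : rat -> K)).
Local Notation ratC := (map_poly (ratr : rat -> algC)).
Local Notation PhiQ n := (map_poly (intr : int -> rat) 'Phi_n).

Lemma ratr_intr_poly (L : numFieldType) (p : {poly int}) :
  map_poly (ratr : rat -> L) (map_poly (intr : int -> rat) p) = map_poly intr p.
Proof. by rewrite -map_poly_comp; apply: eq_map_poly => x /=; rewrite ratr_int. Qed.

Lemma root_Cyclotomic_primitive n (z : K) : n.-primitive_root z ->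
  root (map_poly intr 'Phi_n) z.
Proof.
move=> zn; have n0 := prim_order_gt0 zn.
have : root (map_poly (intr : int -> K) ('X^n - 1)) z.
  by rewrite rmorphB /= map_polyXn rmorph1 rootE !hornerE prim_expr_order// subrr.
rewrite -(prod_Cyclotomic n0) rmorph_prod /= -(big_map (fun d => map_poly (intr : int -> K) 'Phi_d) xpredT id).
apply: contraLR => nroot; rewrite root_bigmul; apply/allP => _ /mapP[d dn ->].
have [->//|ne] := eqVneq d n.
have dvd : (d %| n)%N by rewrite -dvdn_divisors// in dn.
have d0 : (0 < d)%N := dvdn_gt0 n0 dvd.
apply/negP => rd; have : root (map_poly (intr : int -> K) ('X^d - 1)) z.
  rewrite -(prod_Cyclotomic d0) (big_rem d) ?divisors_id //=.
  by rewrite rmorphM /= rootM rd.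
rewrite rmorphB /= map_polyXn rmorph1 rootE !hornerE subr_eq0 => /eqP zd.
have := prim_order_dvd zn d; rewrite zd eqxx => /esym nd.
by move: ne; rewrite eqn_dvd dvd -nd.
Qed.

(** Irreducibility of ['Phi_n] enters through minimal polynomials in [algC]. The gcd of [p] and
    ['Phi_n] over the rationals has the root [z], so it is not constant and has a root in [algC]
    too; the minimal polynomial of the latter is ['Phi_n], which therefore divides [p]. *)
Lemma conjugate_root n (z z' : K) (p : {poly rat}) :
  n.-primitive_root z -> n.-primitive_root z' -> root (ratK p) z -> root (ratK p) z'.
Proof.
move=> zn z'n pz; have n0 := prim_order_gt0 zn.
have [z0 z0n] := C_prim_root_exists n0.
have Phi0 : PhiQ n != 0 by rewrite monic_neq0// monic_map// Cyclotomic_monic.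
pose g := gcdp p (PhiQ n).
have gz : root (ratK g) z.
  by rewrite gcdp_map root_gcd pz ratr_intr_poly root_Cyclotomic_primitive.
have g0 : g != 0 by rewrite gcdp_eq0 negb_and Phi0 orbT.
have sg : size (ratC g) != 1%N.
  have : (1 < size (ratK g))%N by apply: root_size_gt1 gz; rewrite map_poly_eq0.
  by rewrite !size_map_poly => /gtn_eqF ->.
have /closed_rootP[y gy] := sg.
have yPhi : root (ratC (PhiQ n)) y by move: gy; rewrite gcdp_map root_gcd => /andP[].
have yn : n.-primitive_root y.
  by move: yPhi; rewrite ratr_intr_poly (Cintr_Cyclotomic z0n) root_cyclotomic.
have [P [PE _] Pdvd] := minCpolyP y.
have PPhi : P = PhiQ n.
  apply: (map_poly_inj (ratr : {rmorphism rat -> algC})).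
  by rewrite -PE (minCpoly_cyclotomic yn) -(Cintr_Cyclotomic yn) ratr_intr_poly.
have /dvdpP[h ph] : PhiQ n %| p.
  have Pg : P %| g by rewrite -Pdvd.
  by rewrite PPhi in Pg; exact: dvdp_trans Pg (dvdp_gcdl _ _).
by rewrite ph rmorphM /= rootM ratr_intr_poly root_Cyclotomic_primitive ?orbT.
Qed.

End CyclotomicConjugates.

Section Omega.
Variable R : realType.
Local Notation C := (Cx R).

Lemma cisD (x y : R) : cis (x + y) = cis x * cis y.
Proof. by apply: Cx_ext; rewrite !ReImE /cis /re /im /= (cosD, sinD); ring. Qed.

Lemma cis0 : cis (0 : R) = 1.
Proof. by rewrite /cis cos0 sin0. Qed.

Lemma cisX (x : R) n : cis x ^+ n = cis (n%:R * x).
Proof.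
elim: n => [|n ih]; first by rewrite mul0r cis0.
by rewrite exprS ih -cisD -natr1 mulrDl mul1r addrC.
Qed.

Lemma nm_cis (x : R) : nm (cis x) = 1.
Proof. by rewrite /nm /= cos2Dsin2 sqrtr1. Qed.

Lemma cis_conj (x : R) : (cis x)^* = (cis x)^-1.
Proof.
have c0 : cis x != 0.
  apply/eqP => c0; have := nm_cis x; rewrite c0 nm0 => /esym/eqP; by rewrite oner_eq0.
apply: (mulfI c0); rewrite mulfV// -normCK normcE_nm nm_cis rc1 expr1n//.
Qed.

Lemma cis_neq1 (x : R) : 0 < x < 2 * pi -> cis x != 1.
Proof.
move=> /andP[x0 x2]; apply/eqP => /(congr1 (@re R)); rewrite /cis /re /= => cx.
have s0 : 0 < sin (x / 2) by apply: sin_gt0_pi; apply/andP; split; lra.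
have e : x = x / 2 + x / 2 by field.
move: cx; rewrite e cosD -!expr2.
by have := cos2Dsin2 (x / 2); nra.
Qed.

Lemma omega_primitive n : (0 < n)%N -> n.-primitive_root (omega R n).
Proof.
move=> n0; have n0' : (n%:R : R) != 0 by rewrite pnatr_eq0 -lt0n.
have oX k : omega R n ^+ k = cis (k%:R * (2 * pi / n%:R)) by exact: cisX.
have on : omega R n ^+ n = 1.
  rewrite oX; have -> : n%:R * (2 * pi / n%:R) = pi + pi :> R by field.
  by rewrite cisD /cis cospi sinpi; apply: Cx_ext; rewrite !ReImE /re /im /=; ring.
have [m mprim mn] := prim_order_exists n0 on.
have m0 := prim_order_gt0 mprim.
have [mn'|mn'] := eqVneq m n; first by rewrite mn' in mprim.
have mltn : (m < n)%N by rewrite ltn_neqAle mn' dvdn_leq.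
have om : omega R n ^+ m != 1.
  rewrite oX; apply: cis_neq1; have pi0 := pi_gt0 R; have nR : 0 < n%:R :> R by rewrite ltr0n.
  apply/andP; split; first by rewrite mulr_gt0 ?ltr0n// divr_gt0// mulr_gt0.
  have mnR : m%:R < n%:R :> R by rewrite ltr_nat.
  by rewrite mulrA ltr_pdivrMr// [m%:R * _]mulrC ltr_pM2l// mulr_gt0.
by rewrite (prim_expr_order mprim) eqxx in om.
Qed.

End Omega.

(** * Group algebra elements in complex representations *)

Section RepEvaluation.
Variables (R : realType) (gT : finGroupType).
Local Notation C := (Cx R).

Lemma gralg_repM d (rho : mx_representation C [set: gT]%G d) (a b : gralg gT) :
  gralg_rep rho (gralg_mul a b) = gralg_rep rho a *m gralg_rep rho b.
Proof.
rewrite /gralg_rep (@sum_gralg_mul gT C 'M[C]_d rho) mulmx_suml; apply: eq_bigr => g _.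
rewrite mulmx_sumr; apply: eq_bigr => h _.
by rewrite -scalemxAl -scalemxAr scalerA repr_mxM ?inE.
Qed.

Lemma gralg_repB d (rho : mx_representation C [set: gT]%G d) (a b : gralg gT) :
  gralg_rep rho (a - b) = gralg_rep rho a - gralg_rep rho b.
Proof.
rewrite /gralg_rep -sumrB; apply: eq_bigr => g _.
by rewrite !ffunE rmorphB scalerBl.
Qed.

Lemma gralg_repD d (rho : mx_representation C [set: gT]%G d) (a b : gralg gT) :
  gralg_rep rho (a + b) = gralg_rep rho a + gralg_rep rho b.
Proof.
rewrite /gralg_rep -big_split; apply: eq_bigr => g _.
by rewrite !ffunE rmorphD scalerDl.
Qed.

Lemma gralg_rep0 d (rho : mx_representation C [set: gT]%G d) :
  gralg_rep rho (0 : gralg gT) = 0.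
Proof. by rewrite /gralg_rep big1// => g _; rewrite ffunE rmorph0 scale0r. Qed.

Lemma gralg_rep_delta d (rho : mx_representation C [set: gT]%G d) g :
  gralg_rep rho (gralg_delta g) = rho g.
Proof.
rewrite /gralg_rep (bigD1 g)//= big1 => [|h hg]; rewrite ffunE.
  by rewrite eqxx rmorph1 scale1r addr0.
by rewrite (negPf hg) rmorph0 scale0r.
Qed.

Lemma repr_mx_exp d (rho : mx_representation C [set: gT]%G d) g k :
  rho (g ^+ k)%g = rho g ^+ k.
Proof.
elim: k => [|k ih]; first by rewrite expg0 repr_mx1.
by rewrite expgS repr_mxM ?inE// ih exprS.
Qed.

End RepEvaluation.

Section Constituents.
Variables (R : realType) (q : nat) (gT : finGroupType) (r s : gT).
Hypotheses (q_pr : prime q) (q5 : (5 <= q)%N) (dih : is_dihedral q r s).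
Local Notation C := (Cx R).
Local Notation n := (2 * q)%N.
Local Notation w := (omega R n).
Implicit Types a e : gralg gT.

Let q_gt0 : (0 < q)%N. Proof. exact: prime_gt0. Qed.
Let n_gt0 : (0 < n)%N. Proof. by rewrite muln_gt0. Qed.
Let w_prim : n.-primitive_root w. Proof. exact: omega_primitive. Qed.

(** Coefficients on rotations and on reflections become polynomials of degree below [2 * q], so that
    matrix entries in a representation are values of rational polynomials at roots of unity. *)
Definition rot_poly a : {poly rat} := \poly_(k < n) a (r ^+ k)%g.
Definition ref_poly a : {poly rat} := \poly_(k < n) a (s * r ^+ k)%g.
Local Notation evalC p z := ((map_poly (ratr : rat -> C) p).[z]).

Lemma eval_poly_ratr (F : nat -> rat) z :
  evalC (\poly_(k < n) F k) z = \sum_(k < n) ratr (F k) * z ^+ k.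
Proof.
rewrite (@horner_coef_wide _ n); last by rewrite size_map_poly size_poly.
by apply: eq_bigr => k _; rewrite coef_map coef_poly ltn_ord.
Qed.

Lemma gralg_repE d (rho : mx_representation C [set: gT]%G d) a :
  gralg_rep rho a = \sum_(k < n) ratr (a (r ^+ k)%g) *: rho r ^+ k +
                    \sum_(k < n) ratr (a (s * r ^+ k)%g) *: (rho s * rho r ^+ k).
Proof.
rewrite /gralg_rep (dihedral_sum q_gt0 dih); congr (_ + _); apply: eq_bigr => k _.
  by rewrite repr_mx_exp.
by rewrite repr_mxM ?inE// repr_mx_exp.
Qed.

Lemma rot_mxX k l : rot_mx R q k ^+ l = \matrix_(i, j) (if i != j then 0
   else if i == 0 then (w ^+ k) ^+ l else (w ^+ k)^-1 ^+ l).
Proof.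
have rotE i j : rot_mx R q k i j = if i != j then 0 else if i == 0 then w ^+ k else (w ^+ k)^-1.
  by rewrite mxE /omega cis_conj exprVn.
elim: l => [|l ih]; apply/matrixP => i j.
  by rewrite expr0 !mxE; case: eqP => //= _; case: eqP.
rewrite exprS ih !mxE (bigD1 i)//= big1 ?addr0 => [|l' l'i]; rewrite !rotE !mxE.
  by rewrite eqxx /=; case: (i != j); rewrite ?mulr0//=; case: (i == 0); rewrite -exprS.
by rewrite eq_sym l'i mul0r.
Qed.

Lemma ord2P (P : 'I_2 -> Prop) : P 0 -> P 1 -> forall i, P i.
Proof.
move=> P0 P1 [[|[|//]] h]; [have -> : Ordinal h = 0 by exact: val_inj|have -> : Ordinal h = 1 by exact: val_inj]; by [].
Qed.

Lemma gralg_rep2E (rho : mx_representation C [set: gT]%G 2) k a (z : C) :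
  rho r = rot_mx R q k -> rho s = swap_mx R -> z = w ^+ k ->
  [/\ gralg_rep rho a 0 0 = evalC (rot_poly a) z,
      gralg_rep rho a 1 0 = evalC (ref_poly a) z,
      gralg_rep rho a 0 1 = evalC (ref_poly a) z^-1 &
      gralg_rep rho a 1 1 = evalC (rot_poly a) z^-1].
Proof.
move=> rr rs zk; rewrite gralg_repE rr rs /rot_poly /ref_poly !eval_poly_ratr.
have swapE (l : nat) i j : (swap_mx R * rot_mx R q k ^+ l) i j =
    if i == j then 0 else if j == 0 then z ^+ l else z^-1 ^+ l.
  rewrite rot_mxX -zk mxE (bigD1 j)//= big1 ?addr0 => [|x xj]; rewrite !mxE.
    by rewrite eqxx /=; case: eqP => /= _; rewrite ?mul0r ?mul1r.
  by rewrite xj mulr0.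
split; rewrite mxE !summxE.
- rewrite [X in _ + X]big1 ?addr0 => [|l _]; last by rewrite mxE swapE mulr0.
  by apply: eq_bigr => l _; rewrite mxE rot_mxX mxE /= -zk.
- rewrite [X in X + _]big1 ?add0r => [|l _]; last by rewrite mxE rot_mxX mxE mulr0.
  by apply: eq_bigr => l _; rewrite mxE swapE.
- rewrite [X in X + _]big1 ?add0r => [|l _]; last by rewrite mxE rot_mxX mxE mulr0.
  by apply: eq_bigr => l _; rewrite mxE swapE.
- rewrite [X in _ + X]big1 ?addr0 => [|l _]; last by rewrite mxE swapE mulr0.
  by apply: eq_bigr => l _; rewrite mxE rot_mxX mxE /= -zk.
Qed.

Lemma gralg_rep2_eq0 (rho : mx_representation C [set: gT]%G 2) k a (z : C) :
  rho r = rot_mx R q k -> rho s = swap_mx R -> z = w ^+ k ->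
  gralg_rep rho a = 0 <->
  [/\ evalC (rot_poly a) z = 0, evalC (ref_poly a) z = 0,
      evalC (ref_poly a) z^-1 = 0 & evalC (rot_poly a) z^-1 = 0].
Proof.
move=> rr rs zk; have [<- <- <- <-] := gralg_rep2E a rr rs zk.
split=> [->|[e00 e10 e01 e11]]; first by rewrite !mxE.
by apply/matrixP; apply: ord2P; apply: ord2P; rewrite mxE.
Qed.

Lemma rep2_exists k : exists rho : mx_representation C [set: gT]%G 2,
  rho r = rot_mx R q k /\ rho s = swap_mx R.
Proof.
have w0 : w != 0.
  apply/eqP => w0; have := prim_expr_order w_prim; rewrite w0 expr0n gtn_eqF// => /eqP.
  by rewrite eq_sym oner_eq0.
have z0 : w ^+ k != 0 by rewrite expf_neq0.
apply: (dihedral_rep q_gt0 dih).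
- have zn : (w ^+ k) ^+ n = 1 by rewrite -exprM (mulnC k) exprM (prim_expr_order w_prim) expr1n.
  rewrite rot_mxX; apply/matrixP => i j; rewrite !mxE exprVn zn invr1.
  by case: (i == j); rewrite //=; case: ifP.
- by apply/matrixP; apply: ord2P; apply: ord2P; rewrite !mxE !big_ord_recl big_ord0 !mxE /=; ring.
- have -> : rot_mx R q k = rot_mx R q k ^+ 1 by [].
  have e i j : (swap_mx R * rot_mx R q k ^+ 1) i j = if i == j then 0 else if j == 0 then w ^+ k else (w ^+ k)^-1.
    rewrite rot_mxX mxE (bigD1 j)//= big1 ?addr0 => [|x xj]; rewrite !mxE.
      by rewrite eqxx /=; case: eqP => /= _; rewrite ?mul0r ?mul1r.
    by rewrite xj mulr0.
  apply/matrixP; apply: ord2P; apply: ord2P; rewrite !mxE !big_ord_recl big_ord0 !e /=;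
    by rewrite ?mulr0 ?mul0r ?addr0 ?add0r ?mulfV ?mulVf.
Qed.

Lemma rep1_exists (e1 e2 : bool) : exists rho : mx_representation C [set: gT]%G 1,
  rho r = ((-1) ^+ e1)%:M /\ rho s = ((-1) ^+ e2)%:M.
Proof.
apply: (dihedral_rep q_gt0 dih).
- by rewrite -rmorphXn /= exprM sqrr_sign expr1n.
- by rewrite -rmorphM /= -expr2 sqrr_sign.
- by rewrite -!rmorphM /= -expr2 exprMn !sqrr_sign mulr1.
Qed.

End Constituents.

Section Faithfulness.
Variables (R : realType) (q : nat) (gT : finGroupType) (r s : gT).
Hypotheses (q_pr : prime q) (q5 : (5 <= q)%N) (dih : is_dihedral q r s).
Local Notation C := (Cx R).
Local Notation n := (2 * q)%N.
Local Notation w := (omega R n).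
Local Notation evalC p z := ((map_poly (ratr : rat -> C) p).[z]).
Implicit Types a e : gralg gT.

Let q_gt0 : (0 < q)%N. Proof. exact: prime_gt0. Qed.
Let n_gt0 : (0 < n)%N. Proof. by rewrite muln_gt0. Qed.
Let w_prim : n.-primitive_root w. Proof. exact: omega_primitive. Qed.

Lemma coprime_2q m : coprime m n = odd m && ~~ (q %| m)%N.
Proof.
rewrite coprimeMr coprimen2; congr (_ && _).
by rewrite coprime_sym prime_coprime.
Qed.

Lemma gralg_rep1E (rho : mx_representation C [set: gT]%G 1) (x y : C) a :
  rho r = x%:M -> rho s = y%:M ->
  gralg_rep rho a 0 0 = evalC (rot_poly q r a) x + y * evalC (ref_poly q r s a) x.
Proof.
move=> rx sy; rewrite (gralg_repE q_pr dih) rx sy mxE !summxE !eval_poly_ratr; congr (_ + _).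
  by apply: eq_bigr => k _; rewrite -rmorphXn /= !mxE mulr1n.
rewrite mulr_sumr; apply: eq_bigr => k _.
by rewrite -rmorphXn -rmorphM /= !mxE mulr1n; ring.
Qed.

Lemma omega_half : w ^+ q = -1.
Proof.
have : (w ^+ q) ^+ 2 = 1 by rewrite -exprM (mulnC q) (prim_expr_order w_prim).
move/eqP; rewrite -subr_eq0 subr_sqr_1 mulf_eq0 => /orP[]; last by rewrite addr_eq0 => /eqP.
rewrite subr_eq0 -(expr0 w) (eq_prim_root_expr w_prim) mod0n modn_small ?gtn_eqF//.
by rewrite ltn_Pmull.
Qed.

(** Both coefficient polynomials have size at most [2 * q] and vanish at all [2 * q] powers of [w],
    hence are 0. *)
Lemma gralg_rep_faithful a :
  (forall j d (rho : mx_representation C [set: gT]%G d), constituent q r s j rho ->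
    gralg_rep rho a = 0) -> a = 0.
Proof.
move=> ha.
have root2 k : (exists j : 'I_6, [/\ (3 < j)%N & exists2 m, coprime m n & w ^+ k = w ^+ (m * (j - 3))]) ->
    evalC (rot_poly q r a) (w ^+ k) = 0 /\ evalC (ref_poly q r s a) (w ^+ k) = 0.
  move=> [j [j3 [m mn wk]]]; have [rho [rr rs]] := rep2_exists R q_pr dih (m * (j - 3)).
  have := ha j 2 rho (ConstituentDeg2 j3 mn rr rs).
  by move=> /(gralg_rep2_eq0 q_pr dih a rr rs wk)[].
(* The two characters that agree on [r] give the sum and the difference of the two values. *)
have root1 (b : bool) : evalC (rot_poly q r a) ((-1) ^+ b) = 0 /\ evalC (ref_poly q r s a) ((-1) ^+ b) = 0.
  have [rho [rr rs]] := rep1_exists R q_pr dih b false.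
  have [rho' [rr' rs']] := rep1_exists R q_pr dih b true.
  pose j : 'I_6 := inord b.*2; pose j' : 'I_6 := inord b.*2.+1.
  have jE : j = b.*2 :> nat by rewrite inordK//; case: (b).
  have j'E : j' = b.*2.+1 :> nat by rewrite inordK//; case: (b).
  have e : gralg_rep rho a = 0.
    apply: (ha j); apply: ConstituentDeg1; rewrite jE ?rr ?rs; first by case: (b).
      by rewrite doubleK.
    by rewrite -(signr_odd _ b.*2) odd_double.
  have e' : gralg_rep rho' a = 0.
    apply: (ha j'); apply: ConstituentDeg1; rewrite j'E ?rr' ?rs'; first by case: (b).
      by rewrite -uphalfE uphalf_double.
    by rewrite -(signr_odd _ b.*2.+1) /= odd_double.
  have := gralg_rep1E a rr rs; rewrite e mxE expr0 mul1r => h1.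
  have := gralg_rep1E a rr' rs'; rewrite e' mxE expr1 mulN1r => h2.
  set A := evalC _ _ in h1 h2 *; set B := evalC _ _ in h1 h2 *.
  have A0 : A * 2 = 0.
    by transitivity ((A + B) + (A - B)); [ring|rewrite -h1 -h2 addr0].
  have A1 : A = 0 by apply/eqP; move/eqP: A0; rewrite mulf_eq0 pnatr_eq0 orbF.
  by split=> //; move: h1; rewrite A1 add0r.
have roots k : (k < n)%N -> evalC (rot_poly q r a) (w ^+ k) = 0 /\ evalC (ref_poly q r s a) (w ^+ k) = 0.
  move=> kn; have [->|k0] := eqVneq k 0%N; first by rewrite expr0; exact: (root1 false).
  have [->|kq] := eqVneq k q; first by rewrite omega_half; exact: (root1 true).
  have kq' : ~~ (q %| k)%N.
    apply/negP => /dvdnP[l kl]; move: kn k0 kq; rewrite kl ltn_mul2r q_gt0 /=.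
    by case: l {kl} => [|[|l]]; rewrite ?mul0n ?mul1n ?eqxx.
  (* An odd [k] prime to [q] occurs in [W_5]; an even one is twice a unit modulo [2 * q], up to a
     multiple of [2 * q], and occurs in [W_6]. *)
  apply: root2; case: (boolP (odd k)) => [ok|ek].
    exists (inord 4); split; rewrite inordK//; exists k; last by rewrite muln1.
    by rewrite coprime_2q ok.
  have kk : k = (k./2 * 2)%N by rewrite muln2 even_halfK.
  exists (inord 5); split; rewrite inordK//.
  have qk2 : ~~ (q %| k./2)%N by apply: contra kq' => h; rewrite kk dvdn_mulr.
  have oq : odd q by case: (even_prime q_pr) => // q2; move: q5; rewrite q2.
  case: (boolP (odd k./2)) => [ok|ek2].
    by exists k./2; [rewrite coprime_2q ok|rewrite -kk].
  (* Adding [q] to an even half makes it odd and changes the exponent by [2 * q]. *)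
  exists (k./2 + q)%N; first by rewrite coprime_2q oddD (negPf ek2) oq /= dvdn_addl.
  by rewrite mulnDl -kk exprD (mulnC q) (prim_expr_order w_prim) mulr1.
have poly0 (p : {poly rat}) : (size p <= n)%N -> (forall k, (k < n)%N -> evalC p (w ^+ k) = 0) -> p = 0.
  move=> sp pr; apply/eqP; rewrite -(map_poly_eq0 (ratr : {rmorphism rat -> C})); apply: contraTT sp => p0.
  rewrite -ltnNge -(size_map_poly (ratr : {rmorphism rat -> C}) p).
  have := @max_poly_roots _ _ [seq w ^+ k | k <- iota 0 n] p0.
  rewrite size_map size_iota; apply.
    by apply/allP => _ /mapP[k + ->]; rewrite mem_iota /= => /pr /eqP.
  rewrite map_inj_in_uniq ?iota_uniq// => x y; rewrite !mem_iota /= => xn yn /eqP.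
  by rewrite (eq_prim_root_expr w_prim) !modn_small// => /eqP.
have rot0 : rot_poly q r a = 0 by apply: poly0 (size_poly _ _) _ => k /roots[].
have ref0 : ref_poly q r s a = 0 by apply: poly0 (size_poly _ _) _ => k /roots[].
apply/ffunP => g; rewrite ffunE; have [f fK Kf] := dihedral_elt_bij q_gt0 dih.
rewrite -(Kf g) /dihedral_elt; case: (f g) => -[|] k /=.
  by have := congr1 (fun p : {poly rat} => p`_k) ref0; rewrite coef_poly ltn_ord coef0 expg1.
by have := congr1 (fun p : {poly rat} => p`_k) rot0; rewrite coef_poly ltn_ord coef0 expg0 mul1g.
Qed.

Lemma omega_pow_order k m : coprime m n ->
  (n %/ gcdn k n).-primitive_root (w ^+ (m * k)).
Proof.
move=> mn; have := exp_prim_root w_prim (m * k).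
have nm : coprime n m by rewrite coprime_sym.
by have -> : gcdn (m * k) n = gcdn k n by rewrite gcdnC (Gauss_gcdr k nm) gcdnC.
Qed.

Lemma gralg_rep_conjugate (k m m' : nat) a (rho rho' : mx_representation C [set: gT]%G 2) :
  coprime m n -> coprime m' n ->
  rho r = rot_mx R q (m * k) -> rho s = swap_mx R ->
  rho' r = rot_mx R q (m' * k) -> rho' s = swap_mx R ->
  gralg_rep rho a = 0 -> gralg_rep rho' a = 0.
Proof.
move=> mn m'n rr rs rr' rs' /(gralg_rep2_eq0 q_pr dih a rr rs erefl)[e1 e2 _ _].
have transfer (p : {poly rat}) (l : nat) : coprime l n -> evalC p (w ^+ (m * k)) = 0 -> evalC p (w ^+ (l * k)) = 0.
  move=> ln /eqP h; apply/eqP; exact: conjugate_root (omega_pow_order k mn) (omega_pow_order k ln) h.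
(* The inverse is again a conjugate, with [m' * n.-1] in place of [m'], so [transfer] applies to it
   as well. *)
have inv : (w ^+ (m' * k))^-1 = w ^+ (m' * n.-1 * k).
  have wu : w ^+ (m' * k) \is a GRing.unit.
    by rewrite unitrX// unitfE; apply/eqP => w0; have := omega_half; rewrite w0 expr0n gtn_eqF// => /eqP;
      rewrite eq_sym oppr_eq0 oner_eq0.
  apply: (mulrI wu); rewrite divrr// -exprD -mulnA (mulnC n.-1) mulnA -mulnS prednK// (mulnC _ n) exprM.
  by rewrite (prim_expr_order w_prim) expr1n.
have m'n1 : coprime (m' * n.-1) n by rewrite coprimeMl m'n coprimePn.
apply/(gralg_rep2_eq0 q_pr dih a rr' rs' erefl); rewrite inv.
by split; apply: transfer.
Qed.

(** [e] kills the other components, and all constituents of the component of [e] are Galois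
    conjugates of [rho]. *)
Lemma component_faithful (j : 'I_6) e a (rho : mx_representation C [set: gT]%G 2) :
  (3 < j)%N -> central_idempotent R q r s j e -> gralg_mul e a = a ->
  rho r = rot_mx R q (1 * (j - 3)) -> rho s = swap_mx R ->
  gralg_rep rho a = 0 -> a = 0.
Proof.
move=> j3 ej ea rr rs rho0; apply: gralg_rep_faithful => i d rho' ci.
have [ij|ij] := eqVneq i j; last by rewrite -ea gralg_repM (ej _ _ _ ci) (negPf ij) mulr0n raddf0 mul0mx.
rewrite {}ij in ci; case: d rho' / ci => [rho' j4|m rho' _ mn rr' rs'].
  by move: j3; rewrite ltnNge -ltnS j4.
exact: gralg_rep_conjugate (coprime1n _) mn rr rs rr' rs' rho0.
Qed.

Lemma central_idempotent_unique (j : 'I_6) e e' :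
  central_idempotent R q r s j e -> central_idempotent R q r s j e' -> e = e'.
Proof.
move=> ej e'j; apply: subr0_eq; apply: gralg_rep_faithful => i d rho ci.
by rewrite gralg_repB (ej _ _ _ ci) (e'j _ _ _ ci) subrr.
Qed.

End Faithfulness.

(** * Idempotent and singular two by two matrices *)

Section TwoByTwo.
Variable F : fieldType.
Implicit Types M N X Y : 'M[F]_2.

Lemma mulmx2E X Y i j : (X *m Y) i j = X i 0 * Y 0 j + X i 1 * Y 1 j.
Proof.
rewrite mxE !big_ord_recl big_ord0 addr0.
by have -> : lift ord0 ord0 = 1 :> 'I_2 by exact: val_inj.
Qed.

(** If the trace is 1, the equation for the upper left entry says that the determinant is 0.
    Otherwise the off-diagonal entries vanish and the matrix is scalar, hence 0 or 1. *)
Lemma idempotent2_minor X : X *m X = X -> X != 0 -> X != 1%:M ->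
  X 0 0 * X 1 1 = X 0 1 * X 1 0.
Proof.
move=> XX X0 X1; have e i j : X i 0 * X 0 j + X i 1 * X 1 j = X i j by rewrite -mulmx2E XX.
have := e 0 0; have := e 0 1; have := e 1 0; have := e 1 1.
have ext Y : X 0 0 = Y 0 0 -> X 0 1 = Y 0 1 -> X 1 0 = Y 1 0 -> X 1 1 = Y 1 1 -> X = Y.
  by move=> *; apply/matrixP; apply: ord2P; apply: ord2P.
have nX0 : ~ [/\ X 0 0 = 0, X 0 1 = 0, X 1 0 = 0 & X 1 1 = 0].
  by move=> [h1 h2 h3 h4]; case/eqP: X0; apply: ext; rewrite mxE.
have nX1 : ~ [/\ X 0 0 = 1, X 0 1 = 0, X 1 0 = 0 & X 1 1 = 1].
  by move=> [h1 h2 h3 h4]; case/eqP: X1; apply: ext; rewrite mxE.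
move: nX0 nX1; clear; move: (X 0 0) (X 0 1) (X 1 0) (X 1 1) => a b c d n0 n1 e11 e10 e01 e00.
have [t1|t1] := eqVneq (a + d) 1.
  have -> : d = 1 - a by rewrite -t1; ring.
  by transitivity (a * a + b * c - a * a); [rewrite e00|]; ring.
have t0 : a + d - 1 != 0 by rewrite subr_eq0.
have cancel x : x * (a + d - 1) = 0 -> x = 0.
  by move/eqP; rewrite mulf_eq0 (negPf t0) orbF => /eqP.
have b0 : b = 0 by apply: cancel; transitivity (a * b + b * d - b); [ring|rewrite e01 subrr].
have c0 : c = 0 by apply: cancel; transitivity (c * a + d * c - c); [ring|rewrite e10 subrr].
have ad : a = d.
  apply: subr0_eq; apply: cancel.
  by transitivity ((a * a + b * c - a) - (c * b + d * d - d)); [ring|rewrite e00 e11 !subrr].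
have : a * (a - 1) = 0 by transitivity (a * a + b * c - a); [rewrite b0; ring|rewrite e00 subrr].
move/eqP; rewrite mulf_eq0 subr_eq0 => /orP[/eqP a0|/eqP a1].
  by case: n0; rewrite -ad a0 b0 c0.
by case: n1; rewrite -ad a1 b0 c0.
Qed.

(** A singular matrix is [u *m v] with a column [u] and a row [v], so the middle factor
    [v *m M *m u] is a scalar, namely the trace of [X *m M]. *)
Lemma singular2_sandwich X M : X 0 0 * X 1 1 = X 0 1 * X 1 0 ->
  exists t : F, X *m M *m X = t *: X.
Proof.
move=> dX; exists ((X *m M) 0 0 + (X *m M) 1 1).
have dX' : X 1 1 * X 0 0 = X 0 1 * X 1 0 by rewrite mulrC.
apply/matrixP; apply: ord2P; apply: ord2P; rewrite mulmx2E !(mulmx2E X M) mxE.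
- transitivity (X 0 0 * (X 0 0 * M 0 0 + X 0 1 * M 1 0) + M 0 1 * (X 0 0 * X 1 0) + M 1 1 * (X 0 1 * X 1 0)); [ring|rewrite -dX; ring].
- transitivity (X 0 1 * (X 0 0 * M 0 0 + X 0 1 * M 1 0) + M 0 1 * (X 0 0 * X 1 1) + M 1 1 * (X 0 1 * X 1 1)); [ring|rewrite dX; ring].
- transitivity (X 1 0 * (X 1 0 * M 0 1 + X 1 1 * M 1 1) + M 0 0 * (X 0 0 * X 1 0) + M 1 0 * (X 1 1 * X 0 0)); [ring|rewrite dX'; ring].
- transitivity (X 1 1 * (X 1 0 * M 0 1 + X 1 1 * M 1 1) + M 0 0 * (X 0 1 * X 1 0) + M 1 0 * (X 0 1 * X 1 1)); [ring|rewrite -dX; ring].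
Qed.

Lemma mulmx_delta_neq0 X Y : X != 0 -> Y != 0 -> exists i j, X *m delta_mx i j *m Y != 0.
Proof.
move=> /matrix0Pn[i [k ik]] /matrix0Pn[l [j lj]]; exists k, l.
apply/matrix0Pn; exists i, j; rewrite mxE (bigD1 l)//= big1 => [|l' l'l].
  rewrite addr0 mxE (bigD1 k)//= big1 => [|k' k'k].
    by rewrite addr0 mxE !eqxx mulr1 mulf_neq0.
  by rewrite mxE (negPf k'k) mulr0.
by rewrite mxE big1 ?mul0r// => k' _; rewrite mxE (negPf l'l) andbF mulr0.
Qed.

End TwoByTwo.

(** * Linking primitive idempotents of one component *)

Section Link.
Variables (R : realType) (q : nat) (gT : finGroupType) (r s : gT).
Hypotheses (q_pr : prime q) (q5 : (5 <= q)%N) (dih : is_dihedral q r s).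
Local Notation C := (Cx R).
Local Notation n := (2 * q)%N.
Local Notation w := (omega R n).
Local Notation "a ** b" := (gralg_mul a b) (at level 40, left associativity).
Implicit Types a b e f : gralg gT.

Let q_gt0 : (0 < q)%N. Proof. exact: prime_gt0. Qed.
Let n_gt0 : (0 < n)%N. Proof. by rewrite muln_gt0. Qed.
Let w_prim : n.-primitive_root w. Proof. exact: omega_primitive. Qed.

Section Component.
Variables (j : 'I_6) (rho : mx_representation C [set: gT]%G 2).
Hypotheses (j3 : (3 < j)%N) (rr : rho r = rot_mx R q (1 * (j - 3))) (rs : rho s = swap_mx R).
Local Notation z := (w ^+ (1 * (j - 3))).

(** [z] is [w] or its square, and [w] has order [2 * q], which exceeds 4; so the eigenvalues of
    [rho r] are distinct. *)
Let zz : z - z^-1 != 0.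
Proof.
rewrite subr_eq0; apply/eqP => zV.
have w0 : z != 0.
  apply/eqP => w0; have := omega_half R q_pr; move=> wq.
  have : w != 0 by apply/eqP => ww; move: wq; rewrite ww expr0n gtn_eqF// => /eqP; rewrite eq_sym oppr_eq0 oner_eq0.
  by move=> /(expf_neq0 (1 * (j - 3))); rewrite w0 eqxx.
have : z * z == 1 by rewrite {2}zV mulfV.
rewrite -exprD -(expr0 w) (eq_prim_root_expr w_prim) mod0n modn_small.
  by rewrite mul1n addn_eq0 subn_eq0 leqNgt j3.
rewrite mul1n; have j5 := ltn_ord j.
have jb : (j - 3 <= 2)%N by rewrite leq_subLR -ltnS.
apply: (@leq_ltn_trans (2 + 2)%N); first exact: leq_add.
by apply: (@leq_trans (2 * 5)%N) => //; rewrite leq_mul2l.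
Qed.

Let rotE k l : rho r k l = if k != l then 0 else if k == 0 then z else z^-1.
Proof. by rewrite rr -[rot_mx _ _ _]expr1 rot_mxX mxE !expr1. Qed.

(* The image of rho spans M_2(C), so X rho(g) Y = 0 for all g forces X or Y to vanish. *)
Lemma rep_irreducible (X Y : 'M[C]_2) : X != 0 -> Y != 0 ->
  exists g, X *m rho g *m Y != 0.
Proof.
move=> X0 Y0; apply: contrapT => /forallNP h.
have h' g : X *m rho g *m Y = 0 by apply/eqP; apply/negPn/negP; exact: h.
pose Z (M : 'M[C]_2) := X *m M *m Y = 0.
have ZD M N : Z M -> Z N -> Z (M + N).
  by move=> m1 n1; rewrite /Z mulmxDr mulmxDl m1 n1 addr0.
have ZZ c M : Z M -> Z (c *: M) by move=> m1; rewrite /Z -scalemxAr -scalemxAl m1 scaler0.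
(* As the eigenvalues of [rho r] differ, the matrix units are combinations of the images of [1],
   [r], [s] and [s * r]. *)
have D00 : Z (delta_mx 0 0).
  have -> : delta_mx 0 0 = (z - z^-1)^-1 *: (rho r + (- z^-1) *: rho 1%g).
    apply/matrixP; apply: ord2P; apply: ord2P; rewrite repr_mx1 !mxE !rotE /= ?mulr0 ?addr0 ?mulr1 ?mulVf// ?subrr ?mulr0//.
  by apply: (ZZ); apply: (ZD); [exact: h'|apply: (ZZ); exact: h'].
have D11 : Z (delta_mx 1 1).
  have -> : delta_mx 1 1 = rho 1%g + (- 1) *: delta_mx 0 0 :> 'M[C]_2.
    by apply/matrixP; apply: ord2P; apply: ord2P; rewrite repr_mx1 !mxE /= ?mulr0 ?addr0 ?mulr1 ?subrr.
  by apply: (ZD); [exact: h'|exact: ZZ].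
have swapE k l : rho s k l = (k != l)%:R by rewrite rs mxE.
have sr k l : rho (s * r)%g k l = if k == l then 0 else if l == 0 then z else z^-1.
  rewrite repr_mxM ?inE// mulmx2E !rotE !swapE; move: k l.
  by apply: ord2P; apply: ord2P; rewrite /= ?mul0r ?mul1r ?addr0 ?add0r.
have D10 : Z (delta_mx 1 0).
  have -> : delta_mx 1 0 = (z - z^-1)^-1 *: (rho (s * r)%g + (- z^-1) *: rho s).
    by apply/matrixP; apply: ord2P; apply: ord2P; rewrite !mxE !sr !swapE /= ?mulr0 ?addr0 ?mulr1 ?mulVf// ?subrr ?mulr0.
  by apply: (ZZ); apply: (ZD); [exact: h'|apply: (ZZ); exact: h'].
have D01 : Z (delta_mx 0 1).
  have -> : delta_mx 0 1 = rho s + (- 1) *: delta_mx 1 0 :> 'M[C]_2.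
    by apply/matrixP; apply: ord2P; apply: ord2P; rewrite !mxE !swapE /= ?mulr0 ?addr0 ?mulr1 ?subrr.
  by apply: (ZD); [exact: h'|exact: ZZ].
have [k [l /eqP]] := mulmx_delta_neq0 X0 Y0; apply.
by move: k l; apply: ord2P; apply: ord2P.
Qed.

Variable e : gralg gT.
Hypothesis e_central : central_idempotent R q r s j e.

Let faithful a : e ** a = a -> gralg_rep rho a = 0 -> a = 0.
Proof. by move=> ea; exact (component_faithful q_pr q5 dih j3 e_central ea rr rs). Qed.

Let rho_e : gralg_rep rho e = 1%:M.
Proof.
by rewrite (e_central (ConstituentDeg2 j3 (coprime1n _) rr rs)) eqxx.
Qed.

(* f0 Q[G] f0 is a finite-dimensional algebra whose image under rho is made of
   multiples of the rank-one matrix rho(f0), so it is a field; x is any nonzero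
   element of f0 Q[G] f0', and y is obtained by inverting x y0 in that field. *)
Lemma component_idempotents_linked (f0 f1 f0' f1' : gralg gT) :
  e = f0 + f1 -> e = f0' + f1' ->
  primitive_idempotent f0 -> primitive_idempotent f1 ->
  primitive_idempotent f0' -> primitive_idempotent f1' ->
  f0 ** f1 = 0 -> f1 ** f0 = 0 -> f0' ** f1' = 0 -> f1' ** f0' = 0 ->
  exists x y, [/\ x ** y = f0, y ** x = f0', f0 ** x = x, x ** f0' = x & f0' ** y = y /\ y ** f0 = y].
Proof.
move=> e01 e01' [f0i f0n f0p] [f1i f1n _] [f0'i f0'n f0'p] [f1'i f1'n _] f01 f10 f01' f10'.
have ef0 : e ** f0 = f0 by rewrite e01 gralg_mulDl f0i f10 addr0.
have ef1 : e ** f1 = f1 by rewrite e01 gralg_mulDl f1i f01 add0r.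
have ef0' : e ** f0' = f0' by rewrite e01' gralg_mulDl f0'i f10' addr0.
have F0n : gralg_rep rho f0 != 0 by apply/eqP => /(faithful ef0).
have F1n : gralg_rep rho f1 != 0 by apply/eqP => /(faithful ef1).
have F0'n : gralg_rep rho f0' != 0 by apply/eqP => /(faithful ef0').
have minor : gralg_rep rho f0 0 0 * gralg_rep rho f0 1 1 = gralg_rep rho f0 0 1 * gralg_rep rho f0 1 0.
  apply: idempotent2_minor => //; first by rewrite -gralg_repM f0i.
  apply: contraNneq F1n => F01; have := rho_e; rewrite e01 gralg_repD F01 => /eqP.
  by rewrite -subr_eq0 addrC addKr.
have [g gP] := rep_irreducible F0n F0'n.
pose x := f0 ** gralg_delta g ** f0'.
have rx : gralg_rep rho x = gralg_rep rho f0 *m rho g *m gralg_rep rho f0'.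
  by rewrite !gralg_repM gralg_rep_delta.
have xn : gralg_rep rho x != 0 by rewrite rx.
(* [h] is chosen so that [d = x ** y0] has a nonzero image, which is then a nonzero multiple of the
   image of [f0]. *)
have [h hP] := rep_irreducible xn F0n.
pose y0 := f0' ** gralg_delta h ** f0.
have f0x : f0 ** x = x by rewrite /x -!gralg_mulA f0i.
have xf0' : x ** f0' = x by rewrite /x gralg_mulA f0'i.
have f0'y0 : f0' ** y0 = y0 by rewrite /y0 -!gralg_mulA f0'i.
have y0f0 : y0 ** f0 = y0 by rewrite /y0 gralg_mulA f0i.
have [d dD] : exists d, d = x ** y0 by exists (x ** y0).
have dE : d = x ** gralg_delta h ** f0 by rewrite dD /y0 -!gralg_mulA xf0'.
have dn : gralg_rep rho d != 0 by rewrite dE gralg_repM gralg_repM gralg_rep_delta.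
have f0d : f0 ** d = d by rewrite dD -gralg_mulA f0x.
have [t tP] : exists t : C, gralg_rep rho d = t *: gralg_rep rho f0.
  have [t tP] := singular2_sandwich (rho g *m gralg_rep rho f0' *m rho h) minor.
  exists t; rewrite -tP dE gralg_repM gralg_repM gralg_rep_delta rx.
  by rewrite !mulmxA.
have tn : t != 0 by apply: contraNneq dn => t0; rewrite tP t0 scale0r.
clearbody x y0.
(* The term [u - f0 ** u] extends multiplication by [d] on [f0 Q[G]] to an injective map of all of
   [Q[G]]; left multiplication by [f0] removes it again. *)
have [u uP] : exists u, d ** u + (u - f0 ** u) = f0.
  apply: (@gralg_injective_surjective gT (fun u => d ** u + (u - f0 ** u))).
  - move=> a b; rewrite !gralg_mulDr opprD [a + b + _]addrACA [RHS]addrACA.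
    by [].
  - by move=> k a; rewrite !gralg_scaleD; apply/ffunP => g'; rewrite !ffunE mulrDr mulrBr.
  - move=> a La; have da : d ** a = 0.
      have := congr1 (gralg_mul f0) La.
      by rewrite gralg_mulDr gralg_mulBr -!gralg_mulA f0d f0i subrr addr0 gralg_mul0r.
    have fa : f0 ** a = a by move: La; rewrite da add0r => /eqP; rewrite subr_eq0 eq_sym => /eqP.
    apply: faithful; first by rewrite -fa -gralg_mulA ef0.
    have := congr1 (gralg_rep rho) da; rewrite gralg_repM tP gralg_rep0 -scalemxAl -gralg_repM fa.
    by move/eqP; rewrite scaler_eq0 (negPf tn) => /eqP.
have du : d ** u = f0.
  have := congr1 (gralg_mul f0) uP.
  by rewrite gralg_mulDr gralg_mulBr -!gralg_mulA f0d f0i subrr addr0.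
have [y yD] : exists y, y = y0 ** u ** f0 by exists (y0 ** u ** f0).
have xy : x ** y = f0 by rewrite yD -!gralg_mulA -dD du f0i.
have f0'y : f0' ** y = y by rewrite yD -!gralg_mulA f0'y0.
have yf0 : y ** f0 = y by rewrite yD gralg_mulA f0i.
exists x, y; split=> //.
(* [y ** x] is an idempotent below [f0']. It is not 0 because [f0] is not, so primitivity of [f0']
   forces equality. *)
have [k kD] : exists k, k = y ** x by exists (y ** x).
have kk : k ** k = k by rewrite kD gralg_mulA -[x ** (y ** x)]gralg_mulA xy f0x.
have f0'k : f0' ** k = k by rewrite kD -gralg_mulA f0'y.
have kf0' : k ** f0' = k by rewrite kD gralg_mulA xf0'.
have kB : (f0' - k) ** (f0' - k) = f0' - k.
  by rewrite gralg_mulBl !gralg_mulBr f0'i f0'k kf0' kk subrr subr0.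
have [k0|k0] : k = 0 \/ f0' - k = 0.
- apply: f0'p => //.
  + by rewrite gralg_mulBr kf0' kk subrr.
  + by rewrite gralg_mulBl f0'k kk subrr.
  + by rewrite addrC subrK.
- case: f0n; rewrite -f0i -{1}xy -[in X in _ ** X]xy gralg_mulA -[y ** (x ** y)]gralg_mulA -kD k0.
  by rewrite gralg_mul0l gralg_mul0r.
- by rewrite -kD; apply/esym/subr0_eq.
Qed.

End Component.
End Link.

(** * Transport along an automorphism of the group *)

Section Transport.
Variables (gT : finGroupType) (alpha beta : gT -> gT).
Hypotheses (alphaM : {morph alpha : g h / (g * h)%g}) (alphaK : cancel alpha beta)
  (betaK : cancel beta alpha).
Implicit Types a b : gralg gT.
Local Notation "a ** b" := (gralg_mul a b) (at level 40, left associativity).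

(** Precomposition reverses the direction: [gralg_map beta] is the linear extension of [alpha], the
    inverse of [beta]. *)
Definition gralg_map (f : gT -> gT) a : gralg gT := [ffun g => a (f g)].

Let alphaV g : alpha g^-1%g = (alpha g)^-1%g.
Proof.
have a1 : alpha 1%g = 1%g by apply: (mulgI (alpha 1%g)); rewrite -alphaM !mulg1.
by apply: (mulgI (alpha g)); rewrite -alphaM !mulgV.
Qed.

Lemma gralg_map_mul a b : gralg_map alpha (a ** b) = gralg_map alpha a ** gralg_map alpha b.
Proof.
apply/ffunP => g; rewrite !ffunE (reindex alpha) /=; last by exists beta => h _.
by apply: eq_bigr => h _; rewrite !ffunE alphaM alphaV.
Qed.

Lemma gralg_mapD a b : gralg_map alpha (a + b) = gralg_map alpha a + gralg_map alpha b.
Proof. by apply/ffunP => g; rewrite !ffunE. Qed.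

Lemma gralg_map0 : gralg_map alpha 0 = 0.
Proof. by apply/ffunP => g; rewrite !ffunE. Qed.

Lemma gralg_mapK : cancel (gralg_map beta) (gralg_map alpha).
Proof. by move=> a; apply/ffunP => g; rewrite !ffunE alphaK. Qed.

Lemma sum_gralg_map (K : numFieldType) (V : lmodType K) (F : gT -> V) a :
  \sum_g (ratr (gralg_map beta a g) : K) *: F g = \sum_g (ratr (a g) : K) *: F (alpha g).
Proof.
rewrite (reindex alpha) /=; last by exists beta => h _.
by apply: eq_bigr => g _; rewrite ffunE alphaK.
Qed.

End Transport.

Lemma gralg_map_primitive (gT : finGroupType) (alpha beta : gT -> gT) (f : gralg gT) :
  {morph alpha : g h / (g * h)%g} -> cancel alpha beta -> cancel beta alpha ->
  primitive_idempotent f -> primitive_idempotent (gralg_map beta f).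
Proof.
move=> alphaM alphaK betaK [fi fn fp].
have betaM : {morph beta : g h / (g * h)%g}.
  by move=> g h; apply: (can_inj alphaK); rewrite alphaM !betaK.
have mapM := gralg_map_mul betaM betaK alphaK; have mapM' := gralg_map_mul alphaM alphaK betaK.
have mapK := gralg_mapK betaK; have mapK' := gralg_mapK alphaK.
split.
- by rewrite /is_idempotent -mapM fi.
- by move=> f0; apply: fn; rewrite -(mapK' f) f0 gralg_map0.
- move=> a b ai bi ab ba fab.
  have [| | | | |a0|b0] := fp (gralg_map alpha a) (gralg_map alpha b).
  + by rewrite /is_idempotent -mapM' ai.
  + by rewrite /is_idempotent -mapM' bi.
  + by rewrite -mapM' ab gralg_map0.
  + by rewrite -mapM' ba gralg_map0.
  + by rewrite -gralg_mapD -fab mapK'.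
  + by left; rewrite -(mapK a) a0 gralg_map0.
  + by right; rewrite -(mapK b) b0 gralg_map0.
Qed.

Section Twist.
Variables (R : realType) (q : nat) (gT : finGroupType) (r s : gT).
Hypotheses (q_pr : prime q) (q5 : (5 <= q)%N) (dih : is_dihedral q r s).
Local Notation C := (Cx R).
Local Notation n := (2 * q)%N.
Local Notation w := (omega R n).
Variables (alpha beta : gT -> gT).
Hypotheses (alphaM : {morph alpha : g h / (g * h)%g}) (alphaK : cancel alpha beta)
  (betaK : cancel beta alpha).

Let q_gt0 : (0 < q)%N. Proof. exact: prime_gt0. Qed.
Let n_gt0 : (0 < n)%N. Proof. by rewrite muln_gt0. Qed.
Let w_prim : n.-primitive_root w. Proof. exact: omega_primitive. Qed.

Let alpha1 : alpha 1%g = 1%g.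
Proof. by apply: (mulgI (alpha 1%g)); rewrite -alphaM !mulg1. Qed.

Let alphaX g k : alpha (g ^+ k)%g = (alpha g ^+ k)%g.
Proof. by elim: k => [|k ih]; rewrite ?expg0 // !expgS alphaM ih. Qed.

Let r2 : (r ^+ 2)%g != 1%g.
Proof.
rewrite -order_dvdn (dihedral_order_r q_gt0 dih); apply/negP => n2.
have := dvdn_leq (isT : (0 < 2)%N) n2; rewrite leqNgt => /negP; apply.
by rewrite (leq_trans _ (leq_mul (leqnn 2) q5)).
Qed.

Lemma automorphism_rotation : exists2 k, odd k && coprime k n & alpha r = (r ^+ k)%g.
Proof.
have [[|] [k ar]] := dihedral_eltP q_gt0 dih (alpha r).
  case/eqP: r2; apply: (can_inj alphaK); rewrite alpha1 alphaX ar expg1.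
  by rewrite expgS expg1 (dihedral_reflection dih).
rewrite expg0 mul1g in ar; exists k => //.
have kn : coprime k n.
  rewrite /coprime -(eqn_pmul2l n_gt0) muln1.
  have := orderXgcd r k; rewrite (dihedral_order_r q_gt0 dih) -ar.
  have -> : #[alpha r]%g = n.
    rewrite -(dihedral_order_r q_gt0 dih); apply/eqP; rewrite eqn_dvd !order_dvdn.
    rewrite -alphaX expg_order alpha1 eqxx /=.
    by apply/eqP/(can_inj alphaK); rewrite alphaX expg_order alpha1.
  move=> e; have := divnK (dvdn_gcdl n k); rewrite -e gcdnC.
  by move=> ->.
by rewrite kn andbT; move: kn; rewrite coprimeMr coprimen2 => /andP[].
Qed.

Lemma automorphism_reflection : exists k, alpha s = (s * r ^+ k)%g.
Proof.
have [k _ ar] := automorphism_rotation.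
have [[|] [l al]] := dihedral_eltP q_gt0 dih (alpha s); first by exists l.
rewrite expg0 mul1g in al; case/eqP: r2.
have c : (s * r = r * s)%g.
  by apply: (can_inj alphaK); rewrite !alphaM ar al -!expgD addnC.
have := dihedral_rsr dih; rewrite -mulgA c mulgA => e.
by apply: (mulIg s); rewrite mul1g expgS expg1.
Qed.

Lemma sign_odd_exp (b : nat) k : odd k -> (((-1) ^+ b) ^+ k = (-1) ^+ b :> C).
Proof. by move=> ok; rewrite -exprM -signr_odd oddM ok andbT signr_odd. Qed.

(** [constituent] prescribes matrices and not an isomorphism class, so the representation composed
    with [alpha] has to be conjugated back by some [T]. *)
Lemma twisted_rep d (rho : mx_representation C [set: gT]%G d) (T T' : 'M[C]_d) :
  T *m T' = 1%:M -> exists rho' : mx_representation C [set: gT]%G d,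
    forall g, rho' g = T' *m rho (alpha g) *m T.
Proof.
move=> TT; have TT' : T' *m T = 1%:M by exact: mulmx1C.
have H : mx_repr [set: gT]%G (fun g => T' *m rho (alpha g) *m T).
  split; first by rewrite alpha1 repr_mx1 mulmx1.
  move=> g h _ _; rewrite alphaM repr_mxM ?inE//.
  by rewrite !mulmxA -[T' *m rho (alpha g) *m T *m T']mulmxA TT mulmx1.
by exists (MxRepresentation H).
Qed.

Lemma gralg_rep_twisted d (rho rho' : mx_representation C [set: gT]%G d) (T T' : 'M[C]_d) a :
  (forall g, rho' g = T' *m rho (alpha g) *m T) ->
  gralg_rep rho' a = T' *m gralg_rep rho (gralg_map beta a) *m T.
Proof.
move=> rE; rewrite /gralg_rep (sum_gralg_map alphaK betaK) mulmx_sumr mulmx_suml.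
by apply: eq_bigr => g _; rewrite rE -scalemxAr -scalemxAl.
Qed.

Lemma central_idempotent_twist : exists tau : 'S_6,
  [/\ forall j, multiplicity (tau j) = multiplicity j, forall j, tau (tau j) = j &
      forall j e, central_idempotent R q r s j e ->
        central_idempotent R q r s (tau j) (gralg_map beta e)].
Proof.
have [k /andP[ok kn] ar] := automorphism_rotation; have [l asl] := automorphism_reflection.
pose o2 : 'I_6 := inord 2; pose o3 : 'I_6 := inord 3.
have o2E : o2 = 2%N :> nat by rewrite inordK.
have o3E : o3 = 3%N :> nat by rewrite inordK.
(* [o2] and [o3] are the indices of [W_3] and [W_4], where [r] acts as -1; passing from [s] to
   [s * r ^+ l] multiplies the value by [(-1) ^+ l]. *)
pose tau : 'S_6 := if odd l then tperm o2 o3 else 1%g.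
have tauK j : tau (tau j) = j by rewrite /tau; case: ifP => _; rewrite ?tpermK ?perm1.
have tau4 j : (tau j < 4)%N = (j < 4)%N.
  by rewrite /tau; case: ifP => _; rewrite ?perm1//; case: tpermP => [->|->|//]; rewrite o2E o3E.
exists tau; split=> //; first by move=> j; rewrite /multiplicity tau4.
move=> j e ej i d rho ci.
suff [rho' [T [T' [TT rE ci']]]] : exists (rho' : mx_representation C [set: gT]%G d) (T T' : 'M[C]_d),
    [/\ T *m T' = 1%:M, forall g, rho' g = T' *m rho (alpha g) *m T & constituent q r s (tau i) rho'].
  have TT' : T' *m T = 1%:M by exact: mulmx1C.
  have := gralg_rep_twisted e rE; rewrite (ej _ _ _ ci') => h.
  have -> : gralg_rep rho (gralg_map beta e) = T *m (T' *m gralg_rep rho (gralg_map beta e) *m T) *m T'.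
    by rewrite !mulmxA TT mul1mx -mulmxA TT mulmx1.
  rewrite -h mul_mx_scalar -scalemxAl TT scalemx1; congr (_%:R)%:M.
  by rewrite -{2}(tauK i) (inj_eq perm_inj).
case: d rho / ci => [rho i4 rr rs|m rho i4 mn rr rs].
  have [rho' rE] := @twisted_rep 1 rho 1%:M 1%:M (mulmx1 _).
  exists rho', 1%:M, 1%:M; split=> //; first exact: mulmx1.
  have rr' : rho' r = ((-1) ^+ i./2)%:M.
    by rewrite rE mul1mx mulmx1 ar repr_mx_exp rr -rmorphXn /= sign_odd_exp.
  have rs' : rho' s = ((-1) ^+ (i + i./2 * l))%:M.
    by rewrite rE mul1mx mulmx1 asl repr_mxM ?inE// repr_mx_exp rs rr -rmorphXn /= -scalar_mxM -exprM -exprD.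
  apply: ConstituentDeg1; rewrite ?tau4// ?rr' ?rs'; congr (_%:M).
    rewrite /tau; case: ifP => _; rewrite ?perm1//.
    by case: tpermP => [->|->|//]; rewrite o2E o3E.
  rewrite -[LHS]signr_odd -[RHS]signr_odd oddD oddM /tau; case: ifP => ol; last first.
    by rewrite andbF addbF perm1.
  rewrite andbT; case: tpermP => [->|->|n2 n3]; rewrite ?o2E ?o3E//.
  have : i != 2%N :> nat by apply/eqP => e2; apply: n2; apply: val_inj; rewrite /= o2E.
  have : i != 3%N :> nat by apply/eqP => e3; apply: n3; apply: val_inj; rewrite /= o3E.
  by move: i4; case: (val i) => [|[|[|[|]]]].
have taui : tau i = i.
  rewrite /tau; case: ifP => _; rewrite ?perm1//.
  by case: tpermP => [ei|ei|//]; move: i4; rewrite ei ?o2E ?o3E.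
pose z := w ^+ (m * (i - 3)).
have z0 : z != 0.
  apply/eqP => zz0; have := omega_half R q_pr => wq.
  have : w != 0.
    by apply/eqP => ww; move: wq; rewrite ww expr0n gtn_eqF// => /eqP; rewrite eq_sym oppr_eq0 oner_eq0.
  by move=> /(expf_neq0 (m * (i - 3))); rewrite -/z zz0 eqxx.
(* Conjugation by [D (z ^+ l)] fixes diagonal matrices and turns the image of [s * r ^+ l] back into
   the swap matrix. *)
pose D (x : C) : 'M[C]_2 := \matrix_(u, v) (if u != v then 0 else if u == 0 then 1 else x).
pose simp := (@mul0r C, @mulr0 C, @mulr1 C, @mul1r C, @addr0 C, @add0r C).
have DD x y : D x *m D y = D (x * y).
  by apply/matrixP; apply: ord2P; apply: ord2P; rewrite mulmx2E !mxE /= ?mul0r ?mulr0 ?mulr1 ?addr0 ?add0r.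
have D1 : D 1 = 1%:M by apply/matrixP; apply: ord2P; apply: ord2P; rewrite !mxE /= ?mulr1n.
have DDV : D (z ^+ l) *m D (z ^+ l)^-1 = 1%:M.
  by rewrite DD mulfV; [exact: D1|exact: expf_neq0].
have zl : z ^+ l != 0 by exact: expf_neq0.
have [rho' rE] := @twisted_rep 2 rho _ _ DDV.
exists rho', (D (z ^+ l)), (D (z ^+ l)^-1); split=> //.
(* As [r] goes to [r ^+ k], the conjugate with parameter [m] becomes the one with [m * k]. *)
rewrite taui; apply: (@ConstituentDeg2 R q gT r s i (m * k)) => //.
- by rewrite coprimeMl mn kn.
- rewrite rE ar repr_mx_exp rr rot_mxX -/z -[rot_mx _ _ _]expr1 rot_mxX.
  have -> : w ^+ (m * k * (i - 3)) = z ^+ k by rewrite -exprM mulnAC.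
  apply/matrixP; apply: ord2P; apply: ord2P; rewrite mulmx2E !mulmx2E !mxE /= ?expr1; do ?rewrite !simp //.
  by rewrite mulrAC (mulVf zl) mul1r exprVn.
- rewrite rE asl repr_mxM ?inE// repr_mx_exp rr rs rot_mxX -/z.
  apply/matrixP; apply: ord2P; apply: ord2P; rewrite mulmx2E !mulmx2E !mxE /=; do ?rewrite !simp //.
    by rewrite exprVn (mulVf zl).
  by rewrite (mulVf zl).
Qed.

End Twist.

(** * Isogenies between the factors *)

(** In degree one both idempotents equal the central one, which is unique; the other components are
    covered by [component_idempotents_linked]. *)
Lemma idempotents_linked (R : realType) (q : nat) (gT : finGroupType) (r s : gT)
    (j : 'I_6) (e e' : gralg gT) (f f' : nat -> gralg gT) :
  prime q -> (5 <= q)%N -> is_dihedral q r s ->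
  central_idempotent R q r s j e -> central_idempotent R q r s j e' ->
  e = \sum_(k < multiplicity j) f k -> e' = \sum_(k < multiplicity j) f' k ->
  (forall k, (k < multiplicity j)%N -> primitive_idempotent (f k)) ->
  (forall k, (k < multiplicity j)%N -> primitive_idempotent (f' k)) ->
  (forall k k', (k < multiplicity j)%N -> (k' < multiplicity j)%N -> k <> k' ->
     gralg_mul (f k) (f k') = 0) ->
  (forall k k', (k < multiplicity j)%N -> (k' < multiplicity j)%N -> k <> k' ->
     gralg_mul (f' k) (f' k') = 0) ->
  exists x y, [/\ gralg_mul x y = f 0%N, gralg_mul y x = f' 0%N,
    gralg_mul (f 0%N) x = x, gralg_mul x (f' 0%N) = x &
    gralg_mul (f' 0%N) y = y /\ gralg_mul y (f 0%N) = y].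
Proof.
move=> q_pr q5 dih ej e'j; have ee' := central_idempotent_unique q_pr q5 dih ej e'j.
rewrite /multiplicity; case: ltnP => j4 fs f's fp f'p fo f'o.
  rewrite big_ord_recl big_ord0 addr0 /= in fs; rewrite big_ord_recl big_ord0 addr0 /= in f's.
  have ff : f 0%N = f' 0%N by rewrite -fs -f's.
  have [fi _ _] := fp 0%N isT.
  by exists (f 0%N), (f 0%N); rewrite -ff !fi.
rewrite !big_ord_recl big_ord0 addr0 /= in fs; rewrite !big_ord_recl big_ord0 addr0 /= in f's.
have [rho [rr rs]] := rep2_exists R q_pr dih (1 * (j - 3)).
rewrite -ee' in f's.
apply: (component_idempotents_linked q_pr q5 dih j4 rr rs ej fs f's);
  by [exact: fp|exact: f'p|exact: fo|exact: f'o].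
Qed.

Section GroupAction.
Variables (R : realType) (S : riemann_surface R) (gT : finGroupType) (psi : gT -> S -> S).
Hypothesis psi_iso : iso_Aut psi.
Local Notation C := (Cx R).
Local Notation E := (holo_form S -> C : lmodType C).
Local Notation J := (jacobian_torus S).
Local Notation P := (Phi psi).
Implicit Types (a b : gralg gT) (L t : E).

Let psi_Aut g : surface_Aut S (psi g).
Proof. by have [_ _ <-] := psi_iso; exists g. Qed.

Lemma Phi_mul a b L : P (gralg_mul a b) L = P a (P b L).
Proof.
rewrite /Phi (@sum_gralg_mul gT C E (fun g => jac_push (psi g) L)).
apply: eq_bigr => g _; apply/funext => w.
have jE : jac_push (psi g) (\sum_h (ratr (b h) : C) *: (jac_push (psi h) L : E)) w =
    \sum_h ratr (b h) * jac_push (psi g) (jac_push (psi h) L) w.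
  by rewrite /jac_push fct_sumE.
rewrite -[RHS]/(ratr (a g) * _) jE mulr_sumr fct_sumE; apply: eq_bigr => h _.
have [psiM _ _] := psi_iso.
have pc : jac_push (psi (g * h)%g) L = jac_push (psi g) (jac_push (psi h) L).
  rewrite psiM; apply: jac_push_comp; try exact: surface_Aut_holo.
  by rewrite -psiM; exact: surface_Aut_holo.
by rewrite pc; exact: (esym (mulrA _ _ _)).
Qed.

Lemma Phi_mulrn a n L : P (a *+ n) L = n%:R *: P a L.
Proof.
rewrite /Phi scaler_sumr; apply: eq_bigr => g _.
by rewrite ffunMnE rmorphMn /= scalerA mulr_natl.
Qed.

Lemma Phi_linear a (c : C) L1 L2 : P a (c *: L1 + L2) = c *: P a L1 + P a L2.
Proof.
rewrite /Phi scaler_sumr -big_split; apply: eq_bigr => g _.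
apply/funext => w; pose u := pullback (psi g) w.
rewrite -[LHS]/(ratr (a g) * (c * L1 u + L2 u)).
by rewrite -[RHS]/(c * (ratr (a g) * L1 u) + ratr (a g) * L2 u); ring.
Qed.

Lemma Phi0 a : P a 0 = 0.
Proof. by have := Phi_linear a (-1) 0 0; rewrite !scaleN1r !addNr. Qed.

Lemma PhiZ a (c : C) L : P a (c *: L) = c *: P a L.
Proof. by rewrite -[c *: L]addr0 Phi_linear Phi0 addr0. Qed.

Lemma tangent_linear (c : C) L1 L2 : tangent J L1 -> tangent J L2 -> tangent J (c *: L1 + L2).
Proof.
move=> l1 l2 k w1 w2; rewrite -[LHS]/(c * L1 _ + L2 _) l1 l2.
by rewrite -[(c *: L1 + L2) w1]/(c * L1 w1 + L2 w1) -[(c *: L1 + L2) w2]/(c * L1 w2 + L2 w2) /=; ring.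
Qed.

Lemma tangent0 : tangent J (0 : E).
Proof. by move=> k w1 w2; rewrite -[LHS]/(0 : C) -[RHS]/(k * 0 + 0 : C) mulr0 addr0. Qed.

Lemma tangentZ (c : C) L : tangent J L -> tangent J (c *: L).
Proof. by move=> l; rewrite -[c *: L]addr0; apply: tangent_linear => //; exact: tangent0. Qed.

Lemma Phi_tangent a L : tangent J L -> tangent J (P a L).
Proof.
move=> l; rewrite /Phi; apply: (big_ind (fun t : E => tangent J t)) => [|L1 L2 l1 l2|g _].
- exact: tangent0.
- by rewrite -[L1]scale1r; exact: tangent_linear.
- by apply: tangentZ; apply: jac_push_tangent => //; exact: surface_Aut_holo.
Qed.

Lemma Phi_lattice a L : (forall g, exists n : int, a g = n%:~R) ->
  lattice J L -> lattice J (P a L).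
Proof.
move=> ai l; rewrite /Phi; apply: (big_ind (fun t : E => lattice J t)) => [|L1 L2|g _].
- exact: lattice_zero.
- exact: lattice_add.
- have [n ->] := ai g; rewrite ratr_int scaler_int; apply: lattice_mulz.
  exact: lattice_push.
Qed.

(** [l] is invertible in the complex numbers, so on tangent spaces the image of [f *+ l] is that of
    the projection [P f]. *)
Lemma tangent_im f l t : is_idempotent f -> (0 < l)%N ->
  tangent (im_torus J (P (f *+ l))) t <-> tangent J t /\ P f t = t.
Proof.
move=> fi l0; have ln : (l%:R : C) != 0 by rewrite pnatr_eq0 -lt0n.
split=> [[L lL <-]|[tt ft]].
  split; first exact: Phi_tangent.
  by rewrite -Phi_mul gralg_mulnr fi.
exists (l%:R^-1 *: t); first exact: tangentZ.
by rewrite Phi_mulrn PhiZ ft scalerA mulfV// scale1r.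
Qed.

Section Linked.
Variables (f f' x y : gralg gT) (l l' : nat).
Hypotheses (fi : is_idempotent f) (f'i : is_idempotent f') (l0 : (0 < l)%N) (l'0 : (0 < l')%N).
Hypotheses (xy : gralg_mul x y = f) (yx : gralg_mul y x = f').
Hypotheses (fx : gralg_mul f x = x) (f'y : gralg_mul f' y = y).
Local Notation B := (im_torus J (P (f *+ l))).
Local Notation B' := (im_torus J (P (f' *+ l'))).

Let y_tangent t : tangent J t -> tangent B' (P y t).
Proof. by move=> tt; apply/(tangent_im _ f'i l'0); split; [exact: Phi_tangent|rewrite -Phi_mul f'y]. Qed.

Let x_tangent t : tangent J t -> tangent B (P x t).
Proof. by move=> tt; apply/(tangent_im _ fi l0); split; [exact: Phi_tangent|rewrite -Phi_mul fx]. Qed.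

Let tangentBZ (c : C) t : tangent B t -> tangent B (c *: t).
Proof.
move=> /(tangent_im _ fi l0)[tt ft]; apply/(tangent_im _ fi l0).
by split; [exact: tangentZ|rewrite PhiZ ft].
Qed.

Let tangentB'Z (c : C) t : tangent B' t -> tangent B' (c *: t).
Proof.
move=> /(tangent_im _ f'i l'0)[tt ft]; apply/(tangent_im _ f'i l'0).
by split; [exact: tangentZ|rewrite PhiZ ft].
Qed.

Let tangentB0 : tangent B (0 : E).
Proof. by apply/(tangent_im _ fi l0); split; [exact: tangent0|exact: Phi0]. Qed.

Let tangentB'0 : tangent B' (0 : E).
Proof. by apply/(tangent_im _ f'i l'0); split; [exact: tangent0|exact: Phi0]. Qed.

Lemma linked_nonzero : nonzero B -> nonzero B'.
Proof.
move=> [t tB t0]; have [tt ft] := (tangent_im t fi l0).1 tB.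
exists (P y t); first exact: y_tangent.
by apply: contra_neq t0 => yt; rewrite -ft -xy Phi_mul yt Phi0.
Qed.

Lemma linked_isogenous : compact [set: S] -> isogenous B B'.
Proof.
move=> cS; have [N N0 yN] := integral_multiple y; have [M M0 xM] := integral_multiple x.
have NC : (N%:R : C) != 0 by rewrite pnatr_eq0 -lt0n.
have MNC : ((M * N)%:R : C) != 0 by rewrite pnatr_eq0 -lt0n muln_gt0 M0.
have tanJ t : tangent B t -> tangent J t by move=> /(tangent_im _ fi l0)[].
have comeback t : tangent B t -> P (x *+ M) (P (y *+ N) t) = (M * N)%:R *: t.
  move=> /(tangent_im _ fi l0)[_ ft].
  by rewrite -Phi_mul gralg_mulnl gralg_mulnr xy -mulrnA Phi_mulrn ft mulnC.
have tangentBB t u : tangent B t -> tangent B u -> tangent B (t - u).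
  move=> /(tangent_im _ fi l0)[tt ft] /(tangent_im _ fi l0)[tu fu].
  have -> : t - u = (-1) *: u + t by rewrite scaleN1r addrC.
  apply/(tangent_im _ fi l0); split; first exact: tangent_linear.
  by rewrite Phi_linear ft fu.
exists (P (y *+ N)); split.
- split.
  + by move=> c t u _ _; exact: Phi_linear.
  + by move=> t /tanJ tt; rewrite Phi_mulrn; apply: tangentB'Z; exact: y_tangent.
  + move=> t [/tanJ tt lt]; split; last exact: Phi_lattice.
    by rewrite Phi_mulrn; apply: tangentB'Z; exact: y_tangent.
(* Surjectivity holds already on tangent spaces, so the lattice element is 0. *)
- move=> t tB'; have [tt ft] := (tangent_im t f'i l'0).1 tB'.
  exists (N%:R^-1 *: P x t); first by apply: tangentBZ; exact: x_tangent.
  rewrite Phi_mulrn PhiZ scalerA mulfV// scale1r -Phi_mul yx ft subrr.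
  by split; [exact: tangentB'0|exact: lattice_zero].
(* For [t] in the kernel, [M * N] times [t] is a lattice vector of [B]. Representatives of these
   vectors modulo [M * N], divided by [M * N], represent the kernel. *)
- have [ks ksP] := lattice_finitely_generated cS.
  have [||||X [XB XP]] := @subgroup_mod_finite E (fun v => lattice B v) ks (M * N).
  + by rewrite muln_gt0 M0.
  + by split; [exact: tangentB0|exact: lattice_zero].
  + move=> v u [vB vl] [uB ul]; split; [exact: tangentBB|exact: lattice_sub].
  + by move=> v [_ vl]; exact: ksP.
  exists [seq (M * N)%:R^-1 *: (v : E) | v <- X] => t tB [_ Flat].
  have lt : lattice B ((M * N)%:R *: t).
    split; first exact: tangentBZ.
    by rewrite -comeback//; exact: Phi_lattice.
  have [v vX [g gB e]] := XP _ lt.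
  exists ((M * N)%:R^-1 *: v); first exact: map_f.
  have -> : t - (M * N)%:R^-1 *: v = g; last by [].
  apply: (scalerI MNC); rewrite scalerBr scalerA mulfV// scale1r e.
  by rewrite scaler_nat.
Qed.

End Linked.
End GroupAction.

Theorem theorem3 (R : realType) (q : nat) (gT : finGroupType) (r s : gT)
    (gamma lambda : Cx R) (S : riemann_surface R) (p : S -> option (Cx R))
    (sigma sigma' : 'I_4 -> gT) (psi psi' : gT -> S -> S)
    (B B' : 'I_6 -> torus (holo_form S -> Cx R : lmodType (Cx R))) :
  prime q -> (5 <= q)%N -> is_dihedral q r s ->
  gamma ^+ 3 = -1 -> gamma <> -1 -> Omega gamma lambda ->
  is_S_lambda q r s lambda p ->
  generating_vector q sigma -> represents lambda p sigma psi ->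
  generating_vector q sigma' -> represents lambda p sigma' psi' ->
  group_algebra_decomposition q r s psi B ->
  group_algebra_decomposition q r s psi' B' ->
  exists tau : 'S_6, forall j : 'I_6,
    (nonzero (B j) <-> nonzero (B' (tau j))) /\
    (nonzero (B j) -> multiplicity (tau j) = multiplicity j /\
                      isogenous (B j) (B' (tau j))).
Proof.
move=> q_pr q5 dih _ _ _ [cS _ _ _ _] _ [psi_iso _] _ [psi'_iso _].
move=> [[e [f [l [ec ef fp fo fB]]]] _] [[e' [f' [l' [e'c e'f f'p f'o f'B]]]] _].
have [psiM psi_inj psi_range] := psi_iso; have [psi'M psi'_inj psi'_range] := psi'_iso.
have ex_alpha g : exists h, psi h = psi' g.
  have : range psi (psi' g) by rewrite psi_range -psi'_range; exists g.
  by case=> h _ <-; exists h.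
have ex_beta g : exists h, psi' h = psi g.
  have : range psi' (psi g) by rewrite psi'_range -psi_range; exists g.
  by case=> h _ <-; exists h.
have [alpha alphaP] := choice ex_alpha; have [beta betaP] := choice ex_beta.
have alphaM : {morph alpha : g h / (g * h)%g}.
  by move=> g h; apply: psi_inj; rewrite psiM !alphaP psi'M.
have alphaK : cancel alpha beta by move=> g; apply: psi'_inj; rewrite betaP alphaP.
have betaK : cancel beta alpha by move=> g; apply: psi_inj; rewrite alphaP betaP.
have betaM : {morph beta : g h / (g * h)%g}.
  by move=> g h; apply: psi'_inj; rewrite psi'M !betaP psiM.
(* From here on only the action [psi] occurs; the second decomposition is moved to it by
   transporting its idempotents. *)
have PhiE a : Phi psi' a = Phi psi (gralg_map beta a).
  apply/funext => L; rewrite /Phi.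
  rewrite (@sum_gralg_map _ _ _ alphaK betaK _ _ (fun g => jac_push (psi g) L)).
  by apply: eq_bigr => g _; rewrite alphaP.
have [tau [tau_mult tauK tau_central]] :=
  central_idempotent_twist R q_pr q5 dih alphaM alphaK betaK.
exists tau => j; pose i := tau j.
have mij : multiplicity i = multiplicity j by exact: tau_mult.
have mapMn a n : gralg_map beta (a *+ n) = gralg_map beta a *+ n.
  by apply/ffunP => g; rewrite ffunMnE !ffunE ffunMnE.
have mapM := gralg_map_mul betaM betaK alphaK.
(* [tau] is an involution, so transporting the idempotent of index [tau j] gives that of index
   [j]. *)
have c2 : central_idempotent R q r s j (gralg_map beta (e' i)).
  by rewrite -(tauK j); exact: tau_central.
have s2 : gralg_map beta (e' i) = \sum_(k < multiplicity j) gralg_map beta (f' i k).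
  rewrite e'f mij; apply: (big_morph (gralg_map beta)); last exact: gralg_map0.
  exact: gralg_mapD.
have p2 k : (k < multiplicity j)%N -> primitive_idempotent (gralg_map beta (f' i k)).
  by move=> kj; apply: gralg_map_primitive alphaM alphaK betaK _; apply: f'p; rewrite mij.
have o2 k k' : (k < multiplicity j)%N -> (k' < multiplicity j)%N -> k <> k' ->
    gralg_mul (gralg_map beta (f' i k)) (gralg_map beta (f' i k')) = 0.
  by move=> kj k'j kk; rewrite -mapM f'o ?mij// gralg_map0.
have [x [y [xy yx fx xf [f'y yf]]]] := idempotents_linked q_pr q5 dih (ec j) c2 (ef j) s2
  (fp j) p2 (fo j) o2.
have m0 : (0 < multiplicity j)%N by rewrite /multiplicity; case: ifP.
have [fi _ _] := fp j 0%N m0; have [f'i _ _] := p2 0%N m0.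
have [l0 _ BE] := fB j; have [l'0 _ B'E] := f'B i.
rewrite PhiE mapMn in B'E; rewrite -/i BE B'E.
split.
  (* The converse exchanges the roles of [x] and [y]. *)
  split; first exact: (linked_nonzero psi_iso fi f'i l0 l'0 xy f'y).
  exact: (linked_nonzero psi_iso f'i fi l'0 l0 yx fx).
by move=> _; split; [exact: mij|exact: (linked_isogenous psi_iso fi f'i l0 l'0 xy yx fx f'y cS)].
Qed.
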